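(* Let $X$ be a Banach space, let $A:D(A)\subset X\to X$ generate a $C_0$-semigroup of contractions $S(t)$ on $X$, let $X_1$ be $D(A)$ with the graph norm, and let $J$ be the duality map of $X$. Let $\mathcal B\in\mathcal L(X_1,X)$ be such that, for some $T>0$: (m1) there exists $M>0$ such that $\int_0^T\|\mathcal BS(t)y\|_X\,dt\le M\|y\|_X$ for all $y\in D(A)$; (m2) there exists $\delta>0$ such that for every $y\in D(A)$ and every selection $\phi(t)\in J(S(t)y)$, $t\in[0,T]$, $$\int_0^T\mathrm{Re}\,\langle\mathcal BS(t)y,\phi(t)\rangle\,dt\ge\delta\|y\|_X^2;$$ (m3) there are constants $k_1,k_2\ge0$ such that for all $y,z\in D(A)$ there exists $(y^*,z^* )\in J(y)\times J(z)$ with $$|\langle\mathcal By,y^*\rangle-\langle\mathcal Bz,z^*\rangle|\le k_1\big(\|y\|_{D(\mathcal B)}+\|z\|_{D(\mathcal B)}\big)\|y-z\|_X+k_2\big(\|y\|_X+\|z\|_X\big)\|y-z\|_{D(\mathcal B)},$$ where $\|y\|_{D(\mathcal B)}:=\|y\|_X+\|\mathcal By\|_X$. Then there exists $\alpha>0$ such that for every $\mu\in(0,\alpha)$ the feedback control $v(t)=-\mu\mathbf 1_{\{t\ge0:\ \mathcal By(t)\neq0\}}$ guarantees the exponential stabilization of the bilinear system $$\dot y(t)=Ay(t)+v(t)\mathcal By(t),\qquad y(0)=y_0\in X.$$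
   Context: Duality map: for $y\in X$, $J(y)$ is the nonempty set of all $\phi\in X^*$ with $\langle y,\phi\rangle=\|y\|_X^2=\|\phi\|^2$. Closed-loop system: since $v(t)\mathcal By(t)=-\mu\mathcal By(t)$ for the given feedback, the closed-loop system is $\dot y=Ay-\mu\mathcal By$, $y(0)=y_0$. Exponential stabilization means that $A-\mu\mathcal B$ with domain $D(A)$ generates a $C_0$-semigroup $(\mathcal T_\mu(t))_{t\ge0}$ on $X$ (the closed-loop mild solution being $y(t)=\mathcal T_\mu(t)y_0$) and there are constants $M',\sigma>0$ with $\|\mathcal T_\mu(t)y_0\|_X\le M'e^{-\sigma t}\|y_0\|_X$ for all $t\ge0$ and $y_0\in X$. Convention on integrals involving selections of $J$: the inequality is required for every selection $\phi$; if the integrand is not measurable, the integral is read as the upper Lebesgue integral (infimum of $\int g$ over integrable $g$ dominating the integrand a.e.). *)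

(* Defs.v *)
From HB Require Import structures.
From mathcomp Require Import all_boot all_order all_algebra.
From mathcomp Require Import complex.
From mathcomp Require Import all_classical all_reals all_analysis.

Set Implicit Arguments.
Unset Strict Implicit.
Unset Printing Implicit Defensive.

Import Order.TTheory GRing.Theory Num.Theory.
Import numFieldNormedType.Exports.

Local Open Scope classical_set_scope.
Local Open Scope ring_scope.

(* A Banach space is taken over either of the two usual scalar fields.  The
   order of [R[i]] makes [`|x|] an element of [R[i]], so norms are brought back
   to [R] by [nrm]. *)
Inductive scalars := RealScalars | ComplexScalars.

Definition Scal (R : realType) (s : scalars) : numFieldType :=
  match s with RealScalars => R | ComplexScalars => R[i] end.

Definition of_real (R : realType) (s : scalars) : R -> Scal R s :=
  match s with
  | RealScalars => fun x => x
  | ComplexScalars => fun x => real_complex R x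
  end.

Definition re (R : realType) (s : scalars) : Scal R s -> R :=
  match s with RealScalars => fun x => x | ComplexScalars => fun z => complex.Re z end.

Definition nrm (R : realType) (s : scalars) (V : normedModType (Scal R s))
  (x : V) : R := re `|x|.

Lemma nrmE (R : realType) (s : scalars) (V : normedModType (Scal R s)) (x : V) :
  of_real s (nrm x) = `|x|.
Proof.
rewrite /nrm; case: s V x => //= V x.
by apply/eqP; rewrite RRe_real // normr_real.
Qed.

Definition dual_norm (R : realType) (s : scalars) (X : normedModType (Scal R s))
    (phi : {linear X -> (Scal R s)^o}) : R :=
  sup [set nrm (phi x) | x in [set x : X | nrm x <= 1]].

Definition J (R : realType) (s : scalars) (X : normedModType (Scal R s)) (y : X) :
    set {linear X -> (Scal R s)^o} :=
  [set phi : {linear X -> (Scal R s)^o} |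
    [/\ continuous phi,
        phi y = of_real s (nrm y ^+ 2) &
        nrm y ^+ 2 = dual_norm phi ^+ 2]].

(* Only the operators with index [0 <= t] are meaningful. *)
Definition C0_semigroup (R : realType) (s : scalars)
    (X : normedModType (Scal R s)) (S : R -> {linear X -> X}) : Prop :=
  [/\ forall t, 0 <= t -> continuous (S t),
      forall x, S 0 x = x,
      forall t u x, 0 <= t -> 0 <= u -> S (t + u) x = S t (S u x) &
      forall x, S t x @[t --> 0^'+] --> x].

(* An unbounded operator is given by its domain [D] and a function which is
   meaningful only on [D]. *)
Definition generates (R : realType) (s : scalars) (X : normedModType (Scal R s))
    (D : set X) (A : X -> X) (S : R -> {linear X -> X}) : Prop :=
  C0_semigroup S /\
  forall x y,
    (D x /\ A x = y) <->
    (of_real s h^-1 *: (S h x - x) @[h --> 0^'+] --> y).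

Definition contraction_semigroup (R : realType) (s : scalars)
    (X : normedModType (Scal R s)) (S : R -> {linear X -> X}) : Prop :=
  forall t x, 0 <= t -> nrm (S t x) <= nrm x.

Definition graph_norm (R : realType) (s : scalars) (X : normedModType (Scal R s))
  (L : X -> X) (y : X) : R := nrm y + nrm (L y).

(* [B] belongs to L(X_1, X), where X_1 is [D] with the graph norm of [A]. *)
Definition bounded_on_domain (R : realType) (s : scalars)
    (X : normedModType (Scal R s)) (D : set X) (A B : X -> X) : Prop :=
  (forall (a : Scal R s) x y, D x -> D y -> B (a *: x + y) = a *: B x + B y) /\
  exists C : R, forall y, D y -> nrm (B y) <= C * graph_norm A y.

Definition upper_integral (R : realType) (E : set R) (f : R -> R) : \bar R :=
  ereal_inf [set (\int[lebesgue_measure]_(t in E) (g t)%:E)%E | g in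
    [set g : R -> R | lebesgue_measure.-integrable E (EFin \o g) /\
       {ae lebesgue_measure, forall t, E t -> f t <= g t}]].

(* [measurable_fun] refers to the Borel sets.  An integrable function that is
   Lebesgue but not Borel measurable falls in the second case, where the upper
   integral is its Lebesgue integral. *)
Definition selection_integral (R : realType) (E : set R) (f : R -> R) : \bar R :=
  if `[< measurable_fun E f >]
  then (\int[lebesgue_measure]_(t in E) (f t)%:E)%E
  else upper_integral E f.

(* Feedback laws are functions of the state: the control along a trajectory y
   is v(t) = [feedback mu B (y t)].  On the domain, the resulting closed-loop
   operator is A - mu B, see [closed_loop_feedbackE]. *)
Definition feedback (R : realType) (s : scalars) (X : normedModType (Scal R s))
  (mu : R) (B : X -> X) (y : X) : R := - mu * (B y != 0)%:R.

Definition closed_loop (R : realType) (s : scalars) (X : normedModType (Scal R s))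
  (A B : X -> X) (v : X -> R) (y : X) : X := A y + of_real s (v y) *: B y.

Lemma closed_loop_feedbackE (R : realType) (s : scalars)
    (X : normedModType (Scal R s)) (mu : R) (A B : X -> X) (y : X) :
  closed_loop A B (feedback mu B) y = A y - of_real s mu *: B y.
Proof.
rewrite /closed_loop /feedback; case: eqVneq => [->|_] /=.
  by rewrite !scaler0 subr0 addr0.
rewrite mulr1 -scaleNr; congr (_ + _ *: _).
by case: s X A B y => //= *; rewrite raddfN.
Qed.

Definition exp_stabilizes (R : realType) (s : scalars)
    (X : normedModType (Scal R s)) (D : set X) (A B : X -> X) (v : X -> R) : Prop :=
  exists Tv : R -> {linear X -> X},
    generates D (closed_loop A B v) Tv /\
    exists M' sigma : R, [/\ 0 < M', 0 < sigma &
      forall t y0, 0 <= t -> nrm (Tv t y0) <= M' * expR (- sigma * t) * nrm y0].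

(* Main.v *)
Require Import Defs.
From HB Require Import structures.
From mathcomp Require Import all_boot all_order all_algebra.
From mathcomp Require Import complex.
From mathcomp Require Import all_classical all_reals all_analysis.
From mathcomp Require Import measurable_realfun ring lra.

(** The proof has two halves: for small mu the operator A - mu B generates a
    semigroup V with a bound that is uniform in mu, and over one period V
    contracts the norm by a fixed factor smaller than 1.

    Generation. B is unbounded and is controlled only through the L^1 bound
    [m1] along the orbits of S. This bound is stored in a second norm on D:
    with N(y) the integral over [0, T] of (1 - t/T) |B S(t) y|, put Phi(y) =
    |y| + N(y), so that |y| <= Phi(y) <= (1 + M) |y|. Along an orbit of S the
    quantity N decreases at the rate |B y|, up to a term (M/T) |y|. Hence A -
    M/T is dissipative for Phi with the surplus |B y| ([lyap_orbit]), and this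
    surplus pays for the perturbation mu B as soon as mu (1 + M) <= 1
    ([perturbed_lyap]). The resolvents of A - mu B - M/T, obtained from those
    of A by a Neumann series ([perturbed_solve]), therefore do not increase
    Phi, and arbitrary products of them are bounded by 1 + M in the original
    norm. Such a family of resolvents produces a semigroup as the limit of the
    implicit Euler scheme with dyadic steps ([euler_generates]): with L = A -
    mu B - M/T and R_h its resolvent for the step h, the vectors R_a R_b x and
    R_(a+b) x differ by a b times a bounded operator applied to L L x, so that
    halving the steps adds up to a geometric series. Vector-valued integrals
    are avoided altogether: the resolvent of A and the density of D come from
    the difference quotients of S ([resolvent_scheme], [domain_dense]).

    Decay. Let y0 in D, y(t) = V(t) y0, e(t) = S(t) y0 and z = y - e.
    Integrating the differential inequality for Phi along y and along z gives,
    up to constants that do not depend on mu, a bound |y0| for the integral of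
    |B y| ([observed_input]) and a bound mu |y0| for sup |z| and for the
    integral of |B z| ([observed_deviation]). Since A is dissipative, the left
    derivative of |y|^2 is at most -2 mu Re <B y, phi> for every phi in J(y),
    and [m3] replaces Re <B y, phi> by Re <B S(t) y0, psi>, with psi in J(S(t)
    y0), up to an error whose integral is of order mu |y0|^2. The function t
    |-> Re <B S(t) y0, psi(t)> need not be measurable; what bounds its upper
    integral is that, up to this error, it is dominated by the lower limit of
    difference quotients of the Lipschitz function |y|^2, which Fatou's lemma
    integrates ([selection_integral_rate]). With [m2] this yields |V(T) y0|^2
    <= (1 - mu delta) |y0|^2 for small mu ([decay_step]), on D and then on X
    by density; iterating over the periods gives exponential decay
    ([exponential_decay]). *)

Set Implicit Arguments.
Unset Strict Implicit.
Unset Printing Implicit Defensive.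

Import Order.TTheory GRing.Theory Num.Theory.
Import numFieldNormedType.Exports.

Local Open Scope classical_set_scope.
Local Open Scope ring_scope.

(** * Real scalars, norms and bounded operators *)
Section Scalars.
Variables (R : realType) (s : scalars).
Implicit Types a b : R.

Lemma of_realD a b : of_real s (a + b) = of_real s a + of_real s b.
Proof. by case: s => //=; rewrite rmorphD. Qed.

Lemma of_realN a : of_real s (- a) = - of_real s a.
Proof. by case: s => //=; rewrite rmorphN. Qed.

Lemma of_realM a b : of_real s (a * b) = of_real s a * of_real s b.
Proof. by case: s => //=; rewrite rmorphM. Qed.

Lemma of_real0 : of_real s 0 = 0 :> Scal R s.
Proof. by case: s. Qed.

Lemma of_real1 : of_real s 1 = 1 :> Scal R s.
Proof. by case: s. Qed.

Lemma re_of_real a : re (of_real s a) = a.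
Proof. by case: s. Qed.

Lemma reD (x y : Scal R s) : re (x + y) = re x + re y.
Proof. by case: s x y => //= -[? ?] [? ?]. Qed.

Lemma reN (x : Scal R s) : re (- x) = - re x.
Proof. by case: s x => //= -[? ?]. Qed.

Lemma reB (x y : Scal R s) : re (x - y) = re x - re y.
Proof. by rewrite reD reN. Qed.

Lemma re_of_realM a (x : Scal R s) : re (of_real s a * x) = a * re x.
Proof. by case: s x => //= -[u v] /=; rewrite mul0r subr0. Qed.

Lemma ler_of_real a b : (of_real s a <= of_real s b) = (a <= b).
Proof. by case: s => //=; rewrite lecR. Qed.

Lemma ltr_of_real a b : (of_real s a < of_real s b) = (a < b).
Proof. by case: s => //=; rewrite ltcR. Qed.

Lemma norm_of_real a : `|of_real s a| = of_real s `|a|.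
Proof. by case: s => //=; rewrite normc_def /= expr0n addr0 sqrtr_sqr. Qed.

Lemma gt0_of_real (e : Scal R s) : 0 < e -> exists2 a : R, e = of_real s a & 0 < a.
Proof.
case: s e => [/= e e0|e]; first by exists e.
by case: e => u v; rewrite ltcE /= => /andP[/eqP -> u0]; exists u.
Qed.

Lemma re_le_nrm (x : (Scal R s)^o) : re x <= nrm x.
Proof.
rewrite /nrm; case: s x => /= [x|x]; first exact: ler_norm.
by apply: le_trans (ler_norm _) _; rewrite -lecR; exact: normc_ge_Re x.
Qed.

End Scalars.

Notation "a *r x" := (of_real _ a *: x) (at level 40, left associativity).

Section Norm.
Variables (R : realType) (s : scalars) (V : normedModType (Scal R s)).
Implicit Types (x y : V) (a : R).

Lemma nrm_le x a : `|x| <= of_real s a -> nrm x <= a.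
Proof. by rewrite -nrmE ler_of_real. Qed.

Lemma nrm_ge0 x : 0 <= nrm x.
Proof. by rewrite -(ler_of_real s) nrmE of_real0. Qed.

Lemma nrm0 : nrm (0 : V) = 0.
Proof. by rewrite /nrm normr0 -(of_real0 R s) re_of_real. Qed.

Lemma nrm_eq0 x : nrm x = 0 -> x = 0.
Proof. by move=> x0; apply/eqP; rewrite -normr_eq0 -nrmE x0 of_real0. Qed.

Lemma nrmN x : nrm (- x) = nrm x.
Proof. by rewrite /nrm normrN. Qed.

Lemma nrmC x y : nrm (x - y) = nrm (y - x).
Proof. by rewrite -nrmN opprB. Qed.

Lemma nrmD x y : nrm (x + y) <= nrm x + nrm y.
Proof. by apply: nrm_le; rewrite of_realD !nrmE ler_normD. Qed.

Lemma nrmB x y : nrm (x - y) <= nrm x + nrm y.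
Proof. by rewrite -(nrmN y) nrmD. Qed.

Lemma nrm_sub x y : nrm x - nrm y <= nrm (x - y).
Proof. by have := nrmD (x - y) y; rewrite subrK; lra. Qed.

Lemma nrm_dist x y : `|nrm x - nrm y| <= nrm (x - y).
Proof.
have := nrm_sub x y; have := nrm_sub y x; rewrite (nrmC y x) => h1 h2.
by rewrite ler_norml; apply/andP; split; lra.
Qed.

Lemma nrmZ a x : nrm (a *r x) = `|a| * nrm x.
Proof.
by rewrite /nrm normrZ norm_of_real -nrmE -of_realM !re_of_real.
Qed.

Lemma nrmZ_ge0 a x : 0 <= a -> nrm (a *r x) = a * nrm x.
Proof. by move=> a0; rewrite nrmZ ger0_norm. Qed.

Lemma nrm_trans y x z : nrm (x - z) <= nrm (x - y) + nrm (y - z).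
Proof. by rewrite -[x - z](subrKA y) nrmD. Qed.

Lemma nrm_small x : (forall e : R, 0 < e -> nrm x <= e) -> x = 0.
Proof.
move=> H; apply: nrm_eq0; apply/eqP; rewrite eq_le nrm_ge0 andbT.
by apply/ler_addgt0Pr => e e0; rewrite add0r H.
Qed.

(** Limits are handled through the real-valued norm, so that all estimates take
    place in the ordered field [R] whichever the scalars are. *)
Lemma cvg_at0rP (f : R -> V) y :
  f h @[h --> 0^'+] --> y <->
  forall e : R, 0 < e -> exists2 d : R, 0 < d & forall h : R, 0 < h < d -> nrm (f h - y) <= e.
Proof.
split=> [/cvgrPdist_lt H e e0|H].
  have /H : 0 < of_real s e by rewrite -(of_real0 R s) ltr_of_real.
  rewrite /at_right near_withinE => /nbhs_ballP[d /= d0 Hd].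
  exists d => // h /andP[h0 hd]; rewrite nrmC; apply: nrm_le; apply/ltW.
  by apply: Hd => //; rewrite /ball/= sub0r normrN gtr0_norm.
apply/cvgrPdist_le => e /gt0_of_real[{}e -> e0].
have [d d0 Hd] := H _ e0.
rewrite /at_right near_withinE; apply/nbhs_ballP; exists d => //= h.
rewrite /ball/= sub0r normrN => hd h0.
by rewrite -nrmE ler_of_real nrmC Hd // h0 -(gtr0_norm h0).
Qed.

Lemma cvg_seqP (u : nat -> V) y :
  u @ \oo --> y <->
  forall e : R, 0 < e -> exists N, forall n, (N <= n)%N -> nrm (u n - y) <= e.
Proof.
split=> [/cvgrPdist_lt H e e0|H].
  have /H : 0 < of_real s e by rewrite -(of_real0 R s) ltr_of_real.
  move=> [N _ HN]; exists N => n Nn; rewrite nrmC; apply: nrm_le; apply/ltW.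
  exact: HN.
apply/cvgrPdist_le => e /gt0_of_real[{}e -> e0].
have [N HN] := H _ e0; exists N => // n /= Nn.
by rewrite -nrmE ler_of_real nrmC HN.
Qed.

End Norm.

Section Bounded.
Variables (R : realType) (s : scalars) (V W : normedModType (Scal R s)).

Lemma linR (f : {linear V -> W}) (a : R) x : f (a *r x) = a *r f x.
Proof. by rewrite linearZ. Qed.

Lemma bounded_continuous (f : {linear V -> W}) C :
  (forall x, nrm (f x) <= C * nrm x) -> continuous f.
Proof.
move=> H; apply: bounded_linear_continuous.
rewrite /bounded_near; exists (of_real s `|C|); split.
  by rewrite ger0_real // -(of_real0 R s) ler_of_real.
move=> M CM; apply/nbhs_ballP; exists 1 => //= x; rewrite -ball_normE /= sub0r normrN.
move=> x1; apply: le_trans (ltW CM); rewrite -nrmE ler_of_real.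
apply: le_trans (H x) _; apply: le_trans (ler_norm _) _.
rewrite normrM ler_piMr // ger0_norm ?nrm_ge0 //.
by apply: nrm_le; rewrite of_real1 ltW.
Qed.

Lemma continuous_bounded (f : {linear V -> W}) :
  continuous f -> exists C, forall x, nrm (f x) <= C * nrm x.
Proof.
move=> /(_ 0)/cvgrPdist_lt H.
have /H : 0 < of_real s 1 :> Scal R s by rewrite of_real1.
move=> /nbhs_ballP[d /= /gt0_of_real[r -> d0] Hd].
exists (2 / r) => x; have [x0|xn0] := eqVneq (nrm x) 0.
  by rewrite (nrm_eq0 x0) linear0 !nrm0 mulr0.
have x0 : 0 < nrm x by rewrite lt_def xn0 nrm_ge0.
set c := r / (2 * nrm x).
have c0 : 0 < c by rewrite divr_gt0 // mulr_gt0.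
have cx : nrm (c *r x) = r / 2 by rewrite nrmZ_ge0 ?(ltW c0) // /c; field.
have /Hd : ball (0 : V) (of_real s r) (c *r x).
  rewrite -ball_normE /= sub0r normrN -nrmE ltr_of_real cx; lra.
rewrite linear0 sub0r normrN -nrmE ltr_of_real linR (nrmZ_ge0 _ (ltW c0)) => /ltW Hc.
rewrite -(ler_pM2l c0); apply: le_trans Hc _.
by rewrite le_eqVlt; apply/orP; left; apply/eqP; rewrite /c; field; rewrite xn0 gt_eqF.
Qed.

End Bounded.

(** * Linear identities by comparison of coefficients *)

(** Both sides of an identity between real combinations of vectors are reified and
    evaluated to their coefficients over a list of atoms; equal coefficients make
    the two sides equal, so that only scalar identities remain. *)
Inductive lexp (R : Type) : Type :=
| LZero | LVar of nat | LAdd of lexp R & lexp R | LOpp of lexp R | LScale of R & lexp R.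
Arguments LZero {R}.
Arguments LVar {R}.

Section Lexp.
Variables (R : realType) (s : scalars) (X : lmodType (Scal R s)).

Fixpoint leval (e : seq X) (t : lexp R) : X :=
  match t with
  | LZero => 0
  | LVar i => nth 0 e i
  | LAdd u v => leval e u + leval e v
  | LOpp u => - leval e u
  | LScale a u => a *r leval e u
  end.

Fixpoint lcoef (t : lexp R) (i : nat) : R :=
  match t with
  | LZero => 0
  | LVar j => (i == j)%:R
  | LAdd u v => lcoef u i + lcoef v i
  | LOpp u => - lcoef u i
  | LScale a u => a * lcoef u i
  end.

Lemma levalE (e : seq X) t : leval e t = \sum_(i < size e) lcoef t i *r nth 0 e i.
Proof.
elim: t => [|j|u IHu v IHv|u IHu|a u IHu] /=; rewrite ?IHu ?IHv.
- by rewrite big1 // => i _; rewrite of_real0 scale0r.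
- case: (ltnP j (size e)) => je.
    rewrite (bigD1 (Ordinal je)) //= eqxx of_real1 scale1r big1 ?addr0 // => i.
    by rewrite -val_eqE /= => /negPf ->; rewrite of_real0 scale0r.
  rewrite nth_default // big1 // => i _.
  by rewrite ltn_eqF ?of_real0 ?scale0r // (leq_trans _ je).
- by rewrite -big_split; apply: eq_bigr => i _; rewrite of_realD scalerDl.
- by rewrite -sumrN; apply: eq_bigr => i _; rewrite of_realN scaleNr.
- by rewrite scaler_sumr; apply: eq_bigr => i _; rewrite scalerA of_realM.
Qed.

Fixpoint all_below (n : nat) (P : nat -> Prop) : Prop :=
  if n is m.+1 then P m /\ all_below m P else True.

Lemma leval_eq (e : seq X) t u :
  all_below (size e) (fun i => lcoef t i = lcoef u i) -> leval e t = leval e u.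
Proof.
rewrite !levalE => H; apply: eq_bigr => -[i /= ie] _; congr (_ *r _).
elim: (size e) i ie H => // n IH i; rewrite ltnS leq_eqVlt => /orP[/eqP -> []//|].
by move=> /IH h [_ /h].
Qed.

End Lexp.

(** [vec_eq e] proves an identity between real combinations of the vectors listed
    in [e]; it leaves one scalar identity per entry of [e], a goal for [ring] or
    [field].  The hint database stays empty: unification relative to it unfolds no
    constant, so that looking up an atom never reduces an operator. *)
Create HintDb vec_atoms discriminated.
Ltac vindex x l :=
  lazymatch l with
  | ?y :: ?l' =>
    match goal with
    | _ => let _ := match goal with _ => constr_eq x y end in constr:(0%N)
    | _ => let _ := match goal with _ => unify x y with vec_atoms end in constr:(0%N)
    | _ => let i := vindex x l' in constr:(S i)
    end
  end.
Ltac vreify R e t :=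
  lazymatch t with
  | (?u + ?v)%R => let u' := vreify R e u in let v' := vreify R e v in
      constr:(LAdd u' v')
  | (- ?u)%R => let u' := vreify R e u in constr:(LOpp u')
  | (of_real _ ?a *: ?u)%R => let u' := vreify R e u in constr:(LScale a u')
  | 0%R => constr:(@LZero R)
  | _ => let i := vindex t e in constr:(@LVar R i)
  end.
Ltac vec_eq e :=
  lazymatch goal with
  | _ : _ (Scal ?R ?s) |- ?t = ?u =>
    let t' := vreify (Real.sort R) e t in
    let u' := vreify (Real.sort R) e u in
    apply: (@leval_eq R s _ e t' u'); rewrite /=; do ?split
  end.

(** * Complete spaces and the Neumann series *)
Section Complete.
Variables (R : realType) (s : scalars) (X : completeNormedModType (Scal R s)).

Lemma nrm_cauchy_cvg (u : nat -> X) :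
  (forall e : R, 0 < e -> exists N, forall n, (N <= n)%N -> nrm (u n - u N) <= e) ->
  exists y, forall e : R, 0 < e -> exists N, forall n, (N <= n)%N -> nrm (u n - y) <= e.
Proof.
move=> H; suff /cauchy_cvg/cvg_ex[y] : cauchy (u @ \oo).
  by move=> uy; exists y; apply/cvg_seqP.
apply: cauchy_exP => e /gt0_of_real[{}e -> e0].
have [N HN] := H _ (divr_gt0 e0 (ltr0n R 2)); exists (u N); exists N => // n /= Nn.
by rewrite -ball_normE /= -nrmE ltr_of_real nrmC; have := HN n Nn; lra.
Qed.

Lemma geometric_small (q C e : R) : 0 <= q < 1 -> 0 < e ->
  exists N, forall n, (N <= n)%N -> C * q ^+ n <= e.
Proof.
move=> /andP[q0 q1] e0.
have : (fun n => C * q ^+ n) @ \oo --> (C * 0 : R).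
  by apply: cvgM; [exact: cvg_cst|apply: cvg_expr; rewrite ger0_norm].
rewrite mulr0 => /cvgrPdist_le /(_ e e0)[N _ HN]; exists N => n Nn.
by have := HN n Nn; rewrite sub0r normrN => /(le_trans (ler_norm _)).
Qed.

Lemma geometric_cvg (u : nat -> X) (C q : R) : 0 <= q < 1 ->
  (forall n, nrm (u n.+1 - u n) <= C * (1 - q) * q ^+ n) ->
  exists y, forall n, nrm (u n - y) <= C * q ^+ n.
Proof.
move=> qr H; have /andP[q0 q1] := qr.
have C0 : 0 <= C.
  have := le_trans (nrm_ge0 _) (H 0%N); rewrite expr0 mulr1.
  by rewrite pmulr_lge0 // subr_gt0.
have step m n : nrm (u (m + n)%N - u m) <= C * (1 - q ^+ n) * q ^+ m.
  elim: n => [|n IH]; first by rewrite addn0 subrr nrm0 expr0 subrr mulr0 mul0r.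
  apply: le_trans (nrm_trans (u (m + n)%N) _ _) _.
  rewrite addnS; apply: le_trans (lerD (H _) IH) _.
  by rewrite le_eqVlt; apply/orP; left; apply/eqP; rewrite exprD exprS; ring.
have step' m n : (m <= n)%N -> nrm (u n - u m) <= C * q ^+ m.
  move=> /subnKC <-; apply: le_trans (step _ _) _.
  rewrite ler_wpM2r ?exprn_ge0 // -[leRHS]mulr1 ler_wpM2l //.
  by rewrite lerBlDr lerDl exprn_ge0.
have [y Hy] : exists y, forall e : R, 0 < e ->
    exists N, forall n, (N <= n)%N -> nrm (u n - y) <= e.
  apply: nrm_cauchy_cvg => e e0; have [N HN] := geometric_small C qr e0.
  by exists N => n Nn; apply: le_trans (step' _ _ Nn) (HN _ _).
exists y => n; apply/ler_addgt0Pr => e e0; have [N HN] := Hy e e0.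
apply: le_trans (nrm_trans (u (maxn n N)) _ _) _.
by rewrite lerD ?HN ?leq_maxr // nrmC step' ?leq_maxl.
Qed.

(** The iterates of the contraction [y |-> x - K y] converge geometrically to its
    fixed point.  A Lipschitz condition in place of linearity lets [K] be a plain
    function, such as a composite with a chosen resolvent. *)
Lemma neumann_solve (K : X -> X) (q : R) (x : X) : 0 <= q < 1 ->
  (forall y z, nrm (K y - K z) <= q * nrm (y - z)) -> exists y, y + K y = x.
Proof.
move=> qr HK; have /andP[q0 q1] := qr; have q1' : 0 < 1 - q by rewrite subr_gt0.
pose u n := iter n (fun y => x - K y) 0.
have Hu n : nrm (u n.+1 - u n) <= nrm (u 1%N - u 0%N) / (1 - q) * (1 - q) * q ^+ n.
  rewrite divfK ?gt_eqF //; elim: n => [|n IH]; first by rewrite mulr1.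
  have Ku m : K (u m) = x - u m.+1 by rewrite /=; vec_eq [:: x; K (u m)]; ring.
  have -> : u n.+2 - u n.+1 = K (u n) - K (u n.+1).
    by rewrite !Ku; vec_eq [:: x; u n.+1; u n.+2]; ring.
  apply: le_trans (HK _ _) _; rewrite nrmC exprS mulrCA ler_wpM2l //.
have [y Hy] := geometric_cvg qr Hu; exists y; apply/eqP; rewrite -subr_eq0; apply/eqP.
set C := nrm _ / _ in Hy.
apply: nrm_small => e e0; have [N HN] := geometric_small (2 * C) qr e0.
have E : y + K y - x = (y - u N.+1) + (K y - K (u N)).
  by rewrite [u N.+1]/=; vec_eq [:: y; K y; K (u N); x]; ring.
rewrite E; apply: le_trans (nrmD _ _) _.
apply: le_trans (lerD (lexx _) (HK _ _)) _.
rewrite !(nrmC y); have := Hy N; have := Hy N.+1; have := HN N (leqnn _).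
rewrite exprS; have := exprn_ge0 N q0; have := nrm_ge0 (u N - y).
set a := nrm _; set b := nrm _; set p := q ^+ N => a0 p0 h1 h2 h3.
have h4 : q * a <= q * (C * p) by rewrite ler_wpM2l.
have C0 : 0 <= C by rewrite divr_ge0 ?nrm_ge0 ?ltW.
have h5 : q * (C * p) <= 1 * (C * p) by apply: ler_wpM2r (ltW q1); apply: mulr_ge0.
by rewrite mulrCA in h2; lra.
Qed.

End Complete.

(** * Generators and their orbits *)
Section Generator.
Variables (R : realType) (s : scalars) (X : completeNormedModType (Scal R s)).

Lemma right_derivativeP (U : R -> {linear X -> X}) x y :
  (of_real s h^-1 *: (U h x - x) @[h --> 0^'+] --> y) <->
  forall e : R, 0 < e -> exists2 d : R, 0 < d &
    forall h : R, 0 < h < d -> nrm (U h x - x - h *r y) <= e * h.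
Proof.
have E h : 0 < h ->
    nrm (U h x - x - h *r y) = nrm (h^-1 *r (U h x - x) - y) * h.
  move=> h0; rewrite mulrC -(nrmZ_ge0 _ (ltW h0)); congr nrm.
  by vec_eq [:: U h x; x; y]; field; rewrite gt_eqF.
split=> [/cvg_at0rP H e e0|H].
  have [d d0 Hd] := H e e0; exists d => // h hd.
  by have /andP[h0 _] := hd; rewrite E // ler_pM2r // Hd.
apply/cvg_at0rP => e e0; have [d d0 Hd] := H e e0; exists d => // h hd.
by have /andP[h0 _] := hd; have := Hd h hd; rewrite E // ler_pM2r.
Qed.

Variables (D : set X) (L : X -> X) (U : R -> {linear X -> X}).
Hypothesis gen : generates D L U.

Lemma generatorP x y : (D x /\ L x = y) <->
  forall e : R, 0 < e -> exists2 d : R, 0 < d &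
    forall h : R, 0 < h < d -> nrm (U h x - x - h *r y) <= e * h.
Proof. by rewrite (gen.2 x y); apply: right_derivativeP. Qed.

Lemma generator_linear (a : Scal R s) x y : D x -> D y ->
  D (a *: x + y) /\ L (a *: x + y) = a *: L x + L y.
Proof.
move=> Dx Dy.
have [_ H] := gen; apply/H.
have /H Hx := conj Dx (erefl (L x)); have /H Hy := conj Dy (erefl (L y)).
have -> : (fun h => of_real s h^-1 *: (U h (a *: x + y) - (a *: x + y))) =
  (fun h => a *: (of_real s h^-1 *: (U h x - x)) + of_real s h^-1 *: (U h y - y)).
  apply/funext => h; rewrite linearP /= [a *: (_ *: _)]scalerA mulrC -scalerA -scalerDr.
  by congr (_ *: _); rewrite scalerBr opprD addrACA.
by apply: cvgD => //; apply: cvgZr.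
Qed.

Lemma generator_0 : D 0 /\ L 0 = 0.
Proof.
apply/generatorP => e e0; exists 1 => // h /andP[h0 _].
by rewrite linear0 scaler0 !subr0 nrm0 mulr_ge0 // ltW.
Qed.

Lemma generator_Z (a : Scal R s) x : D x -> D (a *: x) /\ L (a *: x) = a *: L x.
Proof.
have [D0 L0] := generator_0.
by move=> /(generator_linear a) /(_ D0); rewrite L0 !addr0.
Qed.

Lemma generator_D x y : D x -> D y -> D (x + y) /\ L (x + y) = L x + L y.
Proof. by move=> Dx /(generator_linear 1 Dx); rewrite !scale1r. Qed.

Lemma generator_B x y : D x -> D y -> D (x - y) /\ L (x - y) = L x - L y.
Proof.
move=> Dx Dy; have [Dn Ln] := generator_linear (-1) Dy Dx.
by rewrite !scaleN1r ![- _ + _]addrC in Dn Ln.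
Qed.

(** A bounded operator maps difference quotients of [x] to those of [K x], so
    commuting with the semigroup is inherited by the generator. *)
Lemma generator_commute (K : {linear X -> X}) C x :
  (forall y, nrm (K y) <= C * nrm y) ->
  (forall h : R, 0 <= h -> U h (K x) = K (U h x)) ->
  D x -> D (K x) /\ L (K x) = K (L x).
Proof.
move=> KC KU Dx; apply/generatorP => e e0.
have C1 : 0 < `|C| + 1 by rewrite ltr_wpDl.
have /generatorP H := conj Dx (erefl (L x)).
have [d d0 Hd] := H _ (divr_gt0 e0 C1); exists d => // h hd.
have /andP[h0 _] := hd; rewrite KU ?(ltW h0) //.
have -> : K (U h x) - K x - h *r K (L x) = K (U h x - x - h *r L x).
  by rewrite !linearB (linR K).
apply: le_trans (KC _) _.
apply: (@le_trans _ _ ((`|C| + 1) * nrm (U h x - x - h *r L x))).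
  by rewrite ler_wpM2r ?nrm_ge0 // (le_trans (ler_norm _)) // lerDl.
by rewrite -ler_pdivlMl // mulrA [_^-1 * e]mulrC Hd.
Qed.

(* A semigroup is locally bounded by the uniform boundedness principle; here each
   semigroup comes with an explicit bound, which is taken as a hypothesis. *)
Hypothesis Ub : forall b : R, exists2 K : R, 0 < K &
  forall (t : R) x, 0 <= t <= b -> nrm (U t x) <= K * nrm x.

Lemma generator_orbit (t : R) x : 0 <= t -> D x -> D (U t x) /\ L (U t x) = U t (L x).
Proof.
move=> t0; have [K K0 HK] := Ub t.
apply: (@generator_commute _ K) => [y|h h0]; first by apply: HK; rewrite t0 lexx.
have [[_ _ UD _] _] := gen.
by rewrite -!UD // addrC.
Qed.

Lemma orbit_uniform (b : R) x (e : R) : 0 < e -> exists2 d : R, 0 < d &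
  forall t t' : R, 0 <= t <= b -> 0 <= t' <= b -> `|t' - t| < d ->
    nrm (U t' x - U t x) <= e.
Proof.
move=> e0; have [K K0 HK] := Ub b.
have [[_ U0 UD /(_ x)/cvg_at0rP Uc] _] := gen.
have [d d0 Hd] := Uc _ (divr_gt0 e0 K0); exists d => // t t'.
wlog : t t' / t <= t'.
  move=> W t0 t'0 tt'; case: (leP t t') => [h|/ltW h]; first exact: W.
  by rewrite nrmC; apply: W => //; rewrite distrC.
rewrite le_eqVlt => /orP[/eqP <- _ _ _|tt']; first by rewrite subrr nrm0 ltW.
move=> /andP[t0 tb] /andP[t'0 t'b]; rewrite gtr0_norm ?subr_gt0 // => h.
have -> : U t' x - U t x = U t (U (t' - t) x - x).
  by rewrite linearB -UD ?subr_ge0 ?(ltW tt') // subrKC.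
apply: le_trans (HK _ _ _) _; first by rewrite t0.
by rewrite -ler_pdivlMl // mulrC Hd // subr_gt0 tt'.
Qed.

(** Orbits in the domain are differentiable from the left as well: the backward
    increment at [t] is [U (t - r)] applied to the forward increment at 0, and
    [U (t - r)] is bounded and converges to [U t] strongly.  The decay estimates
    use left derivatives because dissipativity bounds the norm backwards in
    time. *)
Lemma orbit_left_derivative (t : R) x (e : R) : 0 < t -> D x -> 0 < e ->
  exists2 d : R, 0 < d & forall r : R, 0 < r < d ->
    r < t /\ nrm (U t x - U (t - r) x - r *r L (U t x)) <= e * r.
Proof.
move=> t0 Dx e0; have [K K0 HK] := Ub t.
have [[_ U0 UD _] _] := gen.
have [_ ->] := generator_orbit (ltW t0) Dx.
have e2 : 0 < e / 2 by rewrite divr_gt0.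
have [d1 d10 H1] := orbit_uniform t (L x) e2.
have /generatorP H := conj Dx (erefl (L x)).
have [d2 d20 H2] := H _ (divr_gt0 e2 K0).
exists (Num.min t (Num.min d1 d2)); first by rewrite !lt_min t0 d10.
move=> r /andP[r0]; rewrite !lt_min => /and3P[rt rd1 rd2]; split=> //.
have -> : U t x - U (t - r) x - r *r U t (L x) =
    U (t - r) (U r x - x - r *r L x) - r *r (U t (L x) - U (t - r) (L x)).
  rewrite !(linearB (U _)) (linR (U _)) -UD ?subr_ge0 ?(ltW rt) ?(ltW r0) // subrK.
  by vec_eq [:: U t x; U (t - r) x; U t (L x); U (t - r) (L x)]; ring.
apply: le_trans (nrmB _ _) _.
have -> : e * r = K * (e / 2 / K * r) + r * (e / 2) by field; rewrite gt_eqF.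
apply: lerD.
  apply: le_trans (HK _ _ _) _; first by rewrite subr_ge0 (ltW rt) gerBl (ltW r0).
  by rewrite ler_pM2l // H2 // r0.
rewrite nrmZ_ge0 ?(ltW r0) // ler_pM2l // H1 ?subr_ge0 ?gerBl ?(ltW r0) ?(ltW rt) ?(ltW t0) ?lexx //.
by rewrite subKr gtr0_norm.
Qed.

End Generator.

(** * The resolvent of a contraction semigroup *)
Lemma le_addM_eps (R : realType) (x a c : R) :
  (forall e : R, 0 < e -> x <= a + c * e) -> x <= a.
Proof.
move=> H; apply/ler_addgt0Pr => e e0.
have c1 : 0 < `|c| + 1 by rewrite ltr_wpDl.
have e1 := divr_gt0 e0 c1; apply: le_trans (H _ e1) _; rewrite lerD2l.
apply: (@le_trans _ _ ((`|c| + 1) * (e / (`|c| + 1)))).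
  by rewrite ler_pM2r // (le_trans (ler_norm _)) // lerDl.
by rewrite mulrC divfK // gt_eqF.
Qed.

Section Resolvent.
Variables (R : realType) (s : scalars) (X : completeNormedModType (Scal R s)).
Variables (D : set X) (A : X -> X) (S : R -> {linear X -> X}).
Hypotheses (gen : generates D A S) (contr : contraction_semigroup S).

Let S0 x : S 0 x = x. Proof. by have [[]] := gen. Qed.

Let SD (t u : R) x : 0 <= t -> 0 <= u -> S (t + u) x = S t (S u x).
Proof. by have [[_ _ H _] _] := gen; apply: H. Qed.

Let SC (t u : R) x : 0 <= t -> 0 <= u -> S t (S u x) = S u (S t x).
Proof. by move=> t0 u0; rewrite -!SD // addrC. Qed.

(** [(1 + l) w = (w + l (w - S t w)) + l S t w], and [S t] is a contraction: this
    is dissipativity of the bounded operator [(S t - 1) / t]. *)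
Lemma difference_dissipative (t l : R) w : 0 <= t -> 0 <= l ->
  nrm w <= nrm (w + l *r (w - S t w)).
Proof.
move=> t0 l0; have h : l * nrm (S t w) <= l * nrm w by rewrite ler_wpM2l ?contr.
have := nrm_sub ((1 + l) *r w) (l *r S t w).
have -> : (1 + l) *r w - l *r S t w = w + l *r (w - S t w).
  by vec_eq [:: w; S t w]; ring.
by rewrite !nrmZ_ge0 ?addr_ge0 //; lra.
Qed.

(** With [l = h / t] this inverts [I - h (S t - 1) / t], the discrete counterpart
    of [I - h A]; dividing by [1 + l] leaves the contraction [l / (1 + l) S t]. *)
Lemma difference_resolvent (t l : R) x : 0 <= t -> 0 <= l ->
  exists y, y + l *r (y - S t y) = x.
Proof.
move=> t0 l0; have l1 : 0 < 1 + l by rewrite ltr_wpDr.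
have q1 : 0 <= l / (1 + l) < 1.
  by rewrite divr_ge0 ?(ltW l1) //= ltr_pdivrMr // mul1r ltrDr.
have [y Hy] : exists y, y + - ((l / (1 + l)) *r S t y) = (1 + l)^-1 *r x.
  apply: (neumann_solve _ q1 (K := fun y => - ((l / (1 + l)) *r S t y))) => y z.
  have /andP[q0 _] := q1.
  have -> : - ((l / (1 + l)) *r S t y) - - ((l / (1 + l)) *r S t z) =
    - ((l / (1 + l)) *r S t (y - z)).
    by rewrite (linearB (S t)); vec_eq [:: S t y; S t z]; ring.
  by rewrite nrmN nrmZ_ge0 // ler_wpM2l // contr.
exists y; have -> : x = (1 + l) *r ((1 + l)^-1 *r x).
  by vec_eq [:: x]; field; rewrite gt_eqF.
by rewrite -Hy; vec_eq [:: y; S t y]; field; rewrite gt_eqF.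
Qed.

(** The modulus of continuity of the orbit of [x] is the only information on [x]
    that enters the estimates below. *)
Let modulus x (e r : R) := forall u : R, 0 <= u <= r -> nrm (S u x - x) <= e.

Let modulus_exists x (e : R) : 0 < e -> exists2 r : R, 0 < r & modulus x e r.
Proof.
move=> e0; have [[_ _ _ /(_ x)/cvg_at0rP/(_ e e0)[d d0 Hd]] _] := gen.
exists (d / 2) => [|u /andP[]]; first by rewrite divr_gt0.
rewrite le_eqVlt => /orP[/eqP <- _|u0 ud]; first by rewrite S0 subrr nrm0 ltW.
by apply: Hd; rewrite u0; lra.
Qed.

Section Scheme.
Variables (h : R) (x : X).
Hypothesis h0 : 0 < h.
Variables (t : R) (y : X).
Hypotheses (t0 : 0 < t) (Hy : y + (h / t) *r (y - S t y) = x).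

Let SyE : S t y = y + (t / h) *r (y - x).
Proof.
by rewrite -Hy; vec_eq [:: y; S t y]; field; rewrite !gt_eqF.
Qed.

(** The orbit of the discrete resolvent [y] of [x] oscillates no more than that of
    [x]: [S u] commutes with [S t], so [S u y - y] is the discrete resolvent of
    [S u x - x]. *)
Lemma scheme_modulus (u : R) : 0 <= u -> nrm (S u y - y) <= nrm (S u x - x).
Proof.
move=> u0; have ht : 0 <= h / t by rewrite divr_ge0 ?(ltW h0) ?(ltW t0).
apply: le_trans (difference_dissipative _ (ltW t0) ht) _.
rewrite -Hy (linearD (S u)) (linR (S u)) !(linearB (S _)).
rewrite (SC y (ltW t0) u0) le_eqVlt; apply/orP; left; apply/eqP; congr nrm.
by vec_eq [:: y; S u y; S t y; S u (S t y)]; ring.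
Qed.

(** Iterating [S t y = y + (t / h) (y - x)] gives
    [S (m t) y - y = (t / h) sum_(j < m) S (j t) (y - x)], and each of the [m] terms
    differs from [y - x] by at most [2 e]. *)
Lemma scheme_orbit (e r : R) : modulus x e r -> forall m, m%:R * t <= r ->
  nrm (S (m%:R * t) y - y - (m%:R * t / h) *r (y - x)) <= 2 * e * (m%:R * t / h).
Proof.
move=> xe; elim=> [|m IH] mr.
  by rewrite mul0r S0 subrr mul0r of_real0 scale0r subrr nrm0 mulr0.
have mt : 0 <= m%:R * t by rewrite mulr_ge0 ?ler0n ?(ltW t0).
have mr' : m%:R * t <= r.
  by apply: le_trans mr; rewrite ler_pM2r // ler_nat.
have th : 0 < t / h by rewrite divr_gt0.
have -> : S (m.+1%:R * t) y - y - (m.+1%:R * t / h) *r (y - x) =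
  (S (m%:R * t) y - y - (m%:R * t / h) *r (y - x)) +
  (t / h) *r ((S (m%:R * t) y - y) - (S (m%:R * t) x - x)).
  rewrite -natr1 mulrDl mul1r SD // ?(ltW t0) // SyE (linearD (S _)) (linR (S _)).
  rewrite (linearB (S _)).
  by vec_eq [:: y; x; S (m%:R * t) y; S (m%:R * t) x]; field; rewrite gt_eqF.
apply: le_trans (nrmD _ _) _; rewrite nrmZ_ge0 ?(ltW th) //.
have H1 := scheme_modulus mt; have H2 : nrm (S (m%:R * t) x - x) <= e.
  by apply: xe; rewrite mt.
have H3 := nrmB (S (m%:R * t) y - y) (S (m%:R * t) x - x).
have H4 : t / h * nrm (S (m%:R * t) y - y - (S (m%:R * t) x - x)) <= t / h * (2 * e).
  by rewrite ler_pM2l //; lra.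
have -> : 2 * e * (m.+1%:R * t / h) = 2 * e * (m%:R * t / h) + t / h * (2 * e).
  by rewrite -natr1; field; rewrite gt_eqF.
exact: lerD (IH mr') H4.
Qed.

End Scheme.

(** The discrete resolvents for the steps [2^-k] form a Cauchy sequence: a finer
    step divides a coarser one, so by [scheme_orbit] the finer solution nearly
    solves the coarser equation, and that equation is stable.  The limit inherits
    the estimate of [scheme_orbit] for all small times, which contains both its
    membership in the domain and its distance to [x]. *)
Lemma resolvent_scheme (h : R) x : 0 < h -> exists y, forall e r : R,
  0 < e -> 0 < r -> modulus x e r -> forall t, 0 <= t <= r ->
  nrm (S t y - y - (t / h) *r (y - x)) <= 2 * e * (t / h) /\ nrm (S t y - y) <= e.
Proof.
move=> h0; pose t k : R := 2^-1 ^+ k.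
have t0 k : 0 < t k by rewrite exprn_gt0.
have /choice[Y HY] : forall k, exists y, y + (h / t k) *r (y - S (t k) y) = x.
  by move=> k; apply: difference_resolvent; rewrite ?divr_ge0 ?(ltW h0) ?(ltW (t0 k)).
have tsmall (r : R) : 0 < r -> exists N, forall k, (N <= k)%N -> t k <= r.
  move=> r0; have [|N HN] := @geometric_small _ 2^-1 1 r _ r0; first by lra.
  by exists N => k /HN; rewrite mul1r.
have [y Hy] : exists y, forall e : R, 0 < e ->
    exists N, forall n, (N <= n)%N -> nrm (Y n - y) <= e.
  apply: nrm_cauchy_cvg => e e0; have e2 : 0 < e / 2 by rewrite divr_gt0.
  have [r r0 Hr] := modulus_exists x e2; have [k Hk] := tsmall r r0.
  exists k => l kl; set w := Y l - Y k.
  have kt : t k = (2 ^ (l - k))%:R * t l.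
    rewrite /t natrX -(subnKC kl) exprD addKn mulrCA -exprMn.
    by rewrite divff ?expr1n ?mulr1 // pnatr_eq0.
  have := scheme_orbit h0 (t0 l) (HY l) Hr (m := (2 ^ (l - k))%N).
  rewrite -kt => /(_ (Hk k (leqnn k))) E.
  have htk : 0 < h / t k by rewrite divr_gt0.
  apply: le_trans (difference_dissipative w (ltW (t0 k)) (ltW htk)) _.
  have -> : w + (h / t k) *r (w - S (t k) w) =
      - ((h / t k) *r (S (t k) (Y l) - Y l - (t k / h) *r (Y l - x))).
    rewrite -(HY k) /w (linearB (S (t k))).
    vec_eq [:: Y l; Y k; S (t k) (Y l); S (t k) (Y k)]; field;
      by rewrite ?gt_eqF ?h0 //.
  rewrite nrmN nrmZ_ge0 ?(ltW htk) // -ler_pdivlMl //.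
  by apply: le_trans E _; rewrite le_eqVlt; apply/orP; left; apply/eqP; field;
    rewrite !gt_eqF.
exists y => e r e0 r0 Hr u /andP[u0 ur].
have St0 v z : 0 <= v -> nrm (S v z) <= nrm z by move=> v0; apply: contr.
split; last first.
  apply: (@le_addM_eps _ _ _ 2) => n n0; have [N HN] := Hy n n0.
  have -> : S u y - y = (S u (Y N) - Y N) + ((Y N - y) - S u (Y N - y)).
    by rewrite (linearB (S u)); vec_eq [:: y; Y N; S u y; S u (Y N)]; ring.
  have := nrmD (S u (Y N) - Y N) ((Y N - y) - S u (Y N - y)).
  have := nrmB (Y N - y) (S u (Y N - y)); have := St0 u (Y N - y) u0.
  have := scheme_modulus h0 (t0 N) (HY N) u0; have := HN N (leqnn N).
  have := Hr u; rewrite u0 ur => /(_ isT); lra.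
apply: (@le_addM_eps _ _ _ (3 + u / h + nrm (y - x) / h)) => n n0.
have [d d0 Hd] := modulus_exists y n0.
have [N1 HN1] := Hy n n0; have [N2 HN2] := tsmall _ d0.
have [N3 HN3] := tsmall _ n0.
pose k := maxn N1 (maxn N2 N3).
have Yk : nrm (Y k - y) <= n by rewrite HN1 ?leq_maxl.
have tkd : t k <= d by rewrite HN2 // leq_max leq_max leqnn orbT.
have tkn : t k <= n by rewrite HN3 // leq_max leq_max leqnn !orbT.
pose m := Num.truncn (u / t k).
have /andP[m1 m2] : m%:R <= u / t k < m.+1%:R.
  by apply: truncn_itv; rewrite divr_ge0 // ltW.
set v := m%:R * t k; have v0 : 0 <= v by rewrite mulr_ge0 ?ler0n ?(ltW (t0 k)).
have vu : v <= u by rewrite /v -ler_pdivlMr.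
have uv : u - v <= t k.
  move: m2; rewrite ltr_pdivrMr // -natr1 mulrDl mul1r -/v; lra.
have H1 := scheme_orbit h0 (t0 k) (HY k) Hr (le_trans vu ur).
rewrite -/v in H1.
have -> : S u y - y - (u / h) *r (y - x) =
  S v (S (u - v) y - y) + (S v (Y k) - Y k - (v / h) *r (Y k - x)) +
  (- S v (Y k - y) + (Y k - y)) + (v / h) *r (Y k - y) - ((u - v) / h) *r (y - x).
  rewrite !(linearB (S v)) -SD ?subr_ge0 // subrKC.
  by vec_eq [:: y; x; Y k; S u y; S v y; S v (Y k)]; field; rewrite gt_eqF.
have H2 : nrm (S (u - v) y - y) <= n by apply: Hd; rewrite subr_ge0 vu /=; lra.
have H3 := St0 v (S (u - v) y - y) v0; have H4 := St0 v (Y k - y) v0.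
apply: le_trans (nrmB _ _) _.
apply: le_trans (lerD (nrmD _ _) (lexx _)) _.
apply: le_trans (lerD (lerD (nrmD _ _) (lexx _)) (lexx _)) _.
apply: le_trans (lerD (lerD (lerD (nrmD _ _) (nrmD _ _)) (lexx _)) (lexx _)) _.
have vh : 0 <= v / h by rewrite divr_ge0 // ltW.
have uvh : 0 <= (u - v) / h by rewrite divr_ge0 ?subr_ge0 // ltW.
rewrite nrmN !nrmZ_ge0 //.
have vuh : v / h <= u / h by rewrite ler_pM2r ?invr_gt0.
have H5 : v / h * nrm (Y k - y) <= u / h * n by rewrite ler_pM ?nrm_ge0.
have H6 : (u - v) / h * nrm (y - x) <= nrm (y - x) / h * n.
  rewrite mulrAC [X in _ <= X]mulrAC ler_pM2r ?invr_gt0 // mulrC.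
  by rewrite ler_wpM2l ?nrm_ge0 //; lra.
have H7 : 2 * e * (v / h) <= 2 * e * (u / h) by rewrite ler_pM2l // mulr_gt0.
lra.
Qed.

Let scheme_domain (h : R) x y : 0 < h ->
  (forall e r : R, 0 < e -> 0 < r -> modulus x e r -> forall t, 0 <= t <= r ->
    nrm (S t y - y - (t / h) *r (y - x)) <= 2 * e * (t / h) /\ nrm (S t y - y) <= e) ->
  D y /\ A y = h^-1 *r (y - x).
Proof.
move=> h0 Hy.
apply/(generatorP gen) => e e0; have e1 : 0 < e * h / 2 by rewrite divr_gt0 ?mulr_gt0.
have [r r0 Hr] := modulus_exists x e1; exists r => // t /andP[tt tr].
have [|+ _] := Hy _ r e1 r0 Hr t; first by rewrite (ltW tt) (ltW tr).
have -> : (t / h) *r (y - x) = t *r (h^-1 *r (y - x)).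
  by vec_eq [:: y; x]; field; rewrite gt_eqF.
move=> /le_trans; apply; rewrite le_eqVlt; apply/orP; left; apply/eqP.
by field; rewrite gt_eqF.
Qed.

Lemma resolvent_exists (h : R) x : 0 < h -> exists y, D y /\ y - h *r A y = x.
Proof.
move=> h0; have [y Hy] := resolvent_scheme x h0; exists y.
have [Dy ->] := scheme_domain h0 Hy.
by split=> //; vec_eq [:: y; x]; field; rewrite gt_eqF.
Qed.

(** For the estimate of [resolvent_scheme] taken at time [t = h = r], the vector
    [S r y - y - (y - x)] is small together with [S r y - y]. *)
Lemma domain_dense x (e : R) : 0 < e -> exists2 y, D y & nrm (y - x) <= e.
Proof.
move=> e0; have e3 : 0 < e / 3 by rewrite divr_gt0.
have [r r0 Hr] := modulus_exists x e3; have [y Hy] := resolvent_scheme x r0.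
have [Dy _] := scheme_domain r0 Hy; exists y => //.
have [|] := Hy _ r e3 r0 Hr r; first by rewrite (ltW r0) lexx.
rewrite divff ?gt_eqF // of_real1 scale1r mulr1 => H1 H2.
have -> : y - x = (S r y - y) - (S r y - y - (y - x)).
  by vec_eq [:: y; x; S r y]; ring.
by apply: le_trans (nrmB _ _) _; lra.
Qed.

Lemma generator_dissipative (h : R) y : 0 <= h -> D y -> nrm y <= nrm (y - h *r A y).
Proof.
move=> h0 Dy; apply: (@le_addM_eps _ _ _ h) => e e0.
have /(generatorP gen) H := conj Dy (erefl (A y)); have [d d0 Hd] := H e e0.
set t := d / 2; have t0 : 0 < t by rewrite divr_gt0.
have ht : 0 <= h / t by rewrite divr_ge0 ?(ltW t0).
apply: le_trans (difference_dissipative y (ltW t0) ht) _.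
have -> : y + (h / t) *r (y - S t y) = (y - h *r A y) - (h / t) *r (S t y - y - t *r A y).
  by vec_eq [:: y; A y; S t y]; field; rewrite gt_eqF.
apply: le_trans (nrmB _ _) _; rewrite lerD2l nrmZ_ge0 //.
have -> : h * e = h / t * (e * t) by field; rewrite gt_eqF.
by rewrite ler_wpM2l // Hd // t0 /t; lra.
Qed.

End Resolvent.

(** * Generation by the implicit Euler scheme *)
Lemma linear_pack (K : numFieldType) (V W : lmodType K) (f : V -> W) :
  linear f -> exists g : {linear V -> W}, g =1 f.
Proof.
move=> fl; pose m := GRing.isLinear.Build K V W _ f fl.
pose g : {linear V -> W} := HB.pack f m.
by exists g.
Qed.

Section Euler.
Variables (R : realType) (s : scalars) (X : completeNormedModType (Scal R s)).
Variables (D : set X) (L : X -> X) (J : R -> X -> X) (K : R).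
Implicit Types (x y : X) (h a b t : R) (v w : seq R) (n k : nat).
(* [J h] is the resolvent [(I - h L)^-1] for [h > 0].  It is extended by the
   identity, so that every list of steps denotes a product of resolvents and a
   zero step is neutral; [J_bounded] is the stability of all such products. *)
Hypothesis L_linear : forall (c : Scal R s) x y, D x -> D y ->
  D (c *: x + y) /\ L (c *: x + y) = c *: L x + L y.
Hypothesis D_dense : forall x (e : R), 0 < e -> exists2 y, D y & nrm (y - x) <= e.
Hypothesis L_inj : forall h y, 0 < h -> D y -> y - h *r L y = 0 -> y = 0.
Hypothesis J_solves : forall h x, 0 < h -> D (J h x) /\ J h x - h *r L (J h x) = x.
Hypothesis J_id : forall h x, h <= 0 -> J h x = x.
Hypothesis K_gt0 : 0 < K.
Hypothesis J_bounded : forall w x, nrm (foldr J x w) <= K * nrm x.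

Let D_linear (c : Scal R s) x y : D x -> D y -> D (c *: x + y).
Proof. by move=> Dx /(L_linear c Dx)[]. Qed.

Let LE (c : Scal R s) x y : D x -> D y -> L (c *: x + y) = c *: L x + L y.
Proof. by move=> Dx /(L_linear c Dx)[]. Qed.

Let subE x y a : x - a *r y = of_real s (- a) *: y + x.
Proof. by rewrite of_realN scaleNr addrC. Qed.

Lemma euler_unique h y : 0 < h -> D y -> J h (y - h *r L y) = y.
Proof.
move=> h0 Dy; have [Dz Hz] := J_solves (y - h *r L y) h0.
apply/eqP; rewrite -subr_eq0; apply/eqP.
have -> : J h (y - h *r L y) - y = (-1) *: y + J h (y - h *r L y).
  by rewrite scaleN1r addrC.
apply: (L_inj h0); first exact: D_linear.
rewrite LE // !scaleN1r scalerDr scalerN.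
set z := J _ _ in Dz Hz *.
have -> : - y + z - (- (h *r L y) + h *r L z) = (z - h *r L z) - (y - h *r L y).
  by vec_eq [:: y; z; L y; L z]; ring.
by rewrite Hz subrr.
Qed.

Lemma euler_linear h : linear (J h).
Proof.
move=> c x y; case: (leP h 0) => [h0|h0]; first by rewrite !J_id.
have [Dx Hx] := J_solves x h0; have [Dy Hy] := J_solves y h0.
rewrite -[RHS](euler_unique h0 (D_linear c Dx Dy)) LE //.
congr (J h _); rewrite -{1}Hx -{1}Hy; set u := J h x; set v := J h y.
by rewrite scalerBr [h *r (_ + _)]scalerDr !scalerA [of_real s h * c]mulrC opprD addrACA.
Qed.

Let JB h x y : J h (x - y) = J h x - J h y.
Proof.
by have := euler_linear h (-1) y x; rewrite !scaleN1r ![- _ + _]addrC.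
Qed.

Let JZ h a x : J h (a *r x) = a *r J h x.
Proof.
have J0 : J h 0 = 0 by rewrite -{1}(subrr 0) JB subrr.
by have := euler_linear h (of_real s a) x 0; rewrite !addr0 J0 addr0.
Qed.

(** [L (J h x) = (J h x - x) / h] belongs to [D], and solves the equation which
    determines [J h (L x)]. *)
Lemma euler_domain h x : D x -> D (J h x) /\ L (J h x) = J h (L x).
Proof.
move=> Dx; case: (leP h 0) => [h0|h0]; first by rewrite !J_id.
have [Dy Hy] := J_solves x h0; split=> //; set y := J h x in Dy Hy *.
have Ly : L y = of_real s (- h^-1) *: x + h^-1 *r y.
  by rewrite -Hy; vec_eq [:: y; L y]; field; rewrite gt_eqF.
have DLy : D (L y).
  rewrite Ly; apply: D_linear => //.
  have := D_linear (of_real s h^-1 - 1) Dy Dy.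
  by rewrite scalerBl scale1r subrK.
rewrite -[LHS](euler_unique h0 DLy); congr (J h _).
by rewrite -[in RHS]Hy [X in _ = L X]subE LE // -subE.
Qed.

(** [J b] commutes with [L] on [D], hence with [I - a L], hence with its inverse. *)
Lemma euler_commute a b x : J a (J b x) = J b (J a x).
Proof.
case: (leP a 0) => [a0|a0]; first by rewrite !(J_id _ a0).
have [Du Hu] := J_solves x a0; set u := J a x in Du Hu *.
have [Dv Hv] := euler_domain b Du.
by rewrite -[RHS](euler_unique a0 Dv) Hv -JZ -JB Hu.
Qed.

Local Notation word w x := (foldr J x w).

Let word_linear w : linear (fun x => word w x).
Proof. by move=> c x y; elim: w => //= h w ->; rewrite euler_linear. Qed.

Let wordB w x y : word w (x - y) = word w x - word w y.
Proof. by elim: w => //= h w ->; rewrite JB. Qed.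

Let wordZ w a x : word w (a *r x) = a *r word w x.
Proof. by elim: w => //= h w ->; rewrite JZ. Qed.

Let word_domain w x : D x -> D (word w x) /\ L (word w x) = word w (L x).
Proof.
move=> Dx; elim: w => //= h w [Dw Lw].
by have [DJ ->] := euler_domain h Dw; rewrite Lw.
Qed.

Let word_J w h x : word w (J h x) = J h (word w x).
Proof. by elim: w => //= a w ->; rewrite euler_commute. Qed.

(** The domain of [L^2], on which splitting a step changes the scheme to second
    order. *)
Definition core x := D x /\ D (L x).

Let word_core w x : core x -> core (word w x) /\ L (L (word w x)) = word w (L (L x)).
Proof.
move=> [Dx DLx]; have [Dw Lw] := word_domain w Dx.
by rewrite /core Lw; have [DLw ->] := word_domain w DLx.
Qed.

(** On [D] one has [J h d - d = h J h (L d)], which tends to 0; density and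
    stability extend this to all of [X]. *)
Lemma euler_approx x (e : R) : 0 < e -> exists2 h, 0 < h & nrm (J h x - x) <= e.
Proof.
move=> e0; have K2 : 0 < K + 2 by rewrite addr_gt0.
have e2 := divr_gt0 e0 K2; have [d Dd Hd] := D_dense x e2.
have C0 : 0 < K * nrm (L d) + 1 by rewrite ltr_wpDl // mulr_ge0 ?nrm_ge0 ?(ltW K_gt0).
pose h := e / (K + 2) / (K * nrm (L d) + 1); have h0 : 0 < h by rewrite divr_gt0.
exists h => //; have [_ LJ] := euler_domain h Dd; have [_ HJ] := J_solves d h0.
have -> : J h x - x = (d - x) - J h (d - x) + h *r J h (L d).
  rewrite JB -LJ; move: HJ; set z := J h d => HJ.
  by rewrite -{1}HJ; vec_eq [:: J h x; x; z; L z]; ring.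
apply: le_trans (nrmD _ _) _; apply: le_trans (lerD (nrmB _ _) (lexx _)) _.
rewrite nrmZ_ge0 ?(ltW h0) //.
have H1 := J_bounded [:: h] (L d); have H2 := J_bounded [:: h] (d - x).
have H3 : K * nrm (d - x) <= K * (e / (K + 2)) by rewrite ler_pM2l.
have H4 : h * nrm (J h (L d)) <= h * (K * nrm (L d) + 1).
  by rewrite ler_pM2l //; rewrite /= in H1; lra.
rewrite {2}/h divfK ?gt_eqF // in H4.
have -> : e = e / (K + 2) + K * (e / (K + 2)) + e / (K + 2) by field; rewrite gt_eqF.
by rewrite /= in H2; lra.
Qed.

Lemma core_dense x (e : R) : 0 < e -> exists2 y, core y & nrm (y - x) <= e.
Proof.
move=> e0; have e2 : 0 < e / 2 by rewrite divr_gt0.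
have [d Dd Hd] := D_dense x e2; have [h h0 Hh] := euler_approx d e2.
have [DJ LJ] := euler_domain h Dd.
exists (J h d); first by split=> //; rewrite LJ; have [] := J_solves (L d) h0.
by apply: le_trans (nrm_trans d _ _) _; lra.
Qed.

(** The resolvent identity behind the scheme: since
    [(I - a L) (I - b L) = I - (a + b) L + a b L^2], the operators [J a J b] and
    [J (a + b)] differ by [- a b J a J b J (a + b) L^2]. *)
Lemma euler_step a b x : 0 <= a -> 0 <= b -> core x ->
  J a (J b x) - J (a + b) x = - ((a * b) *r J a (J b (J (a + b) (L (L x))))).
Proof.
rewrite le_eqVlt => /orP[/eqP <- _ _|a0].
  by rewrite add0r mul0r of_real0 scale0r oppr0 (J_id _ (lexx 0)) subrr.
rewrite le_eqVlt => /orP[/eqP <- _|b0 Cx].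
  by rewrite addr0 mulr0 of_real0 scale0r oppr0 (J_id _ (lexx 0)) subrr.
have ab0 : 0 < a + b by rewrite addr_gt0.
have [Du Hu] := J_solves x ab0.
have /= [[_ DLu] <-] := word_core [:: a + b] Cx.
set u := J (a + b) x in Du Hu DLu *.
have Dp : D (u - b *r L u) by rewrite subE; apply: D_linear.
have Lp : L (u - b *r L u) = L u - b *r L (L u) by rewrite !subE LE.
rewrite -{1}Hu.
have -> : u - (a + b) *r L u =
    (u - b *r L u - a *r L (u - b *r L u)) - (a * b) *r L (L u).
  by rewrite Lp; vec_eq [:: u; L u; L (L u)]; ring.
rewrite euler_commute JB euler_unique // JB euler_unique // !JZ.
rewrite [J b (J a _)]euler_commute.
by vec_eq [:: u; J a (J b (L (L u)))]; ring.
Qed.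

Let pairs n a b := flatten (nseq n [:: a; b]).

(** Telescoping: the [n] pairs of steps are merged one after another, and each
    merge costs [a b], multiplied by a product of resolvents and [L^2 x].  The
    prefix [v] of steps already passed is what the induction carries along. *)
Lemma euler_compare n v a b x : 0 <= a -> 0 <= b -> core x ->
  nrm (word v (word (pairs n a b) x) - word v (word (nseq n (a + b)) x)) <=
  n%:R * (a * b * (K * nrm (L (L x)))).
Proof.
move=> a0 b0 Cx; elim: n v => [|n IH] v; first by rewrite subrr nrm0 mul0r.
rewrite /=; set P := word (pairs n a b) x; set Q := word (nseq n (a + b)) x.
have -> : word v (J a (J b P)) - word v (J (a + b) Q) =
  (word (v ++ [:: a; b]) P - word (v ++ [:: a; b]) Q) +
  word v (J a (J b Q) - J (a + b) Q).
  rewrite !foldr_cat /= wordB.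
  by vec_eq [:: word v (J a (J b P)); word v (J (a + b) Q); word v (J a (J b Q))]; ring.
apply: le_trans (nrmD _ _) _; rewrite -natr1 mulrDl mul1r; apply: lerD => //.
have [CQ LQ] := word_core (nseq n (a + b)) Cx.
rewrite euler_step // LQ -scaleNr -of_realN wordZ nrmZ normrN ger0_norm ?mulr_ge0 //.
rewrite ler_wpM2l ?mulr_ge0 //.
by have := J_bounded (v ++ [:: a; b; a + b] ++ nseq n (a + b)) (L (L x));
  rewrite !foldr_cat.
Qed.

Let E k t x := word (nseq (2 ^ k) (t / (2 ^ k)%:R)) x.

Let pow2_neq0 k : (2 ^ k)%:R != 0 :> R.
Proof. by rewrite pnatr_eq0 expn_eq0. Qed.

(** Halving [2^k] steps of length [2 c] costs [2^k c^2], a geometric sequence. *)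
Let E_core t x : 0 <= t -> core x -> forall k,
  nrm (E k.+1 t x - E k t x) <=
  t ^+ 2 * K * nrm (L (L x)) / 2 * (1 - 2^-1) * 2^-1 ^+ k.
Proof.
move=> t0 Cx k; set c := t / (2 ^ k.+1)%:R.
have c0 : 0 <= c by rewrite divr_ge0.
have -> : E k.+1 t x = word (pairs (2 ^ k) c c) x.
  rewrite /E -/c expnSr; elim: (2 ^ k)%N => // n IH.
  by rewrite mulSn /= IH.
have -> : E k t x = word (nseq (2 ^ k) (c + c)) x.
  by congr (foldr _ _ (nseq _ _)); rewrite /c expnS natrM; field; rewrite pow2_neq0.
apply: le_trans (euler_compare (2 ^ k) [::] c0 c0 Cx) _.
rewrite le_eqVlt; apply/orP; left; apply/eqP.
by rewrite /c exprVn expnS natrM natrX; field; rewrite expf_neq0.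
Qed.

Let E_cvg t x : exists y, (fun k => E k t x) @ \oo --> y.
Proof.
case: (leP 0 t) => t0; last first.
  exists x; apply/cvg_seqP => e e0; exists 0%N => n _.
  rewrite /E (_ : word _ _ = x) ?subrr ?nrm0 ?(ltW e0) //.
  elim: (X in nseq X) => //= m ->; rewrite J_id //.
  by rewrite pmulr_lle0 ?invr_gt0 ?ltr0n ?expn_gt0 // ltW.
suff [y Hy] : exists y, forall e : R, 0 < e ->
    exists N, forall n, (N <= n)%N -> nrm (E n t x - y) <= e.
  by exists y; apply/cvg_seqP.
apply: nrm_cauchy_cvg => e e0.
have e3 : 0 < e / 4 by rewrite divr_gt0.
have [d Cd Hd] := core_dense x (divr_gt0 e3 K_gt0).
have [|z Hz] := @geometric_cvg _ _ _ (fun k => E k t d) _ 2^-1 _ (E_core t0 Cd).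
  by lra.
have [|N HN] := @geometric_small _ 2^-1 (t ^+ 2 * K * nrm (L (L d)) / 2) _ _ e3.
  by lra.
exists N => n Nn.
have -> : E n t x - E N t x =
  (E n t d - z) - (E N t d - z) - (E n t (d - x) - E N t (d - x)).
  rewrite /E !wordB.
  by vec_eq [:: E n t x; E N t x; E n t d; E N t d; z]; ring.
apply: le_trans (nrmB _ _) _.
apply: le_trans (lerD (nrmB _ _) (nrmB _ _)) _.
have Kd : K * nrm (d - x) <= e / 4 by rewrite -ler_pdivlMl // mulrC.
have := J_bounded (nseq (2 ^ n) (t / (2 ^ n)%:R)) (d - x).
have := J_bounded (nseq (2 ^ N) (t / (2 ^ N)%:R)) (d - x).
have := Hz n; have := HN n Nn; have := Hz N; have := HN N (leqnn N).
rewrite -!/(E _ _ _); lra.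
Qed.

Lemma cvg_nrm_le (u : nat -> X) y z (c : R) : u @ \oo --> y ->
  (forall n, nrm (u n - z) <= c) -> nrm (y - z) <= c.
Proof.
move=> /cvg_seqP uy H; apply: (@le_addM_eps _ _ _ 1) => e e0.
have [N HN] := uy e e0; have := HN N (leqnn N); rewrite nrmC => h1.
by apply: le_trans (nrm_trans (u N) _ _) _; have := H N; lra.
Qed.

Lemma euler_limit : exists T : R -> {linear X -> X},
  forall t x, (fun k => E k t x) @ \oo --> T t x.
Proof.
have /choice[f Hf] : forall p : R * X, exists y, (fun k => E k p.1 p.2) @ \oo --> y.
  by move=> p; apply: E_cvg.
suff /choice[T HT] : forall t, exists g : {linear X -> X}, g =1 (fun x => f (t, x)).
  by exists T => t x; rewrite HT; apply: (Hf (t, x)).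
move=> t; apply: linear_pack => c x y.
have H : (fun k => E k t (c *: x + y)) @ \oo --> c *: f (t, x) + f (t, y).
  rewrite (_ : (fun _ => _) = (fun k => c *: E k t x + E k t y)); last first.
    by apply/funext => k; rewrite /E word_linear.
  by apply: cvgD; [apply: cvgZr; apply: (Hf (t, x))|apply: (Hf (t, y))].
exact: cvg_unique (Hf (t, c *: x + y)) H.
Qed.

Section Limit.
Variable T : R -> {linear X -> X}.
Hypothesis T_lim : forall t x, (fun k => E k t x) @ \oo --> T t x.
Arguments T_lim : clear implicits.

Lemma limit_bounded t x : nrm (T t x) <= K * nrm x.
Proof.
rewrite -(subr0 (T t x)); apply: cvg_nrm_le (T_lim t x) _ => n.
by rewrite subr0 J_bounded.
Qed.

Let T_euler t x : 0 <= t -> core x ->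
  nrm (T t x - J t x) <= t ^+ 2 * (K * nrm (L (L x)) / 2).
Proof.
move=> t0 Cx.
have [|z Hz] := @geometric_cvg _ _ _ (fun k => E k t x) _ 2^-1 _ (E_core t0 Cx).
  by lra.
have -> : T t x = z.
  apply: (cvg_unique _ (T_lim t x)); first exact: norm_hausdorff.
  apply/cvg_seqP => e e0.
  have [|N HN] := @geometric_small _ 2^-1 (t ^+ 2 * K * nrm (L (L x)) / 2) _ _ e0.
    by lra.
  by exists N => n /HN; apply: le_trans (Hz n).
have := Hz 0%N; rewrite /E /= expn0 divr1 expr0 mulr1 nrmC => /le_trans; apply.
by rewrite le_eqVlt; apply/orP; left; apply/eqP; ring.
Qed.

(** Each step moves a vector of [D] by [h] times a product of resolvents applied
    to [L x], so the bound holds along the scheme and passes to the limit. *)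
Let T_lipschitz t x : 0 <= t -> D x -> nrm (T t x - x) <= t * (K * nrm (L x)).
Proof.
move=> t0 Dx; apply: cvg_nrm_le (T_lim t x) _ => k.
have -> : t * (K * nrm (L x)) = (2 ^ k)%:R * (t / (2 ^ k)%:R * (K * nrm (L x))).
  by field; rewrite pow2_neq0.
rewrite /E; set h := t / _; have h0 : 0 <= h by rewrite divr_ge0.
elim: (2 ^ k)%N => [|n IH]; first by rewrite subrr nrm0 mul0r.
rewrite -natr1 mulrDl mul1r; apply: le_trans (nrm_trans (word (nseq n h) x) _ _) _.
rewrite addrC lerD //=.
have [Dw Lw] := word_domain (nseq n h) Dx.
have -> : J h (word (nseq n h) x) - word (nseq n h) x =
    h *r word (nseq n.+1 h) (L x).
  have [h0'|h1] := leP h 0.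
    have -> : h = 0 by apply/eqP; rewrite eq_le h0 h0'.
    by rewrite J_id // subrr of_real0 scale0r.
  have [_ HJ] := J_solves (word (nseq n h) x) h1.
  have [_ LJ] := euler_domain h Dw.
  rewrite -{2}HJ LJ Lw /=.
  by vec_eq [:: J h (word (nseq n h) x); J h (word (nseq n h) (L x))]; ring.
by rewrite nrmZ_ge0 // ler_wpM2l.
Qed.

Let J_rate t x : 0 < t -> D x -> J t x - x = t *r J t (L x).
Proof.
move=> t0 Dx; have [_ HJ] := J_solves x t0; have [_ <-] := euler_domain t Dx.
by rewrite -{2}HJ; vec_eq [:: J t x; L (J t x)]; ring.
Qed.

(** On [core] the limit agrees with one resolvent step to second order in [t].  A
    vector [x] of [D] is replaced by [z = J h x] of [core], at the price of
    [T_lipschitz] for [z - x], which is small in the graph norm. *)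
Let domain_rate x (e : R) : D x -> 0 < e -> exists2 d : R, 0 < d &
  forall t, 0 < t < d -> nrm (T t x - x - t *r L x) <= e * t.
Proof.
move=> Dx e0; have K1 : 0 < K + 1 by rewrite addr_gt0.
have [h h0 Hh] := euler_approx (L x) (divr_gt0 e0 (mulr_gt0 (ltr0n R 2) K1)).
have [Dz Lz] := euler_domain h Dx; set z := J h x in Dz Lz.
have DLz : D (L z) by rewrite Lz; have [] := J_solves (L x) h0.
set C := K * nrm (L (L z)).
have C0 : 0 <= C by rewrite mulr_ge0 ?nrm_ge0 ?(ltW K_gt0).
have C1 : 0 < 2 * (2 * C + 1) by lra.
exists (e / (2 * (2 * C + 1))) => [|t /andP[t0 td]]; first by rewrite divr_gt0.
have -> : T t x - x - t *r L x = - (T t (z - x) - (z - x)) + t *r (L z - L x) +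
  (T t z - J t z) + (J t z - z - t *r L z).
  rewrite (linearB (T t)).
  by vec_eq [:: T t x; x; L x; T t z; z; L z; J t z]; ring.
have Dzx : D (z - x).
  by have := D_linear (-1) Dx Dz; rewrite scaleN1r addrC.
have Lzx : L (z - x) = L z - L x.
  by have := LE (-1) Dx Dz; rewrite !scaleN1r ![- _ + _]addrC.
have H1 := T_lipschitz (ltW t0) Dzx; rewrite Lzx in H1.
have H2 : nrm (t *r (L z - L x)) = t * nrm (L z - L x) by rewrite nrmZ_ge0 ?(ltW t0).
have H3 := T_euler (ltW t0) (conj Dz DLz); rewrite -/C in H3.
have H4 : nrm (J t z - z - t *r L z) <= t ^+ 2 * C.
  rewrite J_rate // (_ : _ - _ = t *r (J t (L z) - L z)); last by rewrite scalerBr.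
  rewrite J_rate // !nrmZ_ge0 ?(ltW t0) // expr2 -mulrA !ler_pM2l //.
  exact: (J_bounded [:: t]).
rewrite -Lz in Hh.
have H5 : t * ((K + 1) * nrm (L z - L x)) <= t * (e / 2).
  rewrite ler_pM2l //.
  have -> : e / 2 = (K + 1) * (e / (2 * (K + 1))) by field; rewrite gt_eqF.
  by rewrite ler_pM2l.
have H6 : t * (t * (2 * C + 1)) <= t * (e / 2).
  rewrite ler_pM2l //.
  have -> : e / 2 = e / (2 * (2 * C + 1)) * (2 * C + 1) by field; lra.
  by rewrite ler_wpM2r ?(ltW td) //; lra.
apply: le_trans (nrmD _ _) _; apply: le_trans (lerD (nrmD _ _) H4) _.
apply: le_trans (lerD (lerD (nrmD _ _) H3) (lexx _)) _; rewrite nrmN H2.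
have H7 : 0 <= t ^+ 2 * C by rewrite mulr_ge0 // exprn_ge0 // ltW.
have H8 : 0 <= t ^+ 2 by rewrite exprn_ge0 // ltW.
have -> : e * t = t * (e / 2) + t * (e / 2) by field.
have H9 : t * (K * nrm (L z - L x)) + t * nrm (L z - L x) <= t * (e / 2).
  by apply: le_trans H5; rewrite le_eqVlt; apply/orP; left; apply/eqP; ring.
have H10 : 2 * (t ^+ 2 * C) + t ^+ 2 <= t * (e / 2).
  by apply: le_trans H6; rewrite le_eqVlt; apply/orP; left; apply/eqP; ring.
by rewrite mulrA in H3 *; lra.
Qed.

Let T_J t h x : T t (J h x) = J h (T t x).
Proof.
apply: (cvg_unique _ (T_lim t (J h x))); first exact: norm_hausdorff.
apply/cvg_seqP => e e0; have /cvg_seqP/(_ _ (divr_gt0 e0 K_gt0))[N HN] := T_lim t x.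
exists N => n /HN Hn; rewrite /E word_J -JB.
apply: le_trans (J_bounded [:: h] _) _.
by rewrite -ler_pdivlMl // [K^-1 * e]mulrC; exact: Hn.
Qed.

(** On [core], alternating steps of lengths [t / 2^n] and [u / 2^n] is close, by
    [euler_compare], to taking [2^n] steps of length [(t + u) / 2^n]. *)
Let T_semigroup t u x : 0 <= t -> 0 <= u -> T (t + u) x = T t (T u x).
Proof.
move=> t0 u0; apply/eqP; rewrite -subr_eq0; apply/eqP; apply: nrm_small => e e0.
apply: (@le_addM_eps _ _ _ (K + K * K + 3 + K)) => r r0; apply: ler_wpDl => //.
  exact: ltW.
have [d Cd Hd] := core_dense x r0.
have /cvg_seqP/(_ r r0)[N1 H1] := T_lim (t + u) d.
have /cvg_seqP/(_ r r0)[N2 H2] := T_lim u d.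
have /cvg_seqP/(_ r r0)[N3 H3] := T_lim t (T u d).
have [|N4 H4] := @geometric_small _ 2^-1 (t * u * (K * nrm (L (L d)))) _ _ r0.
  by lra.
pose n := maxn (maxn N1 N2) (maxn N3 N4).
have {}H1 : nrm (E n (t + u) d - T (t + u) d) <= r by rewrite H1 // !leq_max leqnn.
have {}H2 : nrm (E n u d - T u d) <= r by rewrite H2 // !leq_max leqnn orbT.
have {}H3 : nrm (E n t (T u d) - T t (T u d)) <= r.
  by rewrite H3 // !leq_max leqnn !orbT.
have {}H4 := H4 n; rewrite !leq_max leqnn !orbT in H4; have {H4} H4 := H4 isT.
have H5 : nrm (E n t (E n u d) - E n (t + u) d) <= r.
  apply: le_trans H4.
  have -> : E n t (E n u d) = word (pairs (2 ^ n) (t / (2 ^ n)%:R) (u / (2 ^ n)%:R)) d.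
    rewrite /E; set a := t / _; set b := u / _.
    elim: (2 ^ n)%N => //= m IH.
    by rewrite -{}IH; congr (J a _); rewrite word_J.
  have -> : E n (t + u) d = word (nseq (2 ^ n) (t / (2 ^ n)%:R + u / (2 ^ n)%:R)) d.
    by rewrite /E mulrDl.
  apply: le_trans (euler_compare (2 ^ n) [::] _ _ Cd) _; rewrite ?divr_ge0 //.
  rewrite le_eqVlt; apply/orP; left; apply/eqP.
  by rewrite exprVn natrX; field; rewrite expf_neq0.
have -> : T (t + u) x - T t (T u x) = (T t (T u (d - x)) - T (t + u) (d - x)) -
  (E n (t + u) d - T (t + u) d) - (E n t (E n u d) - E n (t + u) d) +
  E n t (E n u d - T u d) + (E n t (T u d) - T t (T u d)).
  rewrite [E n t (_ - _)]wordB !(linearB (T _)) -!/(E _ _ _).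
  by vec_eq [:: T (t + u) x; T t (T u x); T (t + u) d; T t (T u d); E n (t + u) d;
     E n t (E n u d); E n t (T u d)]; ring.
have H6 := J_bounded (nseq (2 ^ n) (t / (2 ^ n)%:R)) (E n u d - T u d).
rewrite -/(E _ _ _) in H6.
have H7 := limit_bounded t (T u (d - x)); have H8 := limit_bounded u (d - x).
have H9 := limit_bounded (t + u) (d - x).
have H10 : K * nrm (T u (d - x)) <= K * (K * r).
  by rewrite ler_pM2l // (le_trans H8) // ler_pM2l.
have H11 : K * nrm (E n u d - T u d) <= K * r by rewrite ler_pM2l.
have H12 : K * nrm (d - x) <= K * r by rewrite ler_pM2l.
apply: le_trans (nrmD _ _) _; apply: le_trans (lerD (nrmD _ _) H3) _.
apply: le_trans (lerD (lerD (nrmB _ _) H6) (lexx _)) _.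
apply: le_trans (lerD (lerD (lerD (nrmB _ _) H5) (lexx _)) (lexx _)) _.
apply: le_trans (lerD (lerD (lerD (lerD (nrmB _ _) H1) (lexx _)) (lexx _)) (lexx _)) _.
lra.
Qed.

Lemma limit_generates : generates D L T.
Proof.
split; first split.
- by move=> t t0; apply: bounded_continuous (limit_bounded t).
- move=> x; apply: (cvg_unique _ (T_lim 0 x)); first exact: norm_hausdorff.
  apply/cvg_seqP => e e0; exists 0%N => n _.
  rewrite /E (_ : word _ _ = x) ?subrr ?nrm0 ?(ltW e0) //.
  by elim: (X in nseq X) => //= m ->; rewrite J_id // mul0r.
- by move=> t u x t0 u0; apply: T_semigroup.
- move=> x; apply/cvg_at0rP => e e0; have K2 : 0 < K + 2 by rewrite addr_gt0.
  have [y Dy Hy] := D_dense x (divr_gt0 e0 K2).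
  have C1 : 0 < (K * nrm (L y) + 1) * (K + 2).
    by rewrite mulr_gt0 // ltr_wpDl // mulr_ge0 ?nrm_ge0 ?(ltW K_gt0).
  exists (e / ((K * nrm (L y) + 1) * (K + 2))); first by rewrite divr_gt0.
  move=> t /andP[t0 td].
  have -> : T t x - x = (T t y - y) - T t (y - x) + (y - x).
    by rewrite (linearB (T t)); vec_eq [:: T t x; x; T t y; y]; ring.
  apply: le_trans (nrmD _ _) _; apply: le_trans (lerD (nrmB _ _) Hy) _.
  have H1 := T_lipschitz (ltW t0) Dy; have H2 := limit_bounded t (y - x).
  have H3 : K * nrm (y - x) <= K * (e / (K + 2)) by rewrite ler_pM2l.
  have H4 : t * (K * nrm (L y) + 1) <= e / (K + 2).
    rewrite -ler_pdivlMr ?ltr_wpDl ?mulr_ge0 ?nrm_ge0 ?(ltW K_gt0) //.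
    by rewrite -mulrA -invfM [(K + 2) * _]mulrC; exact: ltW.
  have H5 : e = e / (K + 2) + K * (e / (K + 2)) + e / (K + 2).
    by field; rewrite gt_eqF.
  by rewrite [leRHS]H5; rewrite mulrDr mulr1 in H4; lra.
move=> x g; split=> [[Dx <-]|/right_derivativeP H].
  by apply/right_derivativeP => e e0; exact: domain_rate.
(* Conversely, let the difference quotients at [x] converge to [g].  Applying
   [J 1] to them gives [L (J 1 x) = J 1 g], whence [x = J 1 (x - g)]. *)
have [Dv Hv] := J_solves x (@ltr01 R).
have Lv : L (J 1 x) = J 1 g.
  apply/eqP; rewrite -subr_eq0; apply/eqP; apply: nrm_small => e e0.
  apply: (@le_addM_eps _ _ _ (K + 1)) => r r0; apply: ler_wpDl; first exact: ltW.
  have [d1 d10 H1] := domain_rate Dv r0; have [d2 d20 H2] := H r r0.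
  have m0 : 0 < Num.min d1 d2 by rewrite lt_min d10.
  pose t : R := Num.min d1 d2 / 2; have t0 : 0 < t by rewrite divr_gt0.
  have /andP[td1 td2] : (t < d1) && (t < d2) by rewrite -lt_min /t; lra.
  rewrite -(ler_pM2l t0) -nrmZ_ge0 ?(ltW t0) //.
  have -> : t *r (L (J 1 x) - J 1 g) =
    J 1 (T t x - x - t *r g) - (T t (J 1 x) - J 1 x - t *r L (J 1 x)).
    rewrite !JB JZ T_J.
    by vec_eq [:: J 1 (T t x); J 1 x; J 1 g; L (J 1 x)]; ring.
  apply: le_trans (nrmB _ _) _.
  have H3 := J_bounded [:: 1] (T t x - x - t *r g); rewrite /= in H3.
  have H4 := H1 t; rewrite t0 td1 in H4; have {}H4 := H4 isT.
  have H5 := H2 t; rewrite t0 td2 in H5; have {}H5 := H5 isT.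
  have H6 : K * nrm (T t x - x - t *r g) <= K * (r * t) by rewrite ler_pM2l.
  lra.
have Ex : x = J 1 (x - g).
  by rewrite JB -Lv; rewrite of_real1 scale1r in Hv; rewrite Hv.
have [Dx Hx] := J_solves (x - g) (@ltr01 R).
rewrite -Ex in Dx Hx; split=> //.
by move: Hx; rewrite of_real1 scale1r => /(congr1 (fun z => x - z)); rewrite !subKr.
Qed.

End Limit.

(** A Hille-Yosida theorem in the form needed here: a densely defined operator
    whose resolvents have uniformly bounded products generates a bounded
    semigroup. *)
Theorem euler_generates : exists T : R -> {linear X -> X},
  generates D L T /\ forall t x, nrm (T t x) <= K * nrm x.
Proof.
have [T HT] := euler_limit; exists T.
by split; [exact: limit_generates|exact: limit_bounded].
Qed.

End Euler.

(** * Primitives and one-sided derivatives *)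
Section Primitive.
Variable R : realType.
Implicit Types (f g F G : R -> R) (t a b e : R).
Local Notation mu := (@lebesgue_measure R).

(** The primitive of [f] that vanishes at 0.  The base point -1 of the integrals
    makes it differentiable, from both sides, on all of [0, +oo[. *)
Definition prim f t : R :=
  (\int[mu]_(u in `[-1, t]) f u) - (\int[mu]_(u in `[-1, 0]) f u).

Lemma prim0 f : prim f 0 = 0.
Proof. by rewrite /prim subrr. Qed.

Let prim_deriv f t : continuous f -> -1 < t ->
  derivable (prim f) t 1 /\ derive1 (prim f) t = f t.
Proof.
move=> cf t1; pose F (x : R) := (\int[mu]_(u in `[-1%R, x]) f u)%R.
have [dF F'] : derivable F t 1 /\ derive1 F t = f t.
  apply: (@continuous_FTC1_closed _ f (-1) t (t + 1)) => //; last exact: cf.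
    by rewrite ltrDl.
  apply: continuous_compact_integrable; first exact: segment_compact.
  exact: continuous_subspaceT.
have E : prim f = F \- cst (\int[mu]_(u in `[-1, 0]) f u) by [].
have dc : derivable (cst (\int[mu]_(u in `[-1, 0]) f u)%R : R -> R) t 1.
  exact: derivable_cst.
split; first by rewrite E; exact: derivableB dF dc.
by rewrite E derive1E (deriveB dF dc) derive_cst subr0 -derive1E.
Qed.

Lemma prim_continuous f t : continuous f -> 0 <= t -> {for t, continuous (prim f)}.
Proof.
move=> cf t0; apply: differentiable_continuous; apply/derivable1_diffP.
by have [|] := prim_deriv cf (t := t); first by lra.
Qed.

Lemma prim_rate f t e : continuous f -> 0 <= t -> 0 < e ->
  exists2 d : R, 0 < d & forall r : R, `|r| < d ->
    `|prim f (t + r) - prim f t - r * f t| <= e * `|r|.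
Proof.
move=> cf t0 e0; have [|dP P'] := prim_deriv cf (t := t); first by lra.
have : h^-1 *: (prim f (h *: 1 + t) - prim f t) @[h --> 0^'] --> f t.
  by rewrite -P' derive1E; exact: dP.
move=> /cvgrPdist_le /(_ e e0); rewrite near_withinE => /nbhs_ballP[d /= d0 Hd].
exists d => // r rd; have [->|r0] := eqVneq r 0.
  by rewrite addr0 subrr mul0r subr0 normr0 mulr0.
have := Hd r; rewrite /ball /= sub0r normrN => /(_ rd r0).
rewrite distrC -(ler_pM2r (_ : 0 < `|r|)) ?normr_gt0 // -normrM.
congr (`|_| <= _); rewrite /GRing.scale /= mulr1 [r + t]addrC; by field.
Qed.

Lemma integral_prim f t : continuous f -> 0 <= t ->
  (\int[mu]_(u in `[0%R, t]) (f u)%:E)%E = (prim f t)%:E.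
Proof.
move=> cf; rewrite le_eqVlt => /orP[/eqP <-|t0].
  by rewrite set_itv1 integral_set1 prim0.
rewrite (@continuous_FTC2 _ f (prim f) 0 t) ?prim0 ?sube0 //.
- exact: continuous_subspaceT.
- split=> [u||].
  + by rewrite in_itv /= => /andP[u0 _]; have [|] := prim_deriv cf (t := u); first by lra.
  + exact: cvg_at_right_filter (prim_continuous cf (lexx 0)).
  + exact: cvg_at_left_filter (prim_continuous cf (ltW t0)).
- by move=> u; rewrite in_itv /= => /andP[u0 _]; have [|] := prim_deriv cf (t := u);
    first by lra.
Qed.

(** The upper left Dini derivative of [F] at [t] is at most [c]. *)
Definition left_rate_le F (c : R) t := forall e, 0 < e ->
  exists2 d : R, 0 < d & forall r : R, 0 < r < d -> F t - F (t - r) <= r * (c + e).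

Lemma prim_left_rate_le f t : continuous f -> 0 <= t -> left_rate_le (prim f) (f t) t.
Proof.
move=> cf t0 e e0; have [d d0 Hd] := prim_rate cf t0 e0; exists d => // r /andP[r0 rd].
have := Hd (- r); rewrite normrN gtr0_norm // => /(_ rd).
by rewrite ler_norml => /andP[]; lra.
Qed.

Lemma primN_left_rate_le f t : continuous f -> 0 <= t ->
  left_rate_le (fun u => - prim f u) (- f t) t.
Proof.
move=> cf t0 e e0; have [d d0 Hd] := prim_rate cf t0 e0; exists d => // r /andP[r0 rd].
have := Hd (- r); rewrite normrN gtr0_norm // => /(_ rd).
by rewrite ler_norml => /andP[]; lra.
Qed.

(** After subtracting [t e], the function decreases strictly from the left at each
    point of ]0, a], so its maximum over [0, a] can only be attained at 0. *)
Lemma left_rate_le0 F a : 0 <= a -> (forall t, 0 <= t -> {for t, continuous F}) ->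
  (forall t, 0 < t <= a -> left_rate_le F 0 t) -> F a <= F 0.
Proof.
move=> a0 cF HF; apply: (@le_addM_eps _ _ _ a) => e e0.
pose H t := F t - t * e.
have cH : {within `[0, a], continuous H}.
  apply: continuous_in_subspaceT => t; rewrite inE /= in_itv /= => /andP[t0 _].
  by apply: cvgB; [exact: cF|apply: cvgMl].
have [c] := EVT_max a0 cH; rewrite in_itv /= => /andP[c0 ca] Hmax.
have {}c0 : c = 0.
  apply/eqP; rewrite eq_le c0 andbT leNgt; apply/negP => {}c0.
  have e2 : 0 < e / 2 by rewrite divr_gt0.
  have [|d d0 Hd] := HF c _ _ e2; first by rewrite c0.
  pose m := Num.min c d; have m0 : 0 < m by rewrite lt_min c0.
  pose r := m / 2; have r0 : 0 < r by rewrite divr_gt0.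
  have /andP[rc rd] : (r < c) && (r < d) by rewrite -lt_min /r -/m; lra.
  have := Hmax (c - r); rewrite in_itv /= subr_ge0 (ltW rc) /= => Hm.
  have {}Hm : H (c - r) <= H c by apply: Hm; lra.
  have := Hd r; rewrite r0 rd => /(_ isT).
  have : 0 < r * e by rewrite mulr_gt0.
  by rewrite /H in Hm; lra.
have := Hmax a; rewrite in_itv /= lexx a0 c0 /H mul0r subr0 => /(_ isT); lra.
Qed.

Lemma left_rate_prim F g a : 0 <= a -> continuous g ->
  (forall t, 0 <= t -> {for t, continuous F}) ->
  (forall t, 0 < t <= a -> left_rate_le F (g t) t) -> F a <= F 0 + prim g a.
Proof.
move=> a0 cg cF HF.
have : F a - prim g a <= F 0 - prim g 0; last by rewrite prim0; lra.
apply: (@left_rate_le0 (fun t => F t - prim g t)) => // [t t0|t /andP[t0 ta] e e0].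
  by apply: cvgB; [exact: cF|exact: prim_continuous].
have e2 : 0 < e / 2 by rewrite divr_gt0.
have [|d1 d10 H1] := HF t _ _ e2; first by rewrite t0.
have [d2 d20 H2] := primN_left_rate_le cg (ltW t0) e2.
exists (Num.min d1 d2) => [|r]; first by rewrite lt_min d10.
rewrite lt_min => /and3P[r0 r1 r2].
by have := H1 r; have := H2 r; rewrite r0 r1 r2 => /(_ isT) ? /(_ isT) ?; lra.
Qed.

Lemma prim_le f g a : 0 <= a -> continuous f -> continuous g ->
  (forall t, 0 <= t <= a -> f t <= g t) -> prim f a <= prim g a.
Proof.
move=> a0 cf cg fg; have := @left_rate_prim (prim f) g a a0 cg.
rewrite prim0 add0r; apply=> [t t0|t /andP[t0 ta] e e0].
  exact: prim_continuous.
have [d d0 Hd] := prim_left_rate_le cf (ltW t0) e0; exists d => // r rd.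
have /andP[r0 _] := rd.
apply: le_trans (Hd r rd) _; rewrite ler_pM2l // lerD2r fg // ta ltW //.
Qed.

Definition rate F (c : R) t := forall e, 0 < e -> exists2 d : R, 0 < d &
  forall r : R, `|r| < d -> `|F (t + r) - F t - r * c| <= e * `|r|.

(** Antiderivatives are unique up to a constant, by [left_rate_le0] in both
    directions; the rules for linear combinations and shifts of [prim] follow. *)
Lemma prim_unique F f a : 0 <= a -> continuous f ->
  (forall t, 0 <= t -> {for t, continuous F}) -> (forall t, 0 <= t -> rate F (f t) t) ->
  prim f a = F a - F 0.
Proof.
move=> a0 cf cF HF; apply/eqP; rewrite eq_le; apply/andP; split.
  have : prim f a - F a <= prim f 0 - F 0; last by rewrite prim0; lra.
  apply: (@left_rate_le0 (fun t => prim f t - F t)) => // [t t0|t /andP[t0 ta] e e0].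
    by apply: cvgB; [exact: prim_continuous|exact: cF].
  have e2 : 0 < e / 2 by rewrite divr_gt0.
  have [d1 d10 H1] := HF t (ltW t0) _ e2.
  have [d2 d20 H2] := prim_left_rate_le cf (ltW t0) e2.
  exists (Num.min d1 d2) => [|r]; first by rewrite lt_min d10.
  rewrite lt_min => /and3P[r0 r1 r2]; have := H1 (- r).
  have := H2 r; rewrite r0 r2 normrN gtr0_norm // => /(_ isT) ? /(_ r1).
  by rewrite ler_norml => /andP[? ?]; lra.
have := @left_rate_prim F f a a0 cf cF; rewrite lerBlDl; apply=> t /andP[t0 ta] e e0.
have [d d0 Hd] := HF t (ltW t0) _ e0; exists d => // r /andP[r0 rd].
by have := Hd (- r); rewrite normrN gtr0_norm // => /(_ rd); rewrite ler_norml => /andP[? ?]; lra.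
Qed.

Lemma prim_linear (a b : R) f g t : 0 <= t -> continuous f -> continuous g ->
  prim (fun u => a * f u + b * g u) t = a * prim f t + b * prim g t.
Proof.
move=> t0 cf cg; pose F u := a * prim f u + b * prim g u.
have F0 : F 0 = 0 by rewrite /F !prim0 !mulr0 addr0.
rewrite (prim_unique (F := F) t0) ?F0 ?subr0 // => [u|u u0|u u0 e e0].
- by apply: cvgD; apply: cvgMr; [exact: cf|exact: cg].
- by apply: cvgD; apply: cvgMr; exact: prim_continuous.
have c0 : 0 < `|a| + `|b| + 1 by rewrite ltr_wpDl // addr_ge0.
have e1 := divr_gt0 e0 c0.
have [d1 d10 H1] := prim_rate cf u0 e1; have [d2 d20 H2] := prim_rate cg u0 e1.
exists (Num.min d1 d2) => [|r]; first by rewrite lt_min d10.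
rewrite lt_min => /andP[r1 r2].
have -> : F (u + r) - F u - r * (a * f u + b * g u) =
  a * (prim f (u + r) - prim f u - r * f u) +
  b * (prim g (u + r) - prim g u - r * g u) by rewrite /F; ring.
apply: le_trans (ler_normD _ _) _; rewrite !normrM.
have := H1 r r1; have := H2 r r2.
set x := `|_ - _|; set y := `|_ - _| => hx hy.
have Ha : `|a| * y <= `|a| * (e / (`|a| + `|b| + 1) * `|r|) by rewrite ler_wpM2l.
have Hb : `|b| * x <= `|b| * (e / (`|a| + `|b| + 1) * `|r|) by rewrite ler_wpM2l.
have Hc : 0 <= e / (`|a| + `|b| + 1) * `|r| by rewrite mulr_ge0 // ltW.
have -> : e * `|r| = (`|a| + `|b| + 1) * (e / (`|a| + `|b| + 1) * `|r|).
  by field; rewrite gt_eqF.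
lra.
Qed.

Lemma prim_shift f (h t : R) : 0 <= h -> 0 <= t -> continuous f ->
  prim (fun u => f (u + h)) t = prim f (t + h) - prim f h.
Proof.
move=> h0 t0 cf.
have ch (u : R) : (fun v => v + h : R) @ u --> u + h by apply: cvgD => //; exact: cvg_cst.
rewrite (prim_unique (F := fun u => prim f (u + h)) t0) ?add0r // => [u|u u0|u u0 e e0].
- by apply: (@continuous_comp _ _ _ (fun v => v + h) f); [exact: ch|exact: cf].
- apply: (@continuous_comp _ _ _ (fun v => v + h) (prim f)); first exact: ch.
  exact: prim_continuous (addr_ge0 u0 h0).
have [d d0 Hd] := prim_rate cf (addr_ge0 u0 h0) e0; exists d => // r rd.
by rewrite [u + r + h]addrAC; exact: Hd.
Qed.

End Primitive.

(** * Exponential rescaling of semigroups *)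
Section Rescale.
Variables (R : realType) (s : scalars) (X : completeNormedModType (Scal R s)).

Lemma expR_near0 (z : R) : `|z| <= 2^-1 ->
  [/\ expR z <= 2, `|expR z - 1| <= 2 * `|z| & `|expR z - 1 - z| <= 2 * z ^+ 2].
Proof.
move=> z12; have zz : z ^+ 2 <= 2^-1 * `|z|.
  by rewrite -real_normK ?num_real // expr2 ler_wpM2r.
have := z12; rewrite ler_norml => /andP[z1 z2].
have h1 := expR_ge1Dx z; have h2 := expR_ge1Dx (- z).
have e0 := expR_gt0 z; have e1 : expR z * expR (- z) = 1 by rewrite -expRD subrr expR0.
have h3 : expR z * (1 - z) <= 1 by rewrite -[leRHS]e1 ler_pM2l.
have h4 : 0 <= expR z - 1 - z <= 2 * z ^+ 2 by apply/andP; split; nra.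
have [h5 h6] := andP h4; have h7 := ler_norm z.
split; [lra| |by rewrite ger0_norm].
have -> : expR z - 1 = (expR z - 1 - z) + z by ring.
by apply: le_trans (ler_normD _ _) _; rewrite ger0_norm //; lra.
Qed.

Let rescale_derivative (U V : R -> {linear X -> X}) (w : R) (x y : X) :
  (forall t, 0 <= t -> V t x = expR (w * t) *r U t x) ->
  (forall e : R, 0 < e -> exists2 d : R, 0 < d &
    forall h : R, 0 < h < d -> nrm (U h x - x - h *r y) <= e * h) ->
  (forall e : R, 0 < e -> exists2 d : R, 0 < d &
    forall h : R, 0 < h < d -> nrm (V h x - x - h *r (y + w *r x)) <= e * h).
Proof.
move=> HV H e e0; have e4 : 0 < e / 4 by rewrite divr_gt0.
have [d d0 Hd] := H _ e4; set N := 2 * nrm y * (`|w| + 1) + 2 * w ^+ 2 * nrm x + 1.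
have N0 : 0 < N.
  have : 0 <= nrm y * (`|w| + 1) by rewrite mulr_ge0 ?nrm_ge0 ?addr_ge0.
  have : 0 <= w ^+ 2 * nrm x by rewrite mulr_ge0 ?nrm_ge0 ?sqr_ge0.
  rewrite /N; lra.
pose m := 2 * (`|w| + 1); have m0 : 0 < m by rewrite mulr_gt0 // ltr_wpDl.
exists (Num.min d (Num.min m^-1 (e / 2 / N))).
  by rewrite !lt_min d0 invr_gt0 m0 divr_gt0 // divr_gt0.
move=> h /andP[h0]; rewrite !lt_min => /and3P[hd hm hN].
have wh : `|w * h| <= 2^-1.
  rewrite normrM (gtr0_norm h0).
  have : (`|w| + 1) * h <= 2^-1.
    rewrite -ler_pdivlMl ?ltr_wpDl // (le_trans (ltW hm)) // /m invfM mulrC //.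
  lra.
have [E2 E1 E3] := expR_near0 wh; set E := expR (w * h) in E1 E2 E3 *.
rewrite HV ?(ltW h0) // -/E.
have -> : E *r U h x - x - h *r (y + w *r x) =
  E *r (U h x - x - h *r y) + ((E - 1) * h) *r y + (E - 1 - w * h) *r x.
  by vec_eq [:: U h x; x; y]; ring.
have E0 : 0 <= E by exact: expR_ge0.
have H1 : nrm (E *r (U h x - x - h *r y)) <= 2 * (e / 4 * h).
  by rewrite nrmZ_ge0 // ler_pM ?nrm_ge0 // Hd // h0.
have H2 : nrm (((E - 1) * h) *r y) <= 2 * (`|w| * h) * h * nrm y.
  rewrite nrmZ normrM (gtr0_norm h0) ler_wpM2r ?nrm_ge0 // ler_wpM2r ?(ltW h0) //.
  by rewrite normrM (gtr0_norm h0) in E1.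
have H3 : nrm ((E - 1 - w * h) *r x) <= 2 * (w * h) ^+ 2 * nrm x.
  by rewrite nrmZ ler_wpM2r ?nrm_ge0.
have H4 : h * (h * N) <= h * (e / 2).
  by rewrite ler_pM2l // -ler_pdivlMr // ltW.
have H5 : 2 * (`|w| * h) * h * nrm y + 2 * (w * h) ^+ 2 * nrm x <= h * (h * N).
  rewrite -subr_ge0.
  have -> : h * (h * N) - (2 * (`|w| * h) * h * nrm y + 2 * (w * h) ^+ 2 * nrm x) =
    h ^+ 2 * (2 * nrm y + 1) by rewrite /N; ring.
  by have := nrm_ge0 y => y0; rewrite mulr_ge0 ?sqr_ge0 //; lra.
apply: le_trans (nrmD _ _) _; apply: le_trans (lerD (nrmD _ _) (lexx _)) _.
lra.
Qed.

(** That a limit of difference quotients of [V] places [x] in the domain comes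
    from the same computation for [U], which is [V] rescaled by [- w]. *)
Lemma generates_rescale (D : set X) (L L' : X -> X) (U : R -> {linear X -> X}) (w : R) :
  (forall x, D x -> L' x = L x + w *r x) ->
  generates D L U -> exists V : R -> {linear X -> X},
    generates D L' V /\ forall t x, V t x = expR (w * t) *r U t x.
Proof.
move=> LE [[Uc U0 UD Us] UL].
have /choice[V HV] : forall t, exists g : {linear X -> X},
    g =1 (fun x => expR (w * t) *r U t x).
  move=> t; apply: linear_pack => c x y.
  by rewrite linearP scalerDr !scalerA mulrC.
exists V; split=> //; split; first split.
- move=> t t0; have [C HC] := continuous_bounded (Uc t t0).
  apply: (@bounded_continuous _ _ _ _ _ (expR (w * t) * C)) => x.
  by rewrite HV nrmZ_ge0 ?expR_ge0 // -mulrA ler_wpM2l ?expR_ge0.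
- by move=> x; rewrite HV mulr0 expR0 of_real1 scale1r U0.
- by move=> t u x t0 u0; rewrite !HV UD // linR scalerA mulrDr expRD of_realM.
- move=> x; apply/cvg_at0rP => e e0; have e4 : 0 < e / 4 by rewrite divr_gt0.
  have /cvg_at0rP/(_ _ e4)[d d0 Hd] := Us x.
  have w1 : 0 < 2 * (`|w| + 1) by rewrite mulr_gt0 // ltr_wpDl.
  have x1 : 0 < 4 * (nrm x + 1) * (`|w| + 1).
    by rewrite !mulr_gt0 // ltr_wpDl ?nrm_ge0.
  exists (Num.min d (Num.min (2 * (`|w| + 1))^-1 (e / (4 * (nrm x + 1) * (`|w| + 1))))).
    by rewrite !lt_min d0 invr_gt0 w1 divr_gt0.
  move=> h /andP[h0]; rewrite !lt_min => /and3P[hd hw hx].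
  have wh : `|w * h| <= (`|w| + 1) * h.
    by rewrite normrM (gtr0_norm h0) ler_pM2r // lerDl.
  have w2 : (`|w| + 1) * h <= 2^-1.
    by rewrite -ler_pdivlMl ?ltr_wpDl // (le_trans (ltW hw)) // invfM mulrC.
  have w3 : 4 * (nrm x + 1) * ((`|w| + 1) * h) <= e.
    by rewrite mulrA -ler_pdivlMl // mulrC ltW.
  have [E2 E1 _] := expR_near0 (le_trans wh w2).
  have -> : V h x - x = expR (w * h) *r (U h x - x) + (expR (w * h) - 1) *r x.
    by rewrite HV; vec_eq [:: U h x; x]; ring.
  apply: le_trans (nrmD _ _) _; rewrite (nrmZ_ge0 _ (expR_ge0 _)) nrmZ.
  have H1 : expR (w * h) * nrm (U h x - x) <= 2 * (e / 4).
    by rewrite ler_pM ?expR_ge0 ?nrm_ge0 // Hd // h0.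
  have H2 : `|expR (w * h) - 1| * nrm x <= 2 * ((`|w| + 1) * h) * nrm x.
    by rewrite ler_wpM2r ?nrm_ge0 // (le_trans E1) // ler_pM2l.
  have : 0 <= (`|w| + 1) * h by rewrite mulr_ge0 ?addr_ge0 // ltW.
  by set a := (_ + 1) * h in w3 H2 *; nra.
move=> x y; split=> [[Dx <-]|/right_derivativeP H].
  apply/right_derivativeP; rewrite LE //.
  apply: (rescale_derivative (U := U)) => [t t0|]; first exact: HV.
  by apply/right_derivativeP/UL.
have HU t : 0 <= t -> U t x = expR (- w * t) *r V t x.
  by move=> _; rewrite HV scalerA -of_realM -expRD mulNr addNr expR0 of_real1 scale1r.
have /UL[Dx Lx] : of_real s h^-1 *: (U h x - x) @[h --> 0^'+] --> y + (- w) *r x.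
  by apply/right_derivativeP; exact: rescale_derivative HU H.
by split=> //; rewrite LE // Lx; vec_eq [:: y; x]; ring.
Qed.
End Rescale.

(** * Integrable majorants of derivatives *)
Section Majorant.
Variable R : realType.
Implicit Types (f g F G : R -> R) (t a b e : R).
Local Notation mu := (@lebesgue_measure R).

Lemma limn_einfE (u : nat -> \bar R) : limn_einf u = ereal_sup (range (einfs u)).
Proof. by rewrite limn_einf_lim; apply/cvg_lim => //; exact: cvg_einfs_sup. Qed.

Lemma limn_einf_ge (u : nat -> \bar R) (c : \bar R) (N : nat) :
  (forall n, (N <= n)%N -> (c <= u n)%E) -> (c <= limn_einf u)%E.
Proof.
move=> H; rewrite limn_einfE; apply: (@le_trans _ _ (einfs u N)).
  by apply: le_ereal_inf_tmp => _ [n /= Nn <-]; exact: H.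
by apply: ereal_sup_ubound; exists N.
Qed.

Lemma limn_einf_le (u : nat -> \bar R) (c : \bar R) :
  (forall N, exists2 n, (N <= n)%N & (u n <= c)%E) -> (limn_einf u <= c)%E.
Proof.
move=> H; rewrite limn_einfE; apply: ge_ereal_sup => _ [N _ <-].
have [n Nn] := H N; apply: le_trans; apply: ereal_inf_lbound.
by exists n.
Qed.

Lemma prim_cst (c t : R) : 0 <= t -> prim (fun=> c) t = c * t.
Proof.
move=> t0; rewrite (prim_unique (F := fun u => c * u) t0) ?mulr0 ?subr0 // => [u|u _|u _ e e0].
- exact: cvg_cst.
- by apply: cvgMr; exact: cvg_id.
exists 1 => // r _; rewrite (_ : c * (u + r) - c * u - r * c = 0); last by ring.
by rewrite normr0 mulr_ge0 // ltW.
Qed.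

Section Rate.
Variables (f E g : R -> R) (T C : R).
Hypotheses (T_gt0 : 0 < T) (cf : continuous f) (cE : continuous E).
(* The Lipschitz bound reaches to the left of 0, where [f] is constant, so that the
   difference quotients are defined and bounded on all of [0, T]. *)
Hypothesis f_lip : forall t r : R, t <= T -> 0 <= r -> `|f t - f (t - r)| <= C * r.
Hypothesis f_neg : forall t, t <= 0 -> f t = f 0.
Hypothesis f_rate : forall t, 0 < t <= T -> left_rate_le f (E t - g t) t.

Let C_ge0 : 0 <= C.
Proof.
by have := le_trans (normr_ge0 _) (f_lip (lexx T) (@ler01 R)); rewrite mulr1.
Qed.

Let tau n : R := n.+1%:R^-1.
Let tau_gt0 n : 0 < tau n. Proof. by rewrite invr_gt0 ltr0n. Qed.

Let shift_cont (h : R) : continuous (fun u : R => f (u + h)).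
Proof.
move=> u; apply: (@continuous_comp _ _ _ (fun v => v + h) f); last exact: cf.
by apply: cvgD => //; exact: cvg_cst.
Qed.

Let quotient n t := (tau n)^-1 * f (t + - tau n) + - (tau n)^-1 * f t.

Let quotient_cont n : continuous (quotient n).
Proof.
by move=> u; apply: cvgD; apply: cvgMr; [exact: shift_cont|exact: cf].
Qed.

Let quotientE n t : quotient n t = (tau n)^-1 * (f (t - tau n) - f t).
Proof. by rewrite /quotient mulrBr mulNr. Qed.

Let quotient_bound n t : t <= T -> `|quotient n t| <= C.
Proof.
move=> tT; rewrite quotientE normrM gtr0_norm ?invr_gt0 // distrC.
by rewrite ler_pdivrMl // mulrC; exact: f_lip tT (ltW (tau_gt0 n)).
Qed.

(** The integral of a difference quotient telescopes to the mean of [f] over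
    [- tau, 0], which is [f 0], minus its mean over [T - tau, T], which is at least
    [f T - C tau]. *)
Let prim_quotient n : tau n <= T -> prim (quotient n) T <= f 0 - f T + C * tau n.
Proof.
move=> tT; have T0 := ltW T_gt0; have t0 := tau_gt0 n; have t0' := ltW t0.
rewrite (prim_linear _ _ T0 (@shift_cont _) cf).
set h := tau n in t0 t0' tT *; pose q (u : R) := f (u + - h).
have cq : continuous q by exact: shift_cont.
have E1 : prim f T = prim q (T + h) - prim q h.
  rewrite -prim_shift //; congr prim; apply/funext => u.
  by rewrite /q addrK.
have E2 : prim q h = f 0 * h.
  rewrite -prim_cst //; apply/eqP; rewrite eq_le; apply/andP.
  split; apply: prim_le => //; first [by move=> u; exact: cvg_cst|
    by move=> u /andP[u0 uh]; rewrite /q f_neg //; lra].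
have E3 : prim q (T + h) - prim q T = prim (fun u => q (u + T)) h.
  by rewrite prim_shift // [h + T]addrC.
have E4 : (f T - C * h) * h <= prim (fun u => q (u + T)) h.
  rewrite -prim_cst //; apply: prim_le => //.
  - by move=> u; exact: cvg_cst.
  - move=> u; apply: (@continuous_comp _ _ _ (fun v => v + T) q); last exact: cq.
    by apply: cvgD => //; exact: cvg_cst.
  move=> u /andP[u0 uh]; rewrite /q.
  have -> : u + T + - h = T - (h - u) by ring.
  have hu : 0 <= h - u by rewrite subr_ge0.
  have := f_lip (lexx T) hu; rewrite ler_norml => /andP[_ g1].
  have g2 : C * (h - u) <= C * h by rewrite ler_wpM2l // gerBl.
  lra.
have -> : h^-1 * prim (fun u => f (u + - h)) T + - h^-1 * prim f T =
  h^-1 * (prim q T - prim f T) by rewrite /q; ring.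
rewrite ler_pdivrMl //.
have := E1; have := E2; have := E3; lra.
Qed.

(** The backward difference quotients [(f (t - tau) - f t) / tau] have a lower limit
    which is measurable and, by the hypothesis on the rate of [f], at least
    [g - E].  Fatou's lemma, applied after adding the Lipschitz constant [C] to make
    the quotients nonnegative, bounds its integral by [f 0 - f T]; the majorant is
    that lower limit plus [E]. *)
Lemma rate_majorant : exists G, [/\ mu.-integrable `[0, T] (EFin \o G),
  forall t, 0 < t <= T -> g t <= G t &
  (\int[mu]_(t in `[0%R, T]) (G t)%:E <= (f 0 - f T + prim E T)%:E)%E].
Proof.
have T0 := ltW T_gt0.
pose q n t : \bar R := (quotient n t + C)%:E.
have q_ge0 n t : t <= T -> (0 <= q n t)%E.
  by move=> /(quotient_bound n); rewrite lee_fin ler_norml => /andP[? _]; lra.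
have q_le n t : t <= T -> (q n t <= (2 * C)%:E)%E.
  by move=> /(quotient_bound n); rewrite lee_fin ler_norml => /andP[_ ?]; lra.
pose H t := limn_einf (q ^~ t).
have H_ge0 t : t <= T -> (0 <= H t)%E.
  by move=> tT; apply: (@limn_einf_ge _ _ 0) => n _; exact: q_ge0.
have H_le t : t <= T -> (H t <= (2 * C)%:E)%E.
  by move=> tT; apply: limn_einf_le => N; exists N => //; exact: q_le.
have H_fin t : t <= T -> H t = (fine (H t))%:E.
  move=> tT; rewrite fineK // ge0_fin_numE ?H_ge0 //.
  by apply: le_lt_trans (H_le t tT) _; rewrite ltry.
have mq n : measurable_fun `[0, T] (q n).
  apply/measurable_EFinP; apply: measurable_funTS; apply: continuous_measurable_fun.
  by move=> u; apply: cvgD; [exact: quotient_cont|exact: cvg_cst].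
have mH : measurable_fun `[0, T] H.
  apply: measurableT_comp => //; apply: (@measurable_fun_limn_esup _ _ _ _
    (fun n t => - q n t)%E) => n.
  exact: measurableT_comp.
have tau_small (x : R) : 0 < x -> exists N, forall n, (N <= n)%N -> tau n <= x.
  move=> x0; exists (Num.truncn x^-1) => n Nn.
  rewrite /tau invf_ple ?posrE ?ltr0n //.
  apply: (le_trans (ltW (truncnS_gt x^-1))).
  by rewrite ler_nat.
have iHT : (\int[mu]_(t in `[0%R, T]) H t <= (C * T + (f 0 - f T))%:E)%E.
  apply: le_trans (fatou _ _ _ _) _ => //.
    by move=> n t /=; rewrite in_itv /= => /andP[_ ?]; exact: q_ge0.
  apply/lee_addgt0Pr => e e0; apply: limn_einf_le => N.
  have C1 : 0 < C + 1 by rewrite ltr_wpDl.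
  have [N1 H1] := tau_small _ T_gt0; have [N2 H2] := tau_small _ (divr_gt0 e0 C1).
  pose n := maxn N (maxn N1 N2); exists n; first exact: leq_maxl.
  have tT : tau n <= T by rewrite H1 // leq_max leq_maxl orbT.
  have te : C * tau n <= e.
    have : (C + 1) * tau n <= e.
      by rewrite mulrC -ler_pdivlMr // H2 // !leq_max leqnn !orbT.
    by have := tau_gt0 n; lra.
  have cc : continuous (fun _ : R => C : R) by move=> u; exact: cvg_cst.
  have cqn := @quotient_cont n.
  have -> : (\int[mu]_(t in `[0%R, T]) q n t = (prim (quotient n) T + C * T)%:E)%E.
    have E1 : prim (fun u => 1 * quotient n u + 1 * C) T = prim (quotient n) T + C * T.
      by rewrite (prim_linear _ _ T0 cqn cc) !mul1r prim_cst.
    rewrite -E1 -integral_prim //; last first.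
      by move=> u; apply: cvgD; apply: cvgMr; [exact: cqn|exact: cc].
    by apply: eq_integral => t _; rewrite !mul1r.
  by rewrite -EFinD lee_fin; have := prim_quotient tT; lra.
have iH : mu.-integrable `[0, T] H.
  apply/integrableP; split=> //; apply: (@le_lt_trans _ _ (C * T + (f 0 - f T))%:E).
    apply: le_trans iHT; rewrite le_eqVlt; apply/orP; left; apply/eqP.
    apply: eq_integral => t; rewrite inE /= in_itv /= => /andP[_ tT].
    by rewrite gee0_abs ?H_ge0.
  by rewrite ltry.
pose EC (t : R) := 1 * E t + 1 * (- C).
have cnC : continuous (fun _ : R => - C : R) by move=> u; exact: cvg_cst.
have cEC : continuous EC.
  by move=> u; apply: cvgD; apply: cvgMr; [exact: cE|exact: cnC].
have iEC : mu.-integrable `[0, T] (EFin \o EC).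
  apply: continuous_compact_integrable; first exact: segment_compact.
  exact: continuous_subspaceT.
pose G t := fine (H t) + EC t; exists G.
have GE t : t <= T -> (G t)%:E = (H t + (EC t)%:E)%E by move=> tT; rewrite EFinD -H_fin.
split.
- have iHE : mu.-integrable `[0, T] (H \+ (EFin \o EC))%E by exact: integrableD.
  apply: eq_integrable iHE => //.
  by move=> t; rewrite inE /= in_itv /= => /andP[_ tT]; rewrite GE.
- move=> t /andP[t0 tT]; apply: (@le_addM_eps _ _ _ 1) => e e0.
  have [|d d0 Hd] := f_rate _ e0 (t := t); first by rewrite t0.
  have [N HN] := tau_small _ (divr_gt0 d0 (ltr0n R 2)).
  suff : g t - E t - e + C <= fine (H t) by rewrite /G /EC; lra.
  rewrite -lee_fin -H_fin //; apply: (@limn_einf_ge _ _ N) => n Nn.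
  rewrite lee_fin quotientE lerD2r.
  have t1 := tau_gt0 n; have t2 := HN n Nn.
  rewrite ler_pdivlMl //.
  have : f t - f (t - tau n) <= tau n * (E t - g t + e) by apply: Hd; rewrite t1 /=; lra.
  lra.
have -> : (\int[mu]_(t in `[0%R, T]) (G t)%:E =
    \int[mu]_(t in `[0%R, T]) (H t + (EFin \o EC) t))%E.
  by apply: eq_integral => t; rewrite inE /= in_itv /= => /andP[_ tT]; rewrite GE.
rewrite integralD //.
have -> : (\int[mu]_(t in `[0%R, T]) (EFin \o EC) t = (prim E T - C * T)%:E)%E.
  rewrite (integral_prim cEC T0) (prim_linear _ _ T0 cE cnC) prim_cst //.
  by congr (_%:E); ring.
apply: le_trans (leeD iHT (lexx _)) _.
by rewrite -EFinD lee_fin; lra.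
Qed.

(** The majorant serves both readings of the integral: a measurable [g] is bounded,
    hence integrable, and is compared with it; otherwise it competes in the
    infimum that defines the upper integral.  The majorant is controlled on ]0, T]
    only, which suffices since a point is negligible. *)
Lemma selection_integral_rate (C' : R) : (forall t, 0 <= t <= T -> `|g t| <= C') ->
  (selection_integral `[0%R, T] g <= (f 0 - f T + prim E T)%:E)%E.
Proof.
move=> g_bound; have [G [iG gG IG]] := rate_majorant.
apply: le_trans IG; rewrite /selection_integral; case: asboolP => mg.
  have mg' : measurable_fun `]0, T] g.
    apply: measurable_funS mg => //.
    by move=> t /=; rewrite !in_itv /= => /andP[/ltW -> ->].
  have mG : measurable_fun `[0, T] (EFin \o G) by exact: measurable_int iG.
  have iG' : mu.-integrable `]0, T] (EFin \o G).
    apply: integrableS iG => //.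
    by move=> t /=; rewrite !in_itv /= => /andP[/ltW -> ->].
  rewrite -integral_itv_obnd_cbnd; last exact/measurable_EFinP.
  rewrite -integral_itv_obnd_cbnd; last exact: measurable_int iG'.
  apply: le_integral => //.
    apply: measurable_bounded_integrable => //=.
      by rewrite lebesgue_measure_itv /= lte_fin T_gt0 -EFinB ltry.
    exists C'; split; first exact: num_real.
    move=> x Cx t /=; rewrite in_itv /= => /andP[t0 tT].
    by apply: le_trans (ltW Cx); rewrite g_bound // (ltW t0).
  by move=> t; rewrite inE /= in_itv /= => tT; rewrite lee_fin gG.
apply: ereal_inf_lbound; exists G => //; split=> //.
exists [set 0]; split; [exact: measurable_set1|exact: lebesgue_measure_set1|].
move=> t /= /not_implyP[]; rewrite in_itv /= => /andP[t0 tT] gGt.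
apply: contrapT => tn0; apply: gGt; apply: gG; rewrite tT andbT lt_def t0 andbT.
by apply/eqP.
Qed.

End Rate.
End Majorant.

(** * Continuity of orbits *)
Section NormContinuous.
Variables (R : realType) (s : scalars) (X : completeNormedModType (Scal R s)).

(** Norm continuity on the whole line, in terms of the real-valued norm.  Orbits
    are extended to negative times by their value at 0, which makes continuity
    global and avoids one-sided statements at 0. *)
Definition ncont (v : R -> X) := forall (t e : R), 0 < e ->
  exists2 d : R, 0 < d & forall u : R, `|u - t| < d -> nrm (v u - v t) <= e.

Lemma ncont_nrm (v : R -> X) : ncont v -> continuous (fun t => nrm (v t)).
Proof.
move=> cv t; apply/cvgrPdist_le => e e0; have [d d0 Hd] := cv t e e0.
apply/nbhs_ballP; exists d => //= u; rewrite /ball /= distrC => ud.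
by rewrite distrC (le_trans (nrm_dist _ _)) // Hd.
Qed.

Lemma ncontB (v w : R -> X) : ncont v -> ncont w -> ncont (fun t => v t - w t).
Proof.
move=> cv cw t e e0; have e2 : 0 < e / 2 by rewrite divr_gt0.
have [d1 d10 H1] := cv t _ e2; have [d2 d20 H2] := cw t _ e2.
exists (Num.min d1 d2) => [|u]; first by rewrite lt_min d10.
rewrite lt_min => /andP[u1 u2].
have -> : v u - w u - (v t - w t) = (v u - v t) - (w u - w t).
  by vec_eq [:: v u; w u; v t; w t]; ring.
by apply: le_trans (nrmB _ _) _; have := H1 u u1; have := H2 u u2; lra.
Qed.

Lemma max0_dist (t u : R) : `|Num.max 0 u - Num.max 0 t| <= `|u - t|.
Proof.
rewrite !maxEle; case: (leP 0 u) => u0; case: (leP 0 t) => t0 //.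
- by rewrite subr0 ger0_norm // ger0_norm; lra.
- by rewrite sub0r normrN ger0_norm // ler0_norm; lra.
- by rewrite subrr normr0.
Qed.

Variables (D : set X) (L : X -> X) (U : R -> {linear X -> X}).
Hypothesis gen : generates D L U.
Hypothesis Ub : forall b : R, exists2 K : R, 0 < K &
  forall (t : R) x, 0 <= t <= b -> nrm (U t x) <= K * nrm x.

Lemma orbit_ncont x : ncont (fun t => U (Num.max 0 t) x).
Proof.
move=> t e e0; have [d d0 Hd] := orbit_uniform gen Ub (Num.max 0 t + 1) x e0.
exists (Num.min d 1) => [|u]; first by rewrite lt_min d0 ltr01.
rewrite lt_min => /andP[ud u1]; have h := max0_dist t u.
have := ler_norm (Num.max 0 u - Num.max 0 t) => h'.
by apply: Hd; rewrite ?le_max ?lexx //=; lra.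
Qed.

Variables (B : X -> X) (C : R).
Hypothesis B_sub : forall x y, D x -> D y -> B (x - y) = B x - B y.
Hypothesis B_graph : forall y, D y -> nrm (B y) <= C * (nrm y + nrm (L y)).

(** [B] is bounded for the graph norm, and both [U t x] and [L (U t x) = U t (L x)]
    are continuous in [t]. *)
Lemma graph_orbit_ncont x : D x -> ncont (fun t => B (U (Num.max 0 t) x)).
Proof.
move=> Dx t e e0; have C1 : 0 < 2 * (`|C| + 1) by rewrite mulr_gt0 // ltr_wpDl.
have e1 := divr_gt0 e0 C1.
have [d1 d10 H1] := orbit_ncont x t e1; have [d2 d20 H2] := orbit_ncont (L x) t e1.
exists (Num.min d1 d2) => [|u]; first by rewrite lt_min d10.
rewrite lt_min => /andP[/H1 {}H1 /H2 {}H2].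
have m0 v : 0 <= Num.max 0 v :> R by rewrite le_max lexx.
have [Du Lu] := generator_orbit gen Ub (m0 u) Dx.
have [Dt Lt] := generator_orbit gen Ub (m0 t) Dx.
have [Dut Lut] := generator_B gen Du Dt.
rewrite -B_sub //; apply: le_trans (B_graph Dut) _; rewrite Lut Lu Lt.
have -> : e = (`|C| + 1) * (e / (2 * (`|C| + 1)) + e / (2 * (`|C| + 1))).
  by field; rewrite gt_eqF // ltr_wpDl.
apply: (@le_trans _ _ ((`|C| + 1) *
  (nrm (U (Num.max 0 u) x - U (Num.max 0 t) x) +
   nrm (U (Num.max 0 u) (L x) - U (Num.max 0 t) (L x))))).
  by rewrite ler_wpM2r ?addr_ge0 ?nrm_ge0 // (le_trans (ler_norm _)) // lerDl.
by rewrite ler_pM2l ?ltr_wpDl //; exact: lerD.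
Qed.

End NormContinuous.

(** * A norm that absorbs the perturbation *)
Section Perturbation.
Variables (R : realType) (s : scalars) (X : completeNormedModType (Scal R s)).
Variables (D : set X) (A : X -> X) (S : R -> {linear X -> X}).
Hypotheses (gen : generates D A S) (contr : contraction_semigroup S).
Variables (B : X -> X) (C : R).
Hypothesis B_linear : forall (a : Scal R s) x y, D x -> D y ->
  B (a *: x + y) = a *: B x + B y.
Hypothesis B_graph : forall y, D y -> nrm (B y) <= C * (nrm y + nrm (A y)).
Variables (T M : R).
Hypotheses (T_gt0 : 0 < T) (M_gt0 : 0 < M).
Hypothesis m1 : forall y, D y ->
  (\int[lebesgue_measure]_(t in `[0%R, T]) (nrm (B (S t y)))%:E <= (M * nrm y)%:E)%E.

Lemma contraction_bounded (b : R) : exists2 K : R, 0 < K &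
  forall (t : R) x, 0 <= t <= b -> nrm (S t x) <= K * nrm x.
Proof. by exists 1 => // t x /andP[t0 _]; rewrite mul1r contr. Qed.

Let D0 : D 0. Proof. by have [] := generator_0 gen. Qed.
Let DZ (a : Scal R s) x : D x -> D (a *: x).
Proof. by move=> /(generator_Z gen a)[]. Qed.
Let DD x y : D x -> D y -> D (x + y).
Proof. by move=> Dx /(generator_D gen Dx)[]. Qed.
Let DB x y : D x -> D y -> D (x - y).
Proof. by move=> Dx /(generator_B gen Dx)[]. Qed.
Let DS t x : 0 <= t -> D x -> D (S t x).
Proof. by move=> t0 /(generator_orbit gen contraction_bounded t0)[]. Qed.

Let BD x y : D x -> D y -> B (x + y) = B x + B y.
Proof. by move=> Dx /(B_linear 1 Dx); rewrite !scale1r. Qed.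
Let B0 : B 0 = 0.
Proof. by apply: (addrI (B 0)); rewrite -BD // !addr0. Qed.
Let BZ (a : Scal R s) x : D x -> B (a *: x) = a *: B x.
Proof. by move=> Dx; have := B_linear a Dx D0; rewrite B0 !addr0. Qed.
Let BB x y : D x -> D y -> B (x - y) = B x - B y.
Proof.
by move=> Dx Dy; have := B_linear (-1) Dy Dx; rewrite !scaleN1r ![- _ + _]addrC.
Qed.

Definition observation y (t : R) := nrm (B (S (Num.max 0 t) y)).

Lemma observation_continuous y : D y -> continuous (observation y).
Proof.
move=> Dy; apply: ncont_nrm; exact: (graph_orbit_ncont gen contraction_bounded BB B_graph Dy).
Qed.

Definition weight (t : R) := 1 - t / T.

Let weight_itv t : 0 <= t <= T -> 0 <= weight t <= 1.
Proof.
move=> /andP[t0 tT]; rewrite /weight subr_ge0 ler_pdivrMr // mul1r tT /=.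
by rewrite gerBl divr_ge0 // ltW.
Qed.

Let weighted_continuous y : D y -> continuous (fun t => weight t * observation y t).
Proof.
move=> Dy t; apply: cvgM; last exact: observation_continuous.
by apply: cvgB; [exact: cvg_cst|apply: cvgMl; exact: cvg_id].
Qed.

(** The weight falls from 1 to 0 over the period, so that advancing along the orbit
    releases the current output [|B y|] and takes in nothing at the far end. *)
Definition memory y := prim (fun t => weight t * observation y t) T.

Lemma observation_prim_le y : D y -> prim (observation y) T <= M * nrm y.
Proof.
move=> Dy; rewrite -lee_fin -(integral_prim (observation_continuous Dy) (ltW T_gt0)).
apply: le_trans (m1 Dy); rewrite le_eqVlt; apply/orP; left; apply/eqP.
apply: eq_integral => t; rewrite inE /= in_itv /= => /andP[t0 _].
by rewrite /observation max_r.
Qed.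

Lemma memory_le y : D y -> memory y <= M * nrm y.
Proof.
move=> Dy; apply: le_trans (observation_prim_le Dy).
apply: prim_le => //; [exact: ltW|exact: weighted_continuous|exact: observation_continuous|].
move=> t /weight_itv/andP[w0 w1]; rewrite -[leRHS]mul1r ler_wpM2r //; exact: nrm_ge0.
Qed.

Lemma memory_ge0 y : D y -> 0 <= memory y.
Proof.
move=> Dy; have c0 : continuous (fun _ : R => 0 : R) by move=> t; exact: cvg_cst.
have <- : prim (fun=> 0 : R) T = 0.
  by have := prim_linear 0 0 (ltW T_gt0) c0 c0; rewrite !mul0r addr0.
apply: prim_le => //; [exact: ltW|exact: weighted_continuous|].
by move=> t /weight_itv/andP[w0 _]; rewrite mulr_ge0 //; exact: nrm_ge0.
Qed.

Lemma memory_add x y : D x -> D y -> memory (x + y) <= memory x + memory y.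
Proof.
move=> Dx Dy; rewrite -[memory x]mul1r -[memory y]mul1r.
rewrite -(prim_linear 1 1 (ltW T_gt0) (weighted_continuous Dx) (weighted_continuous Dy)).
apply: prim_le; [exact: ltW|exact: weighted_continuous (DD Dx Dy)| |].
  move=> t; apply: cvgD; apply: cvgMr; exact: weighted_continuous.
move=> t /weight_itv/andP[w0 _]; rewrite !mul1r -mulrDr ler_wpM2l //.
have m0 : 0 <= Num.max 0 t by rewrite le_max lexx.
by rewrite /observation linearD BD ?nrmD //; exact: DS.
Qed.

Lemma memory_scale (a : R) x : 0 <= a -> D x -> memory (a *r x) = a * memory x.
Proof.
move=> a0 Dx; rewrite -[RHS]addr0 -(mul0r (memory x)).
rewrite -(prim_linear a 0 (ltW T_gt0) (weighted_continuous Dx) (weighted_continuous Dx)).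
congr prim; apply/funext => t; rewrite mul0r addr0 mulrCA; congr (_ * _).
have m0 : 0 <= Num.max 0 t by rewrite le_max lexx.
by rewrite /observation linR BZ ?nrmZ_ge0 //; exact: DS.
Qed.

(** A norm on [D], equivalent to the original one by [lyap_ge] and [lyap_le]. *)
Definition lyap y := nrm y + memory y.

Lemma lyap_le y : D y -> lyap y <= (1 + M) * nrm y.
Proof. by move=> /memory_le; rewrite /lyap; lra. Qed.

Lemma lyap_ge y : D y -> nrm y <= lyap y.
Proof. by move=> /memory_ge0; rewrite /lyap; lra. Qed.

Lemma lyap_add x y : D x -> D y -> lyap (x + y) <= lyap x + lyap y.
Proof. by move=> Dx /(memory_add Dx); have := nrmD x y; rewrite /lyap; lra. Qed.

Lemma lyap_scale (a : R) x : 0 <= a -> D x -> lyap (a *r x) = a * lyap x.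
Proof. by move=> a0 Dx; rewrite /lyap memory_scale // (nrmZ_ge0 _ a0) -mulrDr. Qed.

(** After a time [h] the weighted integral is taken over [h, T + h] with the weight
    increased by [h / T].  To first order it loses [h |B y|] at the lower end, where
    the weight is 1, gains nothing at the upper end, where it is 0, and gains
    [h / T] times the integral of the output, at most [M |y|]. *)
Lemma lyap_orbit y (e : R) : D y -> 0 < e -> exists2 d : R, 0 < d &
  forall h : R, 0 < h < d ->
    lyap (S h y) <= lyap y + h * (- nrm (B y) + M / T * nrm y + e).
Proof.
move=> Dy e0; have e4 : 0 < e / 4 by rewrite divr_gt0.
have T0 := ltW T_gt0.
have cw := weighted_continuous Dy; have co := observation_continuous Dy.
have [d1 d10 H1] := prim_rate cw T0 e4.
have [d2 d20 H2] := prim_rate cw (lexx 0) e4.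
have cP : {for T, continuous (prim (observation y))} by apply: prim_continuous.
have cP0 : {for 0, continuous (prim (observation y))} by apply: prim_continuous.
have eT : 0 < e * T / 4 by rewrite divr_gt0 ?mulr_gt0.
have [d3 d30 H3] : exists2 d : R, 0 < d & forall h : R, 0 < h < d ->
    prim (observation y) (T + h) - prim (observation y) h <= M * nrm y + e * T / 2.
  move/cvgrPdist_le: cP => /(_ _ eT)/nbhs_ballP[a /= a0 Ha].
  move/cvgrPdist_le: cP0 => /(_ _ eT)/nbhs_ballP[b /= b0 Hb].
  exists (Num.min a b) => [|h]; first by rewrite lt_min a0.
  rewrite lt_min => /and3P[h0 ha hb].
  have := Ha (T + h); rewrite /ball /= opprD addrA subrr sub0r normrN gtr0_norm // => /(_ ha).
  have := Hb h; rewrite /ball /= sub0r normrN gtr0_norm // => /(_ hb).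
  rewrite prim0 !ler_norml => /andP[g1 g2] /andP[g3 g4].
  have := observation_prim_le Dy; lra.
exists (Num.min d1 (Num.min d2 d3)) => [|h]; first by rewrite !lt_min d10 d20.
rewrite !lt_min => /and4P[h0 h1 h2 h3]; have h0' := ltW h0.
have E : memory (S h y) = prim (fun t => weight t * observation y t) (T + h) -
  prim (fun t => weight t * observation y t) h +
  h / T * (prim (observation y) (T + h) - prim (observation y) h).
  have coh : continuous (fun u : R => observation y (u + h)).
    move=> u; apply: (@continuous_comp _ _ _ (fun v => v + h) (observation y)).
      by apply: cvgD => //; exact: cvg_cst.
    exact: co.
  have cwh : continuous (fun u : R => weight (u + h) * observation y (u + h)).
    move=> u; apply: (@continuous_comp _ _ _ (fun v => v + h)
      (fun t => weight t * observation y t)).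
      by apply: cvgD => //; exact: cvg_cst.
    exact: cw.
  rewrite -(prim_shift h0' T0 cw) -(prim_shift h0' T0 co).
  have /esym := prim_linear 1 (h / T) T0 cwh coh; rewrite mul1r => ->.
  apply/eqP; rewrite eq_le; apply/andP.
  have cr : continuous (fun u : R => 1 * (weight (u + h) * observation y (u + h)) +
      h / T * observation y (u + h)).
    by move=> u; apply: cvgD; apply: cvgMr; [exact: cwh|exact: coh].
  have EE t : 0 <= t -> weight t * observation (S h y) t =
    1 * (weight (t + h) * observation y (t + h)) + h / T * observation y (t + h).
    move=> t0; have [[_ _ SD _] _] := gen.
    rewrite /observation !max_r ?addr_ge0 // -SD // /weight; field.
    by rewrite gt_eqF.
  by split; apply: prim_le => //; first [exact: weighted_continuous (DS h0' Dy)|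
    by move=> t /andP[t0 _]; rewrite EE].
have := H1 h; have := H2 h; rewrite gtr0_norm // add0r prim0 subr0 => /(_ h2) g2 /(_ h1) g1.
have g3 := H3 h; rewrite h0 h3 in g3; have {}g3 := g3 isT.
have S0 : S 0 y = y by have [[]] := gen.
have o0 : observation y 0 = nrm (B y) by rewrite /observation max_l // S0.
rewrite /weight mul0r subr0 mul1r o0 divff ?gt_eqF // subrr mul0r mulr0 subr0 in g1 g2.
move: g1 g2; rewrite !ler_norml => /andP[g11 g12] /andP[g21 g22].
have g4 : h / T * (prim (observation y) (T + h) - prim (observation y) h) <=
  h / T * (M * nrm y + e * T / 2) by rewrite ler_pM2l // divr_gt0.
have g5 : h / T * (M * nrm y + e * T / 2) = h * (M / T * nrm y) + h * e / 2.
  by field; rewrite gt_eqF.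
rewrite /lyap E /memory /weight.
have := contr y h0'; lra.
Qed.

(** Triangle inequality for a vector [q] close to [c y - l S(t) y].  A point that
    precedes [y], such as [2 y - S(t) y] or the solution of a resolvent equation, has
    this form, and the known decrease from [y] to [S(t) y] turns into a lower
    bound for it. *)
Lemma lyap_backward (c l t : R) y q : 0 <= c -> 0 <= l -> 0 <= t -> D y -> D q ->
  c * lyap y - l * lyap (S t y) - (1 + M) * nrm (c *r y - l *r S t y - q) <= lyap q.
Proof.
move=> c0 l0 t0 Dy Dq; set p := c *r y - l *r S t y.
have DSt := DS t0 Dy; have Dc := DZ (of_real s c) Dy; have Dl := DZ (of_real s l) DSt.
have Dp : D p by exact: DB.
have Dpq : D (p - q) by exact: DB.
have := lyap_add Dp Dl; rewrite subrK !lyap_scale //.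
have := lyap_add Dpq Dq; rewrite subrK; have := lyap_le Dpq; lra.
Qed.

(** Along a solution of [z' = A z + f] the state at [t - r] is, to first order,
    [2 z(t) - S(r) z(t) - r f]; [lyap_backward] and [lyap_orbit] bound it from
    below. *)
Lemma lyap_left_rate (z : R -> X) (f : X) (t : R) : 0 < t ->
  (forall u, 0 <= u -> D (z u)) ->
  (forall e : R, 0 < e -> exists2 d : R, 0 < d & forall r : R, 0 < r < d ->
    r < t /\ nrm (z t - z (t - r) - r *r (A (z t) + f)) <= e * r) ->
  left_rate_le (fun u => lyap (z (Num.max 0 u)))
    (- nrm (B (z t)) + M / T * nrm (z t) + (1 + M) * nrm f) t.
Proof.
move=> t0 Dz Hz e e0; have M1 : 0 < 4 * (1 + M) by rewrite mulr_gt0 // ltr_wpDl.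
have e2 : 0 < e / 2 by rewrite divr_gt0.
have e3 := divr_gt0 e0 M1; have Dzt := Dz t (ltW t0).
have [d1 d10 H1] := Hz _ e3; have [d2 d20 H2] := lyap_orbit Dzt e2.
have /(generatorP gen)/(_ _ e3)[d3 d30 H3] := conj Dzt (erefl (A (z t))).
exists (Num.min d1 (Num.min d2 d3)); first by rewrite !lt_min d10 d20.
move=> r /andP[r0]; rewrite !lt_min => /and3P[r1 r2 r3].
have [rt {}H1] : r < t /\ _ := H1 r (introT andP (conj r0 r1)).
have {}H2 := H2 r (introT andP (conj r0 r2)).
have {}H3 := H3 r (introT andP (conj r0 r3)).
rewrite max_r ?(ltW t0) // max_r ?subr_ge0 ?(ltW rt) //.
have tr : 0 <= t - r by rewrite subr_ge0 ltW.
have := lyap_backward (ler0n R 2) (@ler01 R) (ltW r0) Dzt (Dz _ tr).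
have -> : 2 *r z t - 1 *r S r (z t) - z (t - r) =
  (z t - z (t - r) - r *r (A (z t) + f)) - (S r (z t) - z t - r *r A (z t)) + r *r f.
  by vec_eq [:: z t; z (t - r); S r (z t); A (z t); f]; ring.
set u1 := z t - _ - _ in H1 *; set u2 := S r _ - _ - _ in H3 *.
have := nrmD (u1 - u2) (r *r f); have := nrmB u1 u2; rewrite nrmZ_ge0 ?(ltW r0) //.
set n := nrm (u1 - u2 + r *r f) => g1 g2 g3.
have g4 : (1 + M) * n <= (1 + M) * (2 * (e / (4 * (1 + M)) * r) + r * nrm f).
  by rewrite ler_wpM2l ?addr_ge0 ?(ltW M_gt0) //; lra.
have g5 : (1 + M) * (2 * (e / (4 * (1 + M)) * r) + r * nrm f) =
  e / 2 * r + r * ((1 + M) * nrm f) by field; rewrite gt_eqF // ltr_wpDl.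
lra.
Qed.

(** The same argument for the original norm, in which [S] is a contraction. *)
Lemma nrm_left_rate (z : R -> X) (f : X) (t : R) : 0 < t -> D (z t) ->
  (forall e : R, 0 < e -> exists2 d : R, 0 < d & forall r : R, 0 < r < d ->
    r < t /\ nrm (z t - z (t - r) - r *r (A (z t) + f)) <= e * r) ->
  left_rate_le (fun u => nrm (z (Num.max 0 u))) (nrm f) t.
Proof.
move=> t0 Dzt Hz e e0; have e2 : 0 < e / 2 by rewrite divr_gt0.
have [d1 d10 H1] := Hz _ e2.
have /(generatorP gen)/(_ _ e2)[d3 d30 H3] := conj Dzt (erefl (A (z t))).
exists (Num.min d1 d3); first by rewrite !lt_min d10.
move=> r /andP[r0]; rewrite lt_min => /andP[r1 r3].
have [rt {}H1] : r < t /\ _ := H1 r (introT andP (conj r0 r1)).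
have {}H3 := H3 r (introT andP (conj r0 r3)).
rewrite max_r ?(ltW t0) // max_r ?subr_ge0 ?(ltW rt) //.
set u1 := z t - _ - _ in H1 *; set u2 := S r _ - _ - _ in H3 *.
have E : 2 *r z t - z (t - r) = S r (z t) + ((u1 - u2) + r *r f).
  by rewrite /u1 /u2; vec_eq [:: z t; z (t - r); S r (z t); A (z t); f]; ring.
have := nrm_sub (2 *r z t) (z (t - r)); rewrite E nrmZ_ge0 //.
have := nrmD (S r (z t)) ((u1 - u2) + r *r f); have := nrmD (u1 - u2) (r *r f).
have := nrmB u1 u2; rewrite (nrmZ_ge0 _ (ltW r0)); have := contr (z t) (ltW r0).
lra.
Qed.

Lemma lyap_continuous (v : R -> X) : (forall u, D (v u)) -> ncont v ->
  continuous (fun u => lyap (v u)).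
Proof.
move=> Dv cv t; apply/cvgrPdist_le => e e0; have M1 : 0 < 1 + M by rewrite addr_gt0.
have [d d0 Hd] := cv t _ (divr_gt0 e0 M1).
apply/nbhs_ballP; exists d => //= u; rewrite /ball /= distrC => /Hd ud.
have g : (1 + M) * nrm (v u - v t) <= e by rewrite -ler_pdivlMl // mulrC.
have Dut := DB (Dv u) (Dv t); have Dtu := DB (Dv t) (Dv u).
have := lyap_add Dut (Dv t); have := lyap_add Dtu (Dv u); rewrite !subrK.
have := lyap_le Dut; have := lyap_le Dtu; rewrite (nrmC (v t)) => g1 g2 g3 g4.
by rewrite ler_norml; apply/andP; split; lra.
Qed.

(** * Generation of the perturbed semigroup *)
Section Perturbed.
Variable mu : R.
Hypotheses (mu_gt0 : 0 < mu) (mu_M : mu * (1 + M) <= 2^-1).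
Hypothesis mu_C : mu * C * (T / M + 2) <= 2^-1.
Hypothesis C_ge0 : 0 <= C.

Let w := M / T.
Let w_gt0 : 0 < w. Proof. by rewrite divr_gt0. Qed.

Let L y := A y - mu *r B y - w *r y.

Let L_linear (c : Scal R s) x y : D x -> D y ->
  D (c *: x + y) /\ L (c *: x + y) = c *: L x + L y.
Proof.
move=> Dx Dy; have [Dc Ac] := generator_linear gen c Dx Dy; split=> //.
have scaleC (a : R) v : c *: (a *r v) = a *r (c *: v) by rewrite !scalerA mulrC.
rewrite /L Ac B_linear // !scalerBr !scaleC.
by vec_eq [:: c *: A x; A y; c *: B x; B y; c *: x; y]; ring.
Qed.

(** [y - h L y] is [(1 + h / t + h w) y - (h / t) S(t) y + h mu B y] up to a vector
    that vanishes with [t].  By [lyap_orbit] the first two terms have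
    [lyap] at least [lyap y + h |B y|], because the shift [w = M / T] compensates
    [(M / T) |y|]; the last term costs [h mu (1 + M) |B y|], less than this
    surplus. *)
Lemma perturbed_lyap h y : 0 < h -> D y -> D (y - h *r L y) ->
  lyap y <= lyap (y - h *r L y).
Proof.
move=> h0 Dy Dx; apply: (@le_addM_eps _ _ _ (h * (2 + M))) => e e0.
have [d1 d10 H1] := lyap_orbit Dy e0.
have /(generatorP gen)/(_ _ e0)[d2 d20 H2] := conj Dy (erefl (A y)).
pose t : R := Num.min d1 d2 / 2; have t0 : 0 < t by rewrite divr_gt0 // lt_min d10.
have /andP[t1 t2] : (t < d1) && (t < d2).
  by rewrite -lt_min /t gtr_pMr ?invf_lt1 ?ltr1n // lt_min d10.
have {}H1 := H1 t (introT andP (conj t0 t1)).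
have {}H2 := H2 t (introT andP (conj t0 t2)).
have l0 : 0 < h / t by rewrite divr_gt0.
have c0 : 0 <= 1 + h / t + h * w.
  by have := mulr_gt0 h0 w_gt0; lra.
have := lyap_backward c0 (ltW l0) (ltW t0) Dy Dx.
have -> : (1 + h / t + h * w) *r y - (h / t) *r S t y - (y - h *r L y) =
   - ((h / t) *r (S t y - y - t *r A y) + (h * mu) *r B y).
  by rewrite /L; vec_eq [:: y; S t y; A y; B y]; field; rewrite gt_eqF.
rewrite nrmN; have := nrmD ((h / t) *r (S t y - y - t *r A y)) ((h * mu) *r B y).
rewrite (nrmZ_ge0 _ (ltW l0)) (nrmZ_ge0 _ (ltW (mulr_gt0 h0 mu_gt0))).
set n := nrm (_ *r _ + _) => g1 g2.
have g3 : h / t * nrm (S t y - y - t *r A y) <= h / t * (e * t) by rewrite ler_pM2l.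
have g4 : h / t * (e * t) = h * e by field; rewrite gt_eqF.
have g5 : h / t * lyap (S t y) <=
  h / t * (lyap y + t * (- nrm (B y) + M / T * nrm y + e)) by rewrite ler_pM2l.
have g6 : h / t * (lyap y + t * (- nrm (B y) + M / T * nrm y + e)) =
  h / t * lyap y + h * (- nrm (B y) + w * nrm y + e).
  by rewrite /w; field; rewrite !gt_eqF.
have M1 : 0 < 1 + M by rewrite addr_gt0.
have g7 : (1 + M) * n <= (1 + M) * (h * e + h * mu * nrm (B y)).
  by rewrite ler_pM2l //; lra.
have g8 : h * (w * nrm y) <= h * (w * lyap y).
  by rewrite !ler_pM2l // lyap_ge.
have g9 : h * (mu * (1 + M) * nrm (B y)) <= h * (2^-1 * nrm (B y)).
  by rewrite ler_pM2l // ler_wpM2r ?nrm_ge0.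
have g10 : 0 <= h * nrm (B y) by rewrite mulr_ge0 ?nrm_ge0 // ltW.
lra.
Qed.

(** Dividing [I - h L] by [1 + h w] turns it into [I - k A + k mu B] with
    [k = h / (1 + h w)], a step that stays below [T / M] for all [h]. *)
Let scaled h := h / (1 + h * w).

Let scaled_gt0 h : 0 < h -> 0 < scaled h.
Proof. by move=> h0; rewrite divr_gt0 // addr_gt0 // mulr_gt0. Qed.

(** [k |y|] and [k |A y|] are bounded by multiples of [|y - k A y|], because [A] is
    dissipative and [k] is bounded; the graph bound on [B] does the rest. *)
Let B_small h y : 0 < h -> D y ->
  scaled h * mu * nrm (B y) <= 2^-1 * nrm (y - scaled h *r A y).
Proof.
move=> h0 Dy; have k0 := scaled_gt0 h0; set k := scaled h in k0 *.
have hw : 0 < 1 + h * w by rewrite addr_gt0 // mulr_gt0.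
have kw : k <= T / M.
  have -> : T / M = w^-1 by rewrite /w invfM invrK mulrC.
  rewrite /k /scaled ler_pdivrMr // mulrDr mulr1 mulrCA mulVf ?gt_eqF // mulr1.
  by rewrite lerDr invr_ge0 ltW.
have g1 := generator_dissipative gen contr (ltW k0) Dy.
set v := y - k *r A y in g1 *.
have g2 : k * nrm (A y) <= 2 * nrm v.
  rewrite -nrmZ_ge0 ?(ltW k0) // (_ : k *r A y = y - v); last first.
    by rewrite /v; vec_eq [:: y; A y]; ring.
  by have := nrmB y v; lra.
have g3 : mu * k * nrm (B y) <= mu * k * (C * (nrm y + nrm (A y))).
  by rewrite (ler_pM2l (mulr_gt0 mu_gt0 k0)) B_graph.
have g4 : k * nrm y <= T / M * nrm v by exact: ler_pM (ltW k0) (nrm_ge0 _) kw g1.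
have g5 : mu * C * (k * nrm y + k * nrm (A y)) <= mu * C * (T / M * nrm v + 2 * nrm v).
  by rewrite (ler_wpM2l (mulr_ge0 (ltW mu_gt0) C_ge0)) // lerD.
have g6 : mu * C * (T / M + 2) * nrm v <= 2^-1 * nrm v by rewrite ler_wpM2r ?nrm_ge0.
lra.
Qed.

Let LE h y : 0 < h ->
  (1 + h * w)^-1 *r (y - h *r L y) = y - scaled h *r A y + (scaled h * mu) *r B y.
Proof.
move=> h0; rewrite /L /scaled; vec_eq [:: y; A y; B y]; field;
  by rewrite gt_eqF // addr_gt0 // mulr_gt0.
Qed.

Lemma perturbed_lipschitz h y : 0 < h -> D y -> nrm y <= 2 * nrm (y - h *r L y).
Proof.
move=> h0 Dy; have k0 := scaled_gt0 h0; have g1 := B_small h0 Dy.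
have g2 := generator_dissipative gen contr (ltW k0) Dy.
have hw : 0 < 1 + h * w by rewrite addr_gt0 // mulr_gt0.
have := nrm_sub (y - scaled h *r A y) (- ((scaled h * mu) *r B y)).
have i0 : 0 <= (1 + h * w)^-1 by rewrite invr_ge0 ltW.
rewrite opprK nrmN -LE // (nrmZ_ge0 _ i0) (nrmZ_ge0 _ (ltW (mulr_gt0 k0 mu_gt0))).
set n := nrm (y - h *r L y).
have : (1 + h * w)^-1 * n <= n.
  by rewrite ler_piMl ?nrm_ge0 // invf_le1 // lerDl (ltW (mulr_gt0 h0 w_gt0)).
lra.
Qed.

(** In terms of [v = y - k A y] the equation reads [v + k mu B (J v) = x / (1 + h w)],
    with [J] the resolvent of [A] for the step [k], and by [B_small] the map
    [v |-> k mu B (J v)] is Lipschitz with constant 1/2. *)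
Lemma perturbed_solve h x : 0 < h -> exists y, D y /\ y - h *r L y = x.
Proof.
move=> h0; have k0 := scaled_gt0 h0.
have hw : 0 < 1 + h * w by rewrite addr_gt0 // mulr_gt0.
have /choice[J HJ] : forall v, exists y, D y /\ y - scaled h *r A y = v.
  by move=> v; exact: (resolvent_exists gen contr).
have q1 : 0 <= (2^-1 : R) < 1 by lra.
have [v Hv] : exists v, v + (scaled h * mu) *r B (J v) = (1 + h * w)^-1 *r x.
  apply: (neumann_solve _ q1 (K := fun v => (scaled h * mu) *r B (J v))) => u v.
  have [Du Hu] := HJ u; have [Dv Hv] := HJ v; rewrite -scalerBr -BB //.
  rewrite (nrmZ_ge0 _ (ltW (mulr_gt0 k0 mu_gt0))).
  apply: le_trans (B_small h0 (DB Du Dv)) _.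
  rewrite (generator_B gen Du Dv).2 -[X in _ <= _ * nrm (X - _)]Hu -[X in _ <= _ * nrm (_ - X)]Hv.
  rewrite le_eqVlt; apply/orP; left; apply/eqP; congr (_ * nrm _).
  by vec_eq [:: J u; J v; A (J u); A (J v)]; ring.
have [Dy Hy] := HJ v; exists (J v); split=> //.
have -> : x = (1 + h * w) *r ((1 + h * w)^-1 *r x).
  by vec_eq [:: x]; field; rewrite gt_eqF.
have := LE (J v) h0; rewrite Hy Hv => <-.
by vec_eq [:: J v; L (J v)]; field; rewrite gt_eqF.
Qed.

Theorem perturbed_generates : exists V : R -> {linear X -> X},
  generates D (fun y => A y - mu *r B y) V /\
  forall t x, nrm (V t x) <= (1 + M) * expR (M / T * t) * nrm x.
Proof.
have /choice[J HJ] : forall p : R * X, exists y,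
    (0 < p.1 -> D y /\ y - p.1 *r L y = p.2) /\ (p.1 <= 0 -> y = p.2).
  move=> [h x] /=; case: (ltP 0 h) => h0.
    by have [y Hy] := perturbed_solve x h0; exists y.
  by exists x.
pose Rs h x := J (h, x).
have Rs_solves (h : R) x : 0 < h -> D (Rs h x) /\ Rs h x - h *r L (Rs h x) = x.
  by move=> h0; apply: (HJ (h, x)).1.
have Rs_id (h : R) x : h <= 0 -> Rs h x = x by move=> h0; apply: (HJ (h, x)).2.
have L_inj (h : R) y : 0 < h -> D y -> y - h *r L y = 0 -> y = 0.
  move=> h0 Dy Ey; have := perturbed_lipschitz h0 Dy; rewrite Ey nrm0 mulr0 => y0.
  by apply: nrm_eq0; apply/eqP; rewrite eq_le y0 nrm_ge0.
have word_D v x : D x -> D (foldr Rs x v) /\ lyap (foldr Rs x v) <= lyap x.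
  move=> Dx; elim: v => //= h v [Dv Hv]; case: (ltP 0 h) => h0; last by rewrite Rs_id.
  have [Dh Eh] := Rs_solves h (foldr Rs x v) h0; split=> //.
  apply: le_trans Hv; rewrite -[X in _ <= lyap X]Eh; apply: perturbed_lyap => //.
  by rewrite Eh.
have word_lip v x y : nrm (foldr Rs x v - foldr Rs y v) <= 2 ^+ size v * nrm (x - y).
  elim: v => /= [|h v IH]; first by rewrite mul1r.
  rewrite exprS -mulrA; set a := foldr Rs x v in IH *; set b := foldr Rs y v in IH *.
  have [h0|h0] := ltP 0 h; last first.
    by rewrite !Rs_id //; have := nrm_ge0 (a - b); lra.
  have [Da Ea] := Rs_solves h a h0; have [Db Eb] := Rs_solves h b h0.
  apply: le_trans (perturbed_lipschitz h0 (DB Da Db)) _.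
  rewrite ler_pM2l //; apply: le_trans IH; rewrite le_eqVlt; apply/orP; left; apply/eqP.
  have [_] := L_linear (-1) Db Da; rewrite !scaleN1r ![- _ + _]addrC => ->.
  rewrite -[in RHS]Ea -[in RHS]Eb; congr nrm.
  by vec_eq [:: Rs h a; Rs h b; L (Rs h a); L (Rs h b)]; ring.
(* The bound [1 + M] comes from [lyap], which is defined on [D] only.  It is
   extended by density using the crude Lipschitz constant [2 ^ size v], whose
   size does not matter for a fixed word. *)
have word_bounded v x : nrm (foldr Rs x v) <= (1 + M) * nrm x.
  apply: (@le_addM_eps _ _ _ (1 + M + 2 ^+ size v)) => e e0.
  have [d Dd Hd] := domain_dense gen contr x e0.
  have [Dw Hw] := word_D v d Dd; have := lyap_ge Dw; have := lyap_le Dd.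
  have := word_lip v x d; have := nrm_sub (foldr Rs x v) (foldr Rs d v).
  have := nrm_sub d x; rewrite (nrmC x d) => g1 g2 g3 g4 g5.
  have g6 : 2 ^+ size v * nrm (d - x) <= 2 ^+ size v * e.
    by rewrite ler_wpM2l // exprn_ge0.
  have g7 : (1 + M) * nrm d <= (1 + M) * (nrm x + e).
    by rewrite ler_wpM2l ?addr_ge0 ?(ltW M_gt0) //; lra.
  lra.
have M1 : 0 < 1 + M by rewrite addr_gt0.
have [U [HU Ub]] := euler_generates L_linear (domain_dense gen contr) L_inj
  Rs_solves Rs_id M1 word_bounded.
have [|V [HV VE]] := @generates_rescale _ _ _ D L (fun y => A y - mu *r B y) U w _ HU.
  by move=> x _; rewrite /L subrK.
exists V; split=> // t x; rewrite VE nrmZ_ge0 ?expR_ge0 //.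
rewrite /w; set E := expR _.
have -> : (1 + M) * E * nrm x = E * ((1 + M) * nrm x) by ring.
by apply: ler_wpM2l (Ub t x); exact: expR_ge0.
Qed.

End Perturbed.
End Perturbation.

(** * The duality map *)
Section Duality.
Variables (R : realType) (s : scalars) (X : completeNormedModType (Scal R s)).
Implicit Types (y : X) (phi : {linear X -> (Scal R s)^o}).

Lemma norm_re_le (x : (Scal R s)^o) : `|re x| <= nrm x.
Proof.
by rewrite ler_norml lerNl -reN; apply/andP; split;
  [rewrite -(nrmN x)|]; exact: re_le_nrm.
Qed.

Lemma re_functionalZ phi (a : R) y : re (phi (a *r y)) = a * re (phi y).
Proof. by rewrite linR -re_of_realM. Qed.

Lemma duality_bound y phi : J y phi -> forall x, nrm (phi x) <= nrm y * nrm x.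
Proof.
move=> [cphi _ Ed] x; have [C HC] := continuous_bounded cphi.
pose A := [set nrm (phi x) | x in [set x : X | nrm x <= 1]].
have A0 : A 0 by exists 0; rewrite ?linear0 /= nrm0.
have bA : has_ubound A.
  exists `|C| => _ [z /= z1 <-]; apply: le_trans (HC z) _.
  apply: le_trans (ler_norm _) _; rewrite normrM (ger0_norm (nrm_ge0 z)).
  by rewrite ler_piMr.
have supA : has_sup A by split=> //; exists 0.
have dn0 : 0 <= dual_norm phi by exact: ub_le_sup.
have -> : nrm y = dual_norm phi.
  by apply/eqP; rewrite -(eqrXn2 (n := 2)) ?nrm_ge0 //; apply/eqP.
have [x0|xn0] := eqVneq (nrm x) 0.
  by rewrite (nrm_eq0 x0) linear0 !nrm0 mulr0.
have x0 : 0 < nrm x by rewrite lt_def xn0 nrm_ge0.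
have : nrm (phi ((nrm x)^-1 *r x)) <= dual_norm phi.
  apply: ub_le_sup => //; exists ((nrm x)^-1 *r x) => //=.
  by rewrite nrmZ_ge0 ?invr_ge0 ?(ltW x0) // mulVf.
rewrite linR nrmZ_ge0 ?invr_ge0 ?(ltW x0) //.
by rewrite mulrC ler_pdivrMr.
Qed.

Lemma duality_re_le y phi x : J y phi -> re (phi x) <= nrm y * nrm x.
Proof. by move=> /duality_bound H; apply: le_trans (H x); exact: re_le_nrm. Qed.

Lemma duality_re y phi : J y phi -> re (phi y) = nrm y ^+ 2.
Proof. by move=> [_ -> _]; exact: re_of_real. Qed.

(** [Re <S(h) y, phi> <= |y|^2 = Re <y, phi>] for a contraction [S(h)]. *)
Lemma duality_dissipative (D : set X) (A : X -> X) (S : R -> {linear X -> X}) y phi :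
  generates D A S -> contraction_semigroup S -> D y -> J y phi -> re (phi (A y)) <= 0.
Proof.
move=> gen contr Dy Jy; apply: (@le_addM_eps _ _ _ (nrm y)) => e e0; rewrite add0r.
have /(generatorP gen)/(_ _ e0)[d d0 Hd] := conj Dy (erefl (A y)).
pose h := d / 2; have h0 : 0 < h by rewrite divr_gt0.
have {}Hd : nrm (S h y - y - h *r A y) <= e * h by apply: Hd; rewrite h0 /= /h; lra.
have g1 := duality_re_le (S h y) Jy; have g2 := contr h y (ltW h0).
have g3 : nrm y * nrm (S h y) <= nrm y * nrm y by rewrite ler_wpM2l ?nrm_ge0.
have g4 := duality_re_le (- (S h y - y - h *r A y)) Jy.
have g5 : nrm y * nrm (S h y - y - h *r A y) <= nrm y * (e * h).
  by rewrite ler_wpM2l ?nrm_ge0.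
rewrite -(ler_pM2l h0) -re_functionalZ.
have -> : h *r A y = - (S h y - y - h *r A y) + S h y - y.
  by vec_eq [:: S h y; y; A y]; ring.
rewrite (linearB phi) (linearD phi) reB reD (duality_re Jy).
rewrite nrmN in g4; lra.
Qed.

End Duality.

(** * Decay of the closed loop over one period *)
Section Decay.
Variables (R : realType) (s : scalars) (X : completeNormedModType (Scal R s)).
Variables (D : set X) (A : X -> X) (S : R -> {linear X -> X}).
Hypotheses (gen : generates D A S) (contr : contraction_semigroup S).
Variables (B : X -> X) (C : R).
Hypothesis B_linear : forall (a : Scal R s) x y, D x -> D y ->
  B (a *: x + y) = a *: B x + B y.
Hypothesis B_graph : forall y, D y -> nrm (B y) <= C * (nrm y + nrm (A y)).
Variables (T M : R).
Hypotheses (T_gt0 : 0 < T) (M_gt0 : 0 < M).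
Hypothesis m1 : forall y, D y ->
  (\int[lebesgue_measure]_(t in `[0%R, T]) (nrm (B (S t y)))%:E <= (M * nrm y)%:E)%E.
Variable mu : R.
Hypotheses (mu_gt0 : 0 < mu) (mu_M : mu * (1 + M) <= 2^-1).
Hypothesis mu_C : mu * C * (T / M + 2) <= 2^-1.
Hypothesis C_ge0 : 0 <= C.
Variable V : R -> {linear X -> X}.
Hypothesis V_gen : generates D (fun y => A y - mu *r B y) V.
Hypothesis V_bound : forall t x, nrm (V t x) <= (1 + M) * expR (M / T * t) * nrm x.

(** A bound for [V] on [0, T] that does not depend on [mu]. *)
Definition growth := (1 + M) * expR M.
Local Notation K := growth.

Let K_ge1 : 1 <= K.
Proof.
have h := expR_ge1Dx M; have m0 := M_gt0; have M1 : 0 < 1 + M by lra.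
have h2 : (1 + M) * 1 <= K by rewrite /growth (ler_pM2l M1); lra.
lra.
Qed.

Lemma growth_bound t x : 0 <= t <= T -> nrm (V t x) <= K * nrm x.
Proof.
move=> /andP[t0 tT]; apply: le_trans (V_bound t x) _.
rewrite ler_wpM2r ?nrm_ge0 // ler_pM2l ?addr_gt0 // ler_expR.
by rewrite mulrAC ler_pdivrMr // ler_pM2l.
Qed.

Let V_loc (b : R) : exists2 K : R, 0 < K &
  forall (t : R) x, 0 <= t <= b -> nrm (V t x) <= K * nrm x.
Proof.
exists ((1 + M) * expR (M / T * b)); first by rewrite mulr_gt0 ?addr_gt0 ?expR_gt0.
move=> t x /andP[t0 tb]; apply: le_trans (V_bound t x) _.
by rewrite ler_wpM2r ?nrm_ge0 // ler_pM2l ?addr_gt0 // ler_expR ler_pM2l // divr_gt0.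
Qed.

Let S_loc := contraction_bounded contr.

Let BB x y : D x -> D y -> B (x - y) = B x - B y.
Proof.
by move=> Dx Dy; have := B_linear (-1) Dy Dx; rewrite !scaleN1r ![- _ + _]addrC.
Qed.

Let L y := A y - mu *r B y.

(** [mu B] is small relative to the graph norm of [A], so [B] is also bounded for
    the graph norm of [L = A - mu B]. *)
Let B_graphL y : D y -> nrm (B y) <= 2 * C * (nrm y + nrm (L y)).
Proof.
move=> Dy; have g1 := B_graph Dy.
have g2 : nrm (A y) <= nrm (L y) + mu * nrm (B y).
  rewrite -nrmZ_ge0 ?(ltW mu_gt0) //; apply: le_trans (nrmD _ _).
  by rewrite /L subrK.
have g3 : C * (nrm y + nrm (A y)) <= C * (nrm y + nrm (L y) + mu * nrm (B y)).
  by rewrite ler_wpM2l //; lra.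
have g4 : 0 <= mu * C * (T / M).
  by apply: mulr_ge0; [apply: mulr_ge0 => //; exact: ltW|rewrite divr_ge0 ?(ltW T_gt0) ?(ltW M_gt0)].
have g5 : mu * C * nrm (B y) <= 4^-1 * nrm (B y).
  by rewrite ler_wpM2r ?nrm_ge0 //; have := mu_C; lra.
have g6 : 0 <= C * (nrm y + nrm (L y)) by rewrite mulr_ge0 ?addr_ge0 ?nrm_ge0.
lra.
Qed.

Let VD t x : 0 <= t -> D x -> D (V t x).
Proof. by move=> t0 Dx; have [] := generator_orbit V_gen V_loc t0 Dx. Qed.
Let SD t x : 0 <= t -> D x -> D (S t x).
Proof. by move=> t0 Dx; have [] := generator_orbit gen S_loc t0 Dx. Qed.
Let max0 (u : R) : 0 <= Num.max 0 u. Proof. by rewrite le_max lexx. Qed.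
Let max0K (u : R) : Num.max 0 (Num.max 0 u) = Num.max 0 u.
Proof. by rewrite max_r. Qed.

Lemma left_rate_le_trans (F : R -> R) (c c' t : R) :
  c <= c' -> left_rate_le F c t -> left_rate_le F c' t.
Proof.
move=> cc' HF e e0; have [d d0 Hd] := HF e e0; exists d => // r rd.
have /andP[r0 _] := rd.
by apply: le_trans (Hd r rd) _; rewrite ler_pM2l // lerD2r.
Qed.

Lemma prim_nondecreasing (f : R -> R) (a b : R) : 0 <= a <= b -> continuous f ->
  (forall t, 0 <= t -> 0 <= f t) -> prim f a <= prim f b.
Proof.
move=> /andP[a0 ab] cf f0; have ba : 0 <= b - a by rewrite subr_ge0.
have := prim_shift a0 ba cf; rewrite subrK -subr_ge0 => <-.
rewrite -(mul0r (b - a)) -prim_cst //; apply: prim_le => //.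
- by move=> u; exact: cvg_cst.
- move=> u; apply: (@continuous_comp _ _ _ (fun v => v + a) f); last exact: cf.
  by apply: cvgD => //; exact: cvg_cst.
by move=> t /andP[t0 _]; rewrite f0 // addr_ge0.
Qed.

Lemma orbit_lipschitz (u : R) x : 0 <= u <= T -> D x ->
  nrm (V u x - x) <= u * (K * nrm (L x)).
Proof.
move=> /andP[u0 uT] Dx; pose v (r : R) := V (Num.max 0 r) x - x.
have cv : ncont v.
  have := orbit_ncont V_gen V_loc x => cV t e e0; have [d d0 Hd] := cV t e e0.
  exists d => // w wd; have := Hd w wd; rewrite /v.
  by congr (nrm _ <= _); vec_eq [:: V (Num.max 0 w) x; V (Num.max 0 t) x; x]; ring.
have [[_ V0 _ _] _] := V_gen.
have cc : continuous (fun _ : R => K * nrm (L x)) by move=> ?; exact: cvg_cst.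
have := @left_rate_prim _ (fun r => nrm (v r)) _ u u0 cc.
have -> : v 0 = 0 by rewrite /v max_l // V0 subrr.
have -> : v u = V u x - x by rewrite /v max_r.
rewrite prim_cst // nrm0 add0r [u * _]mulrC; apply.
  by move=> t _; exact: ncont_nrm.
move=> t /andP[t0 tu] e e0.
have [d d0 Hd] := orbit_left_derivative V_gen V_loc t0 Dx e0.
exists d => // r rd; have [rt {}Hd] := Hd r rd; have /andP[r0 _] := rd.
rewrite /v max_r ?(ltW t0) // max_r ?subr_ge0 ?(ltW rt) //.
have [_ EL] := generator_orbit V_gen V_loc (ltW t0) Dx.
rewrite EL in Hd; apply: le_trans (nrm_sub _ _) _.
have -> : V t x - x - (V (t - r) x - x) =
  (V t x - V (t - r) x - r *r V t (L x)) + r *r V t (L x).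
  by vec_eq [:: V t x; x; V (t - r) x; V t (L x)]; ring.
apply: le_trans (nrmD _ _) _; rewrite (nrmZ_ge0 _ (ltW r0)) mulrDr.
have : r * nrm (V t (L x)) <= r * (K * nrm (L x)).
  by rewrite ler_pM2l // growth_bound // (ltW t0) (le_trans tu).
have : e * r = r * e by rewrite mulrC.
lra.
Qed.

Section Trajectory.
Variable y0 : X.
Hypothesis Dy0 : D y0.
Local Notation n := (nrm y0).

(* The closed-loop orbit [y], the free orbit [e] and the outputs of [y] and of
   [y - e]. *)
Let y (t : R) := V (Num.max 0 t) y0.
Let e (t : R) := S (Num.max 0 t) y0.
Let beta := observation V B y0.
Let zeta (t : R) := nrm (B (y t) - B (e t)).

Let y_ncont : ncont y. Proof. exact: orbit_ncont V_gen V_loc y0. Qed.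
Let e_ncont : ncont e. Proof. exact: orbit_ncont gen S_loc y0. Qed.
Let Dy t : D (y t). Proof. exact: VD. Qed.
Let De t : D (e t). Proof. exact: SD. Qed.

Let By_ncont : ncont (fun t => B (y t)).
Proof. exact: (graph_orbit_ncont V_gen V_loc BB B_graphL Dy0). Qed.
Let Be_ncont : ncont (fun t => B (e t)).
Proof. exact: (graph_orbit_ncont gen S_loc BB B_graph Dy0). Qed.

Let beta_continuous : continuous beta. Proof. exact: ncont_nrm By_ncont. Qed.
Let zeta_continuous : continuous zeta.
Proof. exact: ncont_nrm (ncontB By_ncont Be_ncont). Qed.

Let y_bound t : t <= T -> nrm (y t) <= K * n.
Proof.
by move=> tT; apply: growth_bound; rewrite max0 /= ge_max tT (ltW T_gt0).
Qed.

Let e_bound t : nrm (e t) <= n. Proof. exact: contr. Qed.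

Let y_left (t r : R) : 0 < t -> 0 < r -> exists2 d : R, 0 < d & forall u : R, 0 < u < d ->
  u < t /\ nrm (y t - y (t - u) - u *r (A (y t) + (- mu) *r B (y t))) <= r * u.
Proof.
move=> t0 r0; have [d d0 Hd] := orbit_left_derivative V_gen V_loc t0 Dy0 r0.
exists d => // u ud; have [ut {}Hd] := Hd u ud; split=> //.
rewrite /y max_r ?(ltW t0) // max_r ?subr_ge0 ?(ltW ut) //.
by rewrite of_realN scaleNr.
Qed.

Let z_left (t r : R) : 0 < t -> 0 < r -> exists2 d : R, 0 < d & forall u : R, 0 < u < d ->
  u < t /\ nrm (y t - e t - (y (t - u) - e (t - u)) -
                u *r (A (y t - e t) + (- mu) *r B (y t))) <= r * u.
Proof.
move=> t0 r0; have r2 : 0 < r / 2 by rewrite divr_gt0.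
have [d1 d10 H1] := y_left t0 r2.
have [d2 d20 H2] := orbit_left_derivative gen S_loc t0 Dy0 r2.
exists (Num.min d1 d2) => [|u]; first by rewrite lt_min d10.
rewrite lt_min => /and3P[u0 u1 u2].
have [ut {}H1] := H1 u (introT andP (conj u0 u1)).
have [_ {}H2] := H2 u (introT andP (conj u0 u2)); split=> //.
have Et : e t = S t y0 by rewrite /e max_r ?(ltW t0).
have Etu : e (t - u) = S (t - u) y0 by rewrite /e max_r ?subr_ge0 ?(ltW ut).
rewrite -Et -Etu in H2; rewrite (generator_B gen (Dy t) (De t)).2.
have -> : y t - e t - (y (t - u) - e (t - u)) -
    u *r (A (y t) - A (e t) + (- mu) *r B (y t)) =
  (y t - y (t - u) - u *r (A (y t) + (- mu) *r B (y t))) -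
  (e t - e (t - u) - u *r A (e t)).
  by vec_eq [:: y t; e t; y (t - u); e (t - u); A (y t); A (e t); B (y t)]; ring.
by apply: le_trans (nrmB _ _) _; lra.
Qed.

Let cst_continuous (c : R) : continuous (fun _ : R => c).
Proof. by move=> u; exact: cvg_cst. Qed.

Let lin_continuous (a b : R) (f g : R -> R) : continuous f -> continuous g ->
  continuous (fun u => a * f u + b * g u).
Proof. by move=> cf cg u; apply: cvgD; apply: cvgMr; [exact: cf|exact: cg]. Qed.

Let T0 : 0 <= T := ltW T_gt0.

Definition input_const := 2 * (1 + M + M * K).

Let y0E : y 0 = y0.
Proof. by have [[_ V0 _ _] _] := V_gen; rewrite /y max_l // V0. Qed.
Let e0E : e 0 = y0.
Proof. by have [[_ S0 _ _] _] := gen; rewrite /e max_l // S0. Qed.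

Let nrm_muB t : nrm ((- mu) *r B (y t)) = mu * beta t.
Proof. by rewrite nrmZ normrN gtr0_norm. Qed.

(** Along [y] the inhomogeneity is [f = - mu B y], so [lyap y] has left derivative
    at most [- |B y| + (M / T) |y| + (1 + M) mu |B y|], where the last term is at
    most half of the first.  Integration over [0, T] gives the bound, [lyap]
    being nonnegative at [T]. *)
Lemma observed_input : prim beta T <= input_const * n.
Proof.
pose g (u : R) : R := - 2^-1 * beta u + 1 * (M / T * (K * n)).
have cg : continuous g by apply: lin_continuous.
have cF : continuous (fun u => lyap S B T (y u)).
  exact: (lyap_continuous gen contr B_linear B_graph T_gt0 M_gt0 m1 Dy y_ncont).
have : lyap S B T (y T) <= lyap S B T (y 0) + prim g T.
  apply: (left_rate_prim (F := fun u => lyap S B T (y u)) T0 cg) => [t _|t /andP[t0 tT]].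
    exact: cF.
  pose z (u : R) := y u.
  have Dz (u : R) : 0 <= u -> D (z u) by move=> _; exact: Dy.
  have := lyap_left_rate gen contr B_linear B_graph T_gt0 M_gt0 m1 (z := z) t0 Dz
    (fun r r0 => y_left t0 r0).
  rewrite nrm_muB -[nrm (B (z t))]/(beta t) => H.
  have {}H : left_rate_le (fun u => lyap S B T (y u)) (- beta t + M / T * nrm (z t) + (1 + M) * (mu * beta t)) t.
    move=> r r0; have [d d0 Hd] := H r r0; exists d => // u ud.
    have := Hd u ud; rewrite /z /y.
    by rewrite !max0K.
  apply: left_rate_le_trans H; rewrite /g mul1r.
  have g1 : M / T * nrm (z t) <= M / T * (K * n).
    by rewrite ler_pM2l ?divr_gt0 // y_bound.
  have g2 : mu * (1 + M) * beta t <= 2^-1 * beta t by rewrite ler_wpM2r // nrm_ge0.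
  lra.
have := lyap_ge gen contr B_linear B_graph T_gt0 (Dy T).
have := lyap_le gen contr B_linear B_graph T_gt0 m1 (Dy 0); rewrite y0E.
rewrite (prim_linear _ _ T0 beta_continuous (@cst_continuous (M / T * (K * n)))).
rewrite prim_cst // mul1r.
have -> : M / T * (K * n) * T = M * K * n by field; rewrite gt_eqF.
have := nrm_ge0 (y T); rewrite /input_const; lra.
Qed.

(** [z = y - e] starts at 0 and is driven by [- mu B y], and [S] is a
    contraction. *)
Let z_bound t : 0 <= t <= T -> nrm (y t - e t) <= mu * (input_const * n).
Proof.
move=> /andP[t0 tT].
have cg : continuous (fun u => mu * beta u + 0 * beta u) by apply: lin_continuous.
have : nrm (y t - e t) <= nrm (y 0 - e 0) + prim (fun u => mu * beta u + 0 * beta u) t.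
  apply: (left_rate_prim (F := fun u => nrm (y u - e u)) t0 cg) => [u _|u /andP[u0 ut]].
    by apply: (ncont_nrm (v := fun u => y u - e u)); exact: ncontB.
  pose z (u : R) := y u - e u.
  have Dz (v : R) : D (z v) by have [] := generator_B gen (Dy v) (De v).
  have H := nrm_left_rate gen contr (z := z) u0 (Dz u) (fun r r0 => z_left u0 r0).
  rewrite mul0r addr0 -nrm_muB => r r0; have [d d0 Hd] := H r r0; exists d => // v vd.
  have := Hd v vd; rewrite /z /y /e.
  by rewrite !max0K.
rewrite y0E e0E subrr nrm0 add0r (prim_linear _ _ t0 beta_continuous beta_continuous).
rewrite mul0r addr0 => /le_trans; apply; rewrite ler_pM2l //.
apply: le_trans observed_input; apply: prim_nondecreasing => //; first by rewrite t0.
by move=> u _; exact: nrm_ge0.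
Qed.

Definition deviation_const := (1 + 2 * M) * input_const.

(** The estimate of [observed_input] for [y - e]: it starts at 0, and both of its
    sources, the driving term [mu B y] and [(M / T) |y - e|], are of order [mu]. *)
Lemma observed_deviation : prim zeta T <= deviation_const * mu * n.
Proof.
pose b (u : R) : R := (1 + M) * mu * beta u + M / T * (mu * (input_const * n)) * 1.
have cb : continuous b by apply: lin_continuous.
pose g (u : R) : R := 1 * b u + (-1) * zeta u.
have cg : continuous g by apply: lin_continuous.
pose z (u : R) := y u - e u.
have Dz (u : R) : D (z u) by have [] := generator_B gen (Dy u) (De u).
have cz : ncont z by exact: ncontB.
have cF : continuous (fun u => lyap S B T (z u)).
  exact: (lyap_continuous gen contr B_linear B_graph T_gt0 M_gt0 m1 Dz cz).
have : lyap S B T (z T) <= lyap S B T (z 0) + prim g T.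
  apply: (left_rate_prim (F := fun u => lyap S B T (z u)) T0 cg) => [t _|t /andP[t0 tT]].
    exact: cF.
  have := lyap_left_rate gen contr B_linear B_graph T_gt0 M_gt0 m1 (z := z) t0 (fun u _ => Dz u)
    (fun r r0 => z_left t0 r0).
  rewrite nrm_muB BB // -[nrm (B (y t) - B (e t))]/(zeta t) => H.
  have {}H : left_rate_le (fun u => lyap S B T (z u))
      (- zeta t + M / T * nrm (z t) + (1 + M) * (mu * beta t)) t.
    move=> r r0; have [d d0 Hd] := H r r0; exists d => // u ud.
    have := Hd u ud; rewrite /z /y /e.
    by rewrite !max0K.
  apply: left_rate_le_trans H; rewrite /g /b.
  have g1 : M / T * nrm (z t) <= M / T * (mu * (input_const * n)).
    by rewrite ler_pM2l ?divr_gt0 // z_bound // (ltW t0).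
  lra.
have := lyap_ge gen contr B_linear B_graph T_gt0 (Dz T).
have := lyap_le gen contr B_linear B_graph T_gt0 m1 (Dz 0).
have -> : nrm (z 0) = 0 by rewrite /z y0E e0E subrr nrm0.
rewrite (prim_linear _ _ T0 cb zeta_continuous).
rewrite (prim_linear _ _ T0 beta_continuous (@cst_continuous 1)) prim_cst //.
have -> : M / T * (mu * (input_const * n)) * (1 * T) = M * (mu * (input_const * n)).
  by field; rewrite gt_eqF.
have gb : (1 + M) * mu * prim beta T <= (1 + M) * mu * (input_const * n).
  have M1 : 0 < (1 + M) * mu by rewrite mulr_gt0 // addr_gt0.
  by rewrite (ler_pM2l M1); exact: observed_input.
have := nrm_ge0 (z T); rewrite /deviation_const; lra.
Qed.

Section Selection.
Variables (k1 k2 delta : R).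
Hypotheses (k1_ge0 : 0 <= k1) (k2_ge0 : 0 <= k2).
Hypothesis m2 : forall y, D y -> forall phi : R -> {linear X -> (Scal R s)^o},
  (forall t, 0 <= t <= T -> J (S t y) (phi t)) ->
  ((delta * nrm y ^+ 2)%:E <=
     selection_integral `[0%R, T] (fun t => re (phi t (B (S t y)))))%E.
Hypothesis m3 : forall y z, D y -> D z ->
  exists phi psi : {linear X -> (Scal R s)^o},
    [/\ J y phi, J z psi &
      nrm (phi (B y) - psi (B z)) <=
        k1 * (graph_norm B y + graph_norm B z) * nrm (y - z) +
        k2 * (nrm y + nrm z) * graph_norm B (y - z)].

Definition error_const := k1 * input_const * (input_const + M) + 2 * k2 * K * deviation_const +
  T * (2 * k1 * input_const * K + 2 * k2 * K * input_const).

Let b := observation S B y0.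
Let b_continuous : continuous b. Proof. exact: ncont_nrm Be_ncont. Qed.

Let input_const_ge0 : 0 <= input_const.
Proof.
have h : 0 <= M * K by rewrite mulr_ge0 ?(ltW M_gt0) // (le_trans ler01).
by rewrite /input_const; have := M_gt0; lra.
Qed.

Let a1 := k1 * (mu * (input_const * n)).
Let a2 := 2 * k2 * (K * n).
(* The right-hand side of the Lipschitz estimate of the duality products, after
   the a priori bounds on [y], [e] and [y - e] have been inserted. *)
Let error u := 1 * (a1 * beta u + a1 * b u) +
  1 * (a2 * zeta u + (a1 * (2 * (K * n)) + a2 * (mu * (input_const * n))) * 1).

Let error_continuous : continuous error.
Proof. by apply: lin_continuous; apply: lin_continuous. Qed.

Let Kn_ge : n <= K * n.
Proof. by rewrite ler_peMl // nrm_ge0. Qed.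

Let n_ge0 : 0 <= n. Proof. exact: nrm_ge0. Qed.
Let Kn_ge0 : 0 <= K * n. Proof. exact: le_trans n_ge0 Kn_ge. Qed.
Let K_gt0 : 0 < K. Proof. exact: lt_le_trans ltr01 K_ge1. Qed.

Let a1_ge0 : 0 <= a1.
Proof. by rewrite mulr_ge0 // mulr_ge0 ?(ltW mu_gt0) // mulr_ge0. Qed.
Let a2_ge0 : 0 <= a2.
Proof. by apply: mulr_ge0 Kn_ge0; apply: mulr_ge0. Qed.

Let prim_error : prim error T <= mu * n ^+ 2 * error_const.
Proof.
have cbb : continuous (fun u => a1 * beta u + a1 * b u) by apply: lin_continuous.
have czz : continuous (fun u => a2 * zeta u + (a1 * (2 * (K * n)) + a2 * (mu * (input_const * n))) * 1).
  by apply: lin_continuous.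
rewrite (prim_linear _ _ T0 cbb czz) (prim_linear _ _ T0 beta_continuous b_continuous).
rewrite (prim_linear _ _ T0 zeta_continuous (@cst_continuous 1)) prim_cst // !mul1r.
have h1 : a1 * prim beta T <= a1 * (input_const * n) by rewrite ler_wpM2l // observed_input.
have h2 : a1 * prim b T <= a1 * (M * n).
  by rewrite ler_wpM2l //; exact: (observation_prim_le gen contr B_linear B_graph T_gt0 m1 Dy0).
have h3 : a2 * prim zeta T <= a2 * (deviation_const * mu * n) by rewrite ler_wpM2l // observed_deviation.
apply: le_trans (lerD (lerD h1 h2) (lerD h3 (lexx _))) _.
rewrite le_eqVlt; apply/orP; left; apply/eqP.
by rewrite /a1 /a2 /error_const; ring.
Qed.

Let error_bound t : 0 <= t <= T ->
  k1 * (graph_norm B (y t) + graph_norm B (e t)) * nrm (y t - e t) +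
  k2 * (nrm (y t) + nrm (e t)) * graph_norm B (y t - e t) <= error t.
Proof.
move=> tT; have zb := z_bound tT; have /andP[t0 t1] := tT.
have yb := y_bound t1; have eb := e_bound t.
rewrite /graph_norm BB // -/(zeta t) -[nrm (B (y t))]/(beta t) -[nrm (B (e t))]/(b t).
have b0 : 0 <= b t by exact: nrm_ge0.
have be0 : 0 <= beta t by exact: nrm_ge0.
have ze0 : 0 <= zeta t by exact: nrm_ge0.
have y0' := nrm_ge0 (y t); have e0' := nrm_ge0 (e t); have z0' := nrm_ge0 (y t - e t).
have h1 : k1 * (nrm (y t) + beta t + (nrm (e t) + b t)) * nrm (y t - e t) <=
    k1 * (2 * (K * n) + beta t + b t) * (mu * (input_const * n)).
  apply: ler_pM => //; first by rewrite mulr_ge0 // !addr_ge0.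
  by rewrite ler_wpM2l //; have := Kn_ge; lra.
have h2 : k2 * (nrm (y t) + nrm (e t)) * (nrm (y t - e t) + zeta t) <=
    k2 * (2 * (K * n)) * (mu * (input_const * n) + zeta t).
  apply: ler_pM => //; [by rewrite mulr_ge0 // addr_ge0|by rewrite addr_ge0| |by rewrite lerD2r].
  by rewrite ler_wpM2l //; have := Kn_ge; lra.
apply: le_trans (lerD h1 h2) _.
rewrite le_eqVlt; apply/orP; left; apply/eqP.
by rewrite /error /a1 /a2; ring.
Qed.

Let f u := (2 * mu)^-1 * (nrm (y u) * nrm (y u)).

Let f_continuous : continuous f.
Proof.
have cn := ncont_nrm y_ncont.
by move=> u; apply: cvgMr; apply: cvgM; exact: cn.
Qed.

Let Cf := (2 * mu)^-1 * (2 * (K * n) * (K * (K * nrm (L y0)))).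

Let mu2_gt0 : 0 < (2 * mu)^-1. Proof. by rewrite invr_gt0 mulr_gt0. Qed.

Let f_lipschitz (t r : R) : t <= T -> 0 <= r -> `|f t - f (t - r)| <= Cf * r.
Proof.
move=> tT r0; have trT : t - r <= T by lra.
have -> : f t - f (t - r) =
    (2 * mu)^-1 * ((nrm (y t) + nrm (y (t - r))) * (nrm (y t) - nrm (y (t - r)))).
  by rewrite /f; ring.
have -> : Cf * r = (2 * mu)^-1 * ((2 * (K * n)) * (K * (K * nrm (L y0)) * r)).
  by rewrite /Cf; ring.
rewrite normrM (gtr0_norm mu2_gt0) ler_pM2l // normrM.
rewrite [X in X * _]ger0_norm ?addr_ge0 ?nrm_ge0 //.
apply: ler_pM; rewrite ?addr_ge0 ?nrm_ge0 ?normr_ge0 //.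
  by have := y_bound tT; have := y_bound trT; lra.
apply: le_trans (nrm_dist _ _) _.
pose p := Num.max 0 (t - r); pose q := Num.max 0 t.
have p0 : 0 <= p by exact: max0. have q0 : 0 <= q by exact: max0.
have qT : q <= T by rewrite ge_max T0.
have pq : p <= q by rewrite ge_max max0 /= le_max; apply/orP; right; lra.
have qp : q - p <= r.
  rewrite lerBlDr ge_max addr_ge0 //= -lerBlDl le_max lexx orbT //.
have [[_ _ VA _] _] := V_gen.
have -> : y t - y (t - r) = V p (V (q - p) y0 - y0).
  by rewrite (linearB (V p)) -VA ?subr_ge0 // subrKC.
have pT : 0 <= p <= T by rewrite p0 (le_trans pq).
apply: le_trans (growth_bound _ pT) _.
rewrite -mulrA ler_pM2l //.
have qpT : 0 <= q - p <= T by rewrite subr_ge0 pq /=; lra.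
apply: le_trans (orbit_lipschitz qpT Dy0) _.
rewrite mulrC ler_wpM2l //.
by apply: mulr_ge0 (nrm_ge0 _); exact: ltW.
Qed.

(** By dissipativity of [A] the left derivative of [|y|^2 / (2 mu)] is at most
    [- Re <B y, phi>] with [phi] in [J y], hence at most [error - gamma] with
    [gamma = Re <B S(t) y0, psi>].  The majorant of [gamma] given by
    [selection_integral_rate] then meets the lower bound [m2] on its integral. *)
Lemma decay_step : delta * n ^+ 2 <=
  (2 * mu)^-1 * (n ^+ 2 - nrm (V T y0) ^+ 2) + mu * n ^+ 2 * error_const.
Proof.
have /choice[P HP] : forall t : R, exists p : {linear X -> (Scal R s)^o} * {linear X -> (Scal R s)^o},
    [/\ J (y t) p.1, J (e t) p.2 & nrm (p.1 (B (y t)) - p.2 (B (e t))) <=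
        k1 * (graph_norm B (y t) + graph_norm B (e t)) * nrm (y t - e t) +
        k2 * (nrm (y t) + nrm (e t)) * graph_norm B (y t - e t)].
  by move=> t; have [phi [psi H]] := m3 (Dy t) (De t); exists (phi, psi).
have eE t : 0 <= t -> e t = S t y0 by move=> t0; rewrite /e max_r.
pose gamma t := re ((P t).2 (B (S t y0))).
have Jpsi t : 0 <= t <= T -> J (S t y0) (P t).2.
  by move=> /andP[t0 _]; rewrite -eE //; have [] := HP t.
have gamma_bound : exists C' : R, forall t, 0 <= t <= T -> `|gamma t| <= C'.
  have cwb : {within `[0, T], continuous b} by exact: continuous_subspaceT.
  have [c _ Hc] := EVT_max T0 cwb; exists (n * b c) => t tT.
  apply: le_trans (norm_re_le _) _; apply: le_trans (duality_bound (Jpsi t tT) _) _.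
  have /andP[t0 _] := tT; rewrite -eE //; apply: ler_pM; rewrite ?nrm_ge0 //.
  by apply: (Hc t); rewrite in_itv.
have f_neg t : t <= 0 -> f t = f 0.
  by move=> t0; rewrite /f /y !max_l.
have f_rate t : 0 < t <= T -> left_rate_le f (error t - gamma t) t.
  move=> /andP[t0 tT] r r0; have [Jy Je Hd] := HP t.
  have Eb : nrm ((P t).1 (B (y t)) - (P t).2 (B (e t))) <= error t.
    by apply: le_trans Hd _; apply: error_bound; rewrite (ltW t0).
  have g1 : gamma t - error t <= re ((P t).1 (B (y t))).
    have := norm_re_le ((P t).1 (B (y t)) - (P t).2 (B (e t)) : (Scal R s)^o).
    rewrite ler_norml reB => /andP[g _].
    by rewrite /gamma -eE ?(ltW t0) //; lra.
  have c0 : 0 < K * n + 1 by rewrite ltr_wpDl.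
  have r1 : 0 < r * mu / (K * n + 1) by rewrite divr_gt0 // mulr_gt0.
  have [d d0 {}Hd] := y_left t0 r1; exists d => // u ud.
  have [ut Hu] := Hd u ud; have /andP[u0 _] := ud.
  set w := y t - y (t - u) - _ in Hu.
  have g2 := duality_re_le (y (t - u)) Jy; have g3 := duality_re Jy.
  have g4 := duality_dissipative gen contr (Dy t) Jy.
  have g5 := duality_re_le w Jy.
  have g6 : nrm (y t) * nrm w <= (K * n + 1) * (r * mu / (K * n + 1) * u).
    by apply: ler_pM; rewrite ?nrm_ge0 //; have := y_bound tT; lra.
  have g7 : (K * n + 1) * (r * mu / (K * n + 1) * u) = mu * (r * u).
    by field; rewrite gt_eqF.
  have g8 : re ((P t).1 w) = nrm (y t) ^+ 2 - re ((P t).1 (y (t - u))) -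
      u * (re ((P t).1 (A (y t))) - mu * re ((P t).1 (B (y t)))).
    rewrite /w !(linearB (P t).1) !reB re_functionalZ (linearD (P t).1) reD.
    by rewrite re_functionalZ g3 mulNr.
  have g9 : u * re ((P t).1 (A (y t))) <= 0 by rewrite pmulr_rle0.
  have g10 : u * mu * (gamma t - error t) <= u * mu * re ((P t).1 (B (y t))).
    by rewrite ler_pM2l // mulr_gt0.
  have g11 : nrm (y t) * nrm (y (t - u)) <= 2^-1 * (nrm (y t) ^+ 2 + nrm (y (t - u)) ^+ 2).
    by have := sqr_ge0 (nrm (y t) - nrm (y (t - u))); lra.
  rewrite -(ler_pM2l (mulr_gt0 (ltr0n R 2) mu_gt0)).
  have -> : 2 * mu * (f t - f (t - u)) = nrm (y t) ^+ 2 - nrm (y (t - u)) ^+ 2.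
    by rewrite /f; field; rewrite gt_eqF.
  lra.
have [C' HC'] := gamma_bound.
have := le_trans (m2 Dy0 Jpsi)
  (selection_integral_rate T_gt0 f_continuous error_continuous f_lipschitz f_neg f_rate HC').
rewrite lee_fin => /le_trans; apply; apply: lerD prim_error.
rewrite /f y0E /y max_r // -!expr2 mulrBr //.
Qed.

End Selection.
End Trajectory.
End Decay.

(** * Exponential decay from one period *)
Section ExponentialDecay.
Variables (R : realType) (s : scalars) (X : completeNormedModType (Scal R s)).

Lemma exponential_decay (V : R -> {linear X -> X}) (T K q : R) :
  C0_semigroup V -> 0 < T -> 0 < K -> 0 < q < 1 ->
  (forall t x, 0 <= t <= T -> nrm (V t x) <= K * nrm x) ->
  (forall x, nrm (V T x) <= q * nrm x) ->
  exists M' sigma : R, [/\ 0 < M', 0 < sigma &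
    forall t x, 0 <= t -> nrm (V t x) <= M' * expR (- sigma * t) * nrm x].
Proof.
move=> [_ V0 VD _] T0 K0 /andP[q0 q1] HK Hq.
have lnq : ln q < 0 by rewrite ln_lt0 // q0.
exists (K / q), (- ln q / T); split; rewrite ?divr_gt0 ?oppr_gt0 // => t x t0.
have Hn m : nrm (V (m%:R * T) x) <= q ^+ m * nrm x.
  elim: m => [|m IH]; first by rewrite mul0r V0 mul1r.
  rewrite -natr1 mulrDl mul1r addrC VD ?mulr_ge0 ?(ltW T0) //.
  apply: le_trans (Hq _) _; rewrite exprS -mulrA ler_pM2l //.
pose k := Num.truncn (t / T).
have /andP[k1 k2] : k%:R <= t / T < k.+1%:R by apply: truncn_itv; rewrite divr_ge0 ?(ltW T0).
have kt : k%:R * T <= t by rewrite -ler_pdivlMr.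
have kT : 0 <= k%:R * T by rewrite mulr_ge0 // ltW.
have rT : t - k%:R * T <= T.
  have : t < k.+1%:R * T by rewrite -ltr_pdivrMr.
  by rewrite -natr1 mulrDl mul1r; lra.
have -> : V t x = V (t - k%:R * T) (V (k%:R * T) x) by rewrite -VD ?subr_ge0 // subrK.
apply: le_trans (HK _ _ _) _; first by rewrite subr_ge0 kt.
have qk : q ^+ k.+1 <= expR (- (- ln q / T) * t).
  rewrite -[in leLHS](lnK (x := q)) ?posrE // -expRM_natl ler_expR.
  have -> : - (- ln q / T) * t = (t / T) * ln q by field; rewrite gt_eqF.
  by rewrite ler_wnM2r // ltW.
apply: (@le_trans _ _ (K * (q ^+ k * nrm x))); first by rewrite ler_pM2l.
rewrite mulrA ler_wpM2r ?nrm_ge0 //.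
have -> : K * q ^+ k = K / q * q ^+ k.+1 by rewrite exprS; field; rewrite gt_eqF.
by rewrite ler_pM2l ?divr_gt0.
Qed.

End ExponentialDecay.

Theorem corollary2 (R : realType) (s : scalars)
    (X : completeNormedModType (Scal R s))
    (D : set X) (A : X -> X) (S : R -> {linear X -> X})
    (A_gen : generates D A S) (S_contr : contraction_semigroup S)
    (B : X -> X) (B_bounded : bounded_on_domain D A B)
    (T : R) (T_gt0 : 0 < T)
    (m1 : exists M : R, 0 < M /\ forall y, D y ->
      (\int[lebesgue_measure]_(t in `[0%R, T]) (nrm (B (S t y)))%:E
         <= (M * nrm y)%:E)%E)
    (m2 : exists delta : R, 0 < delta /\
      forall y, D y -> forall phi : R -> {linear X -> (Scal R s)^o},
        (forall t, 0 <= t <= T -> J (S t y) (phi t)) ->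
        ((delta * nrm y ^+ 2)%:E <=
           selection_integral `[0%R, T] (fun t => re (phi t (B (S t y)))))%E)
    (m3 : exists k1 k2 : R, [/\ 0 <= k1, 0 <= k2 &
      forall y z, D y -> D z ->
        exists phi psi : {linear X -> (Scal R s)^o},
          [/\ J y phi, J z psi &
            nrm (phi (B y) - psi (B z)) <=
              k1 * (graph_norm B y + graph_norm B z) * nrm (y - z) +
              k2 * (nrm y + nrm z) * graph_norm B (y - z)]]) :
  exists alpha : R, 0 < alpha /\
    forall mu : R, 0 < mu < alpha -> exp_stabilizes D A B (feedback mu B).
Proof.
have [M [M0 HM]] := m1; have [delta [delta0 Hdelta]] := m2.
have [k1 [k2 [k10 k20 Hk]]] := m3; have [B_linear [C0 HC0]] := B_bounded.
pose C := `|C0|; have C_ge0 : 0 <= C by exact: normr_ge0.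
have B_graph y : D y -> nrm (B y) <= C * (nrm y + nrm (A y)).
  move=> Dy; apply: le_trans (HC0 y Dy) _.
  by rewrite ler_wpM2r ?addr_ge0 ?nrm_ge0 // ler_norm.
(* In turn: the surplus absorbs [mu B]; [mu B] is small in the graph norm; the
   error is at most half the observability constant; and [1 - mu delta] is
   positive. *)
pose c1 := 2 * (1 + M); pose c2 := 2 * (C + 1) * (T / M + 2).
pose c3 := 2 * (`|error_const T M k1 k2| + 1) / delta; pose c4 := 2 * delta.
have TM : 0 < T / M by rewrite divr_gt0.
have c10 : 0 < c1 by rewrite /c1; lra.
have c20 : 0 < c2 by rewrite /c2 !mulr_gt0 //; lra.
have c30 : 0 < c3 by rewrite /c3 divr_gt0 // mulr_gt0 // ltr_wpDl.
have c40 : 0 < c4 by rewrite /c4; lra.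
exists (Num.min (Num.min c1^-1 c2^-1) (Num.min c3^-1 c4^-1)).
split; first by rewrite !lt_min !invr_gt0 c10 c20 c30.
move=> mu /andP[mu0]; rewrite !lt_min => /andP[/andP[mu1 mu2] /andP[mu3 mu4]].
have inv_le (c : R) : 0 < c -> mu < c^-1 -> mu * c <= 1.
  by move=> c0 h; rewrite -ler_pdivlMr // div1r ltW.
have {mu1} mu1 := inv_le _ c10 mu1; have {mu2} mu2 := inv_le _ c20 mu2.
have {mu3} mu3 := inv_le _ c30 mu3; have {mu4} mu4 := inv_le _ c40 mu4.
have mu_M : mu * (1 + M) <= 2^-1 by rewrite /c1 in mu1; lra.
have mu_C : mu * C * (T / M + 2) <= 2^-1.
  have : 0 <= mu * (T / M + 2) by rewrite mulr_ge0 ?ltW //; lra.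
  by rewrite /c2 in mu2; lra.
have [V [V_gen V_bound]] := perturbed_generates A_gen S_contr B_linear B_graph
  T_gt0 M0 HM mu0 mu_M mu_C C_ge0.
exists V; split.
  rewrite (_ : closed_loop _ _ _ = fun y => A y - mu *r B y) //.
  by apply/funext => y; rewrite closed_loop_feedbackE.
have mu_error : mu * error_const T M k1 k2 <= delta / 2.
  have := ler_norm (error_const T M k1 k2) => h.
  have : mu * (`|error_const T M k1 k2| + 1) <= delta / 2.
    by move: mu3; rewrite /c3 mulrA ler_pdivrMr // mul1r; lra.
  have : mu * error_const T M k1 k2 <= mu * `|error_const T M k1 k2| by rewrite ler_pM2l.
  lra.
have rho1 : 0 < 1 - mu * delta < 1.
  have md := mulr_gt0 mu0 delta0; rewrite /c4 in mu4; apply/andP; split; lra.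
have /andP[rho0 rho_lt1] := rho1.
pose q := Num.sqrt (1 - mu * delta).
have q0 : 0 < q by rewrite sqrtr_gt0.
have q1 : q < 1 by rewrite -sqrtr1 ltr_sqrt.
(* [decay_step] with [mu * error_const <= delta / 2] leaves
   [|V T x|^2 <= (1 - mu delta) |x|^2]. *)
have V_D x : D x -> nrm (V T x) <= q * nrm x.
  move=> Dx; rewrite -(ler_pXn2r (n := 2)) ?nnegrE ?mulr_ge0 ?nrm_ge0 ?(ltW q0) //.
  rewrite exprMn sqr_sqrtr ?(ltW rho0) //.
  have := decay_step A_gen S_contr B_linear B_graph T_gt0 M0 HM mu0 mu_M mu_C C_ge0
    V_gen V_bound Dx k10 k20 Hdelta Hk.
  set n2 := nrm x ^+ 2; set N2 := nrm (V T x) ^+ 2 => Hs.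
  have n20 : 0 <= n2 by rewrite sqr_ge0.
  have h1 : mu * error_const T M k1 k2 * n2 <= delta / 2 * n2 by rewrite ler_wpM2r.
  have h2 : delta / 2 * n2 <= (2 * mu)^-1 * (n2 - N2) by lra.
  have mu20 : 0 < 2 * mu by rewrite mulr_gt0.
  by move: h2; rewrite ler_pdivlMl //; lra.
have K0 : 0 < growth M by rewrite mulr_gt0 ?expR_gt0 ?addr_gt0.
have V_T t x : 0 <= t <= T -> nrm (V t x) <= growth M * nrm x.
  by move=> tT; apply: growth_bound tT.
apply: (@exponential_decay _ _ _ V T (growth M) q) => //; first by have [] := V_gen.
  by rewrite q0.
move=> x; apply: (@le_addM_eps _ _ _ (q + growth M)) => e e0.
have [d Dd Hd] := domain_dense A_gen S_contr x e0.
have g1 := V_D d Dd; have g2 := V_T T (d - x); rewrite lexx (ltW T_gt0) in g2.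
have {}g2 := g2 isT; rewrite (linearB (V T)) in g2.
have g3 := nrm_sub (V T x) (V T d); rewrite nrmC in g3.
have g4 : growth M * nrm (d - x) <= growth M * e by rewrite ler_pM2l.
have g5 : q * nrm d <= q * (nrm x + e).
  by rewrite ler_pM2l //; have := nrm_sub d x; lra.
lra.
Qed.
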